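(* Consider the shape invariant model $Y_{i,j}=a_jf(X_i-\theta_j)+v_j+\varepsilon_{i,j}$, $1\le j\le p$, $i\ge 1$, under the assumptions listed in the context, and for $n\ge 1$ let $\widehat v_n=(\widehat v_{n,1},\dots,\widehat v_{n,p})^T$ be defined by $$\widehat v_{n,j}=\frac1n\sum_{i=1}^n\frac{Y_{i,j}}{g(X_i)},\qquad 1\le j\le p.$$ Let $\Gamma(v)=\mathrm{Cov}\left(\frac{Y}{g(X)}\right)$ be the $p\times p$ covariance matrix of the random vector $Y/g(X)$. Then: (i) $\lim_{n\to+\infty}\widehat v_n=v$ almost surely; (ii) $\sqrt n\,(\widehat v_n-v)$ converges in distribution to $\mathcal N_p(0,\Gamma(v))$ as $n\to+\infty$; (iii) (quadratic strong law) $$\lim_{n\to+\infty}\frac1{\log n}\sum_{i=1}^n(\widehat v_i-v)(\widehat v_i-v)^T=\Gamma(v)\quad\text{almost surely.}$$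
   Context: Setting. Let $p\ge2$ be an integer. - $(X_i)_{i\ge1}$ are independent identically distributed real random variables with probability density $g$; $g$ is zero outside $[-1/2,1/2]$, strictly positive on $[-1/2,1/2]$, and on $[-1/2,1/2]$ it is continuous and twice differentiable with bounded derivatives. - $f:\mathbb R\to\mathbb R$ is (measurable,) symmetric ($f(-x)=f(x)$), bounded, periodic with period $1$, and $\int_{-1/2}^{1/2}f(x)\,dx=0$. - $a=(a_1,\dots,a_p)^T$, $\theta=(\theta_1,\dots,\theta_p)^T$, $v=(v_1,\dots,v_p)^T$ are vectors of $\mathbb R^p$ with $a_j\ne0$ for all $j$, $a_1=1$, $\theta_1=0$ and $\max_{1\le j\le p}|\theta_j|<1/4$. - The noise variables $(\varepsilon_{i,j})_{i\ge1,1\le j\le p}$ are mutually independent, independent of $(X_i)_{i\ge 1}$, with mean zero and variance $\mathbb E[\varepsilon_{i,j}^2]=\sigma_j^2$; for each $j$ the variables $(\varepsilon_{i,j})_{i\ge1}$ are identically distributed. - $Y=(Y_1,\dots,Y_p)^T$ with $Y_j=a_jf(X-\theta_j)+v_j+\varepsilon_j$, where $(X,\varepsilon_1,\dots,\varepsilon_p)$ has the same distribution as $(X_i,\varepsilon_{i,1},\dots,\varepsilon_{i,p})$. *)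

(* Defs.v *)
From HB Require Import structures.
From mathcomp Require Import all_boot all_order all_algebra finmap.
From mathcomp Require Import all_classical all_reals all_analysis.

Set Implicit Arguments.
Unset Strict Implicit.
Unset Printing Implicit Defensive.

Import Order.TTheory GRing.Theory Num.Theory.
Import numFieldTopology.Exports numFieldNormedType.Exports.

Local Open Scope classical_set_scope.
Local Open Scope ring_scope.

Notation borel T := (g_sigma_algebraType (@open T)).

Section independence.
Context d (Omega : measurableType d) (R : realType) (P : probability Omega R).

Definition mutually_independent (I : choiceType) (Z : I -> {RV P >-> R}) :=
  forall (J : {fset I}) (B : I -> set R),
    (forall i, i \in J -> measurable (B i)) ->
    P (\bigcap_(i in [set` J]) (Z i @^-1` B i)) =
    (\prod_(i <- J) P (Z i @^-1` B i))%E.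

Definition sigma_of_family (I : Type) (Z : I -> {RV P >-> R}) :
    set (set Omega) :=
  <<s \bigcup_i preimage_set_system setT (Z i) measurable >>.

Definition independent_families (I J : Type) (Z : I -> {RV P >-> R})
    (W : J -> {RV P >-> R}) :=
  forall A B, sigma_of_family Z A -> sigma_of_family W B ->
    P (A `&` B) = (P A * P B)%E.

End independence.

Section distributions.
Context d (Omega : measurableType d) (R : realType) (P : probability Omega R).

Definition same_distribution d' (E : measurableType d') (U V : Omega -> E) :=
  forall B : set E, measurable B -> P (U @^-1` B) = P (V @^-1` B).

Definition has_density (X : {RV P >-> R}) (g : R -> R) :=
  forall B : set R, measurable B ->
    distribution P X B = (\int[lebesgue_measure]_(x in B) (g x)%:E)%E.

Definition cvg_in_distribution (E : ptopologicalType)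
    (Z : nat -> Omega -> E) (mu : probability (borel E) R) :=
  forall h : E -> R, continuous h -> bounded_fun h ->
    ('E_P[h \o Z n] @[n --> \oo] --> 'E_mu[h])%E.

Definition covariance_matrix p (Z : Omega -> 'cV[R]_p) : 'M[R]_p :=
  \matrix_(j, k)
    fine (covariance P (fun w => Z w j 0) (fun w => Z w k 0)).

End distributions.

Section gaussian.
Context (R : realType).

(* N(m, s2) on R, equal to the Dirac mass at m when s2 = 0; the library's
   [normal_prob] takes the standard deviation, and for standard deviation 0
   it is the uniform law on [0, 1]. *)
Definition normal_law (m s2 : R) (B : set R) : \bar R :=
  if s2 == 0 then \d_m B else normal_prob m (Num.sqrt s2) B.

(* mu is N_p(m, S), S possibly singular: every linear form u^T x has, under mu,
   the law N(u^T m, u^T S u). *)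
Definition is_multivariate_normal p (m : 'cV[R]_p) (S : 'M[R]_p)
    (mu : probability (borel 'cV[R]_p) R) :=
  forall (u : 'cV[R]_p) (B : set R), measurable B ->
    mu [set x : 'cV[R]_p | B ((u^T *m x) 0 0)] =
    normal_law ((u^T *m m) 0 0) ((u^T *m S *m u) 0 0) B.

End gaussian.

(* g' is the derivative of g on A relative to A: one-sided at the end points
   when A is a segment. *)
Definition has_derivative_within (R : realType) (A : set R) (g g' : R -> R) :=
  forall x, A x ->
    (g y - g x) / (y - x) @[y --> within A (x^')] --> g' x.

Section shape_invariant_model.
Context (R : realType) (p : nat).

Definition sim_response (f : R -> R) (a theta v : 'cV[R]_p)
    (x : R) (e : 'I_p -> R) : 'cV[R]_p :=
  \col_j (a j 0 * f (x - theta j 0) + v j 0 + e j).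

(* Observations are numbered from 0: the first n ones are those of index
   i < n. *)
Definition v_hat (Omega : Type) (g : R -> R) (X : nat -> Omega -> R)
    (Y : nat -> Omega -> 'cV[R]_p) (n : nat) (w : Omega) : 'cV[R]_p :=
  \col_j (n%:R^-1 * \sum_(i < n) Y i w j 0 / g (X i w)).

End shape_invariant_model.

(* Main.v *)
(* Since 1/g is bounded on the support of X_i, f integrates to 0 over a period and
   the noise is centered and independent of X_i, the residuals
   xi_i = Y_i / g(X_i) - v are i.i.d., centered and square integrable, and
   v_hat_n - v is the mean of the first n of them.  Through the linear forms
   W_i = u^T xi_i everything reduces to i.i.d. real variables with partial sums S_n.
   - The strong law follows from L^2 bounds along the squares n = m^2.
   - Telescoping S_n^2 / n expresses the sum of the (S_k / k)^2 by the sum of the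
     W_k^2 / k, after truncation, and by martingales; all remainders are almost
     surely o(log n) along n = 2^(m^2), which suffices because the sum of squares
     is monotone.  Polarization gives the matrix statement.
   - By tightness and uniform approximation by trigonometric polynomials,
     convergence in distribution follows from that of E cos (u^T Z_n + b).  This
     expectation obeys a linear recursion in the number of summands, and so does its
     Gaussian counterpart, with coefficients that agree up to o(1/n).
   - N_p(0, Gamma) is the law of a sum of independent vectors z_k b_k, with z_k
     standard normal and Gamma the sum of the b_k b_k^T. *)
Require Import Defs.
From HB Require Import structures.
From mathcomp Require Import all_boot all_order all_algebra finmap.
From mathcomp Require Import all_classical all_reals all_analysis.
From mathcomp Require Import measurable_realfun.
From mathcomp Require Import zify ring lra.

Set Implicit Arguments.
Unset Strict Implicit.
Unset Printing Implicit Defensive.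

Import Order.TTheory GRing.Theory Num.Theory.
Import numFieldTopology.Exports numFieldNormedType.Exports.

Local Open Scope classical_set_scope.
Local Open Scope ring_scope.

(** * Deterministic sums *)

(** Only second moments are available, and this shapes both limit theorems. In the quadratic strong
    law [W_k^2] need not have a variance, so it is truncated at level [k + 1]; the truncated squares
    divided by [k + 1] have summable variances, and almost surely the truncation is inactive from
    some rank on. The cross terms [S_k W_k / (k + 1)] sum to a martingale with variance of order
    [log n]; after division by [log n] this leaves [1 / log n], which is summable along [2^(m^2)]
    but not along [2^m], while consecutive logarithms still have ratios tending to 1. In the central
    limit theorem a phase replaces complex exponentials: since [sin x = - cos (x + pi / 2)], the
    family of expectations [E cos (Z + b)], over all real [b], is closed under adding an independent
    summand to [Z]. The Gaussian value of such an expectation is never computed. A normal variable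
    is itself a normalized sum of independent normal variables, so the sample and the limit law are
    both compared with [(1 - v / (2 n))^n cos b]. The covariance may be singular, so Gaussian laws
    are handled as images of the standard normal law rather than through densities. *)

Lemma cvg_sqr (R : realType) (u : nat -> R) (l : R) :
  u n @[n --> \oo] --> l -> u n ^+ 2 @[n --> \oo] --> l ^+ 2.
Proof.
by move=> ul; under eq_fun do rewrite expr2; rewrite expr2; exact: cvgM.
Qed.

Lemma sqr_cvg0 (R : realType) (u : nat -> R) :
  u n ^+ 2 @[n --> \oo] --> 0 -> u n @[n --> \oo] --> 0.
Proof.
move=> u0; apply/norm_cvg0P.
have -> : (fun n => `|u n|) = (fun n => Num.sqrt (u n ^+ 2)).
  by apply/funext => n; rewrite sqrtr_sqr.
rewrite -[X in _ --> X](sqrtr0 R).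
by apply: continuous_cvg => //; exact: sqrt_continuous.
Qed.

(** Serves to carry a limit along a sparse sequence [N] over to all indices: [k n] is the number of
    the block that contains [n]. Raising [k] by at most one per step suffices because [N] is
    strictly increasing; before [N 0] the value is 0. *)
Lemma block_index (N : nat -> nat) : (forall m, N m < N m.+1)%N ->
  exists2 k : nat -> nat,
    forall n, (N 0 <= n)%N -> (N (k n) <= n < N (k n).+1)%N &
    k n @[n --> \oo] --> \oo.
Proof.
move=> Ninc.
pose k := fix k n := if n is n'.+1 then
  (if (N (k n').+1 <= n'.+1)%N then (k n').+1 else k n') else 0%N.
have kP n : (n < N (k n).+1)%N /\ ((N (k n) <= n)%N \/ k n = 0%N).
  elim: n => [|n [IH1 IH2]].
    by split; [exact: leq_ltn_trans (Ninc 0%N)|right].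
  rewrite /=; case: ifPn => [le|].
    by split; [exact: leq_ltn_trans (Ninc _)|left].
  rewrite -ltnNge => lt; split=> //.
  by case: IH2 => [/leqW|]; [left|right].
have Nm : {mono N : i j / (i <= j)%N}.
  by apply: leq_mono; apply: homo_ltn => //; exact: ltn_trans.
exists k => [n N0|].
  by have [-> [->|->]] := kP n; rewrite ?N0.
apply/cvgnyPge => K; near=> n.
have [nk _] := kP n.
have : (N K < N (k n).+1)%N by apply: leq_ltn_trans nk; near: n; exact: nbhs_infty_ge.
by rewrite ltnNge Nm -ltnNge ltnS.
Unshelve. all: by end_near. Qed.

Section harmonic_sums.
Context (R : realType).
Implicit Types (e : nat -> R) (x : R).

(** Both bounds are [ln (1 + x) <= x], at [x = - 1 / (n + 1)] and at [x = 1 / n]. *)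
Lemma ln_natS_bounds n : (0 < n)%N ->
  n.+1%:R^-1 <= (ln n.+1%:R - ln n%:R : R) <= n%:R^-1.
Proof.
move=> n0; have n0' : 0 < n%:R :> R by rewrite ltr0n.
have S0 : 0 < n.+1%:R :> R by [].
apply/andP; split.
  have : ln (1 + - n.+1%:R^-1) <= - n.+1%:R^-1 :> R.
    by apply: le_ln1Dx; rewrite ltrN2 invf_lt1// ltr1n ltnS.
  have -> : 1 + - n.+1%:R^-1 = n%:R / n.+1%:R :> R.
    by rewrite -[in n%:R](addrK 1 n%:R) natr1 mulrBl divff ?gt_eqF// mul1r.
  by rewrite ln_div ?posrE// lerNr opprB.
have : ln (1 + n%:R^-1) <= n%:R^-1 :> R.
  by apply: le_ln1Dx; apply: lt_trans (_ : 0 < _); rewrite ?ltrN10 ?invr_gt0.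
have -> : 1 + n%:R^-1 = n.+1%:R / n%:R :> R.
  by rewrite -natr1 mulrDl divff ?gt_eqF// mul1r.
by rewrite ln_div ?posrE//.
Qed.

Lemma cvg_ln_nat : ln n%:R @[n --> \oo] --> (+oo : set_system R).
Proof.
apply/cvgryPge => A; near=> n.
have n0 : (0 < n)%N by near: n; exact: nbhs_infty_ge.
rewrite -[A]expRK ler_ln ?posrE ?expR_gt0 ?ltr0n//.
by near: n; exact: (cvgryPge _).1 (@cvgr_idn R) _.
Unshelve. all: by end_near. Qed.

Lemma sum_inv_natS_bounds n : (0 < n)%N ->
  (ln n%:R : R) <= \sum_(0 <= k < n) k.+1%:R^-1 <= (1 + ln n%:R : R).
Proof.
move=> n0; apply/andP; split.
  apply: (@le_trans _ _ (ln n.+1%:R)); first by rewrite ler_ln ?posrE ?ltr0n// ler_nat.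
  elim: n {n0} => [|n IH]; first by rewrite ln1 big_geq.
  rewrite big_nat_recr//=; have /andP[_] := @ln_natS_bounds n.+1 isT.
  by rewrite lerBlDl => /le_trans; apply; rewrite lerD2r.
elim: n n0 => // -[|n] IH _; first by rewrite big_nat1 invr1 ln1; lra.
rewrite big_nat_recr//=; have /andP[+ _] := @ln_natS_bounds n.+1 isT.
by move=> /(lerD (IH isT)) /le_trans; apply; rewrite -addrA [ln n.+1%:R + _]addrC subrK.
Qed.

(** A weighted Cesàro mean: the weights [1 / (k + 1)] have total mass [ln n + O(1)], and the
    finitely many terms far from [l] add up to a constant [C], which [ln n] absorbs. *)
Lemma log_mean_cvg e (l : R) : e k @[k --> \oo] --> l ->
  (\sum_(0 <= k < n) e k / k.+1%:R) / ln n%:R @[n --> \oo] --> l.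
Proof.
move=> el; apply/cvgrPdist_le => eps eps0.
have eps2 : 0 < eps / 4 by rewrite divr_gt0.
have [K _ KP] : \forall k \near \oo, `|l - e k| <= eps / 4.
  exact: (cvgrPdist_le _ _).1 el _ eps2.
pose C := \sum_(0 <= k < K) `|l - e k| / k.+1%:R.
have sumP n : `|\sum_(0 <= k < n) (l - e k) / k.+1%:R| <=
    C + eps / 4 * \sum_(0 <= k < n) k.+1%:R^-1.
  apply: le_trans (ler_norm_sum _ _ _) _.
  have -> : C = \sum_(0 <= k < K) `|l - e k| / k.+1%:R by [].
  have le1 k : `|(l - e k) / k.+1%:R| <=
      (if (k < K)%N then `|l - e k| / k.+1%:R else 0) + eps / 4 * k.+1%:R^-1.
    rewrite normrM [X in _ * X]gtr0_norm ?invr_gt0//; case: ltnP => kK.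
      by rewrite lerDl mulr_ge0 ?invr_ge0// ltW.
    by rewrite add0r ler_wpM2r ?invr_ge0//; exact: KP.
  apply: le_trans (ler_sum _ (fun k _ => le1 k)) _.
  rewrite big_split/= -mulr_sumr lerD2r -big_mkcond/=.
  rewrite [leRHS](big_cat_nat (n := minn K n))//= ?geq_minl//.
  have -> : \sum_(0 <= k < n | (k < K)%N) `|l - e k| / k.+1%:R =
            \sum_(0 <= k < minn K n) `|l - e k| / k.+1%:R.
    rewrite [RHS](big_nat_widen _ _ n) ?geq_minr//= big_nat_cond [RHS]big_nat_cond.
    by apply: eq_bigl => k; rewrite leq_min andbC; case: (k < n)%N; rewrite ?andbT ?andbF.
  by rewrite lerDl; apply: sumr_ge0 => k _; rewrite mulr_ge0 ?invr_ge0.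
near=> n.
have n0 : (0 < n)%N by near: n; exact: nbhs_infty_ge.
have ln1 : 1 <= ln n%:R :> R by near: n; exact: (cvgryPge _).1 cvg_ln_nat _.
have lnC : 4 * (C + `|l|) / eps <= ln n%:R :> R.
  by near: n; exact: (cvgryPge _).1 cvg_ln_nat _.
have L0 : 0 < ln n%:R :> R by apply: lt_le_trans ln1.
have /andP[H1 H2] := sum_inv_natS_bounds n0.
set H := \sum_(0 <= k < n) k.+1%:R^-1 in H1 H2.
have := sumP n; rewrite -/H.
have -> : \sum_(0 <= k < n) (l - e k) / k.+1%:R =
    l * H - \sum_(0 <= k < n) e k / k.+1%:R.
  rewrite mulr_sumr -sumrB; apply: eq_bigr => k _; exact: mulrBl.
set S := \sum_(0 <= k < n) e k / _ => SP.
have -> : l - S / ln n%:R = (l * ln n%:R - S) / ln n%:R.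
  by rewrite mulrBl mulfK// gt_eqF.
rewrite normrM [X in _ * X]gtr0_norm ?invr_gt0// ler_pdivrMr//.
have lH : `|l * ln n%:R - l * H| <= `|l|.
  rewrite -mulrBr normrM ler_piMr// ler_norml; lra.
have : `|l * ln n%:R - S| <= `|l * ln n%:R - l * H| + `|l * H - S|.
  by apply: le_trans (ler_normD _ _); rewrite addrA subrK.
move: lnC; rewrite ler_pdivrMr// => lnC.
have C0 : 0 <= C by apply: sumr_ge0 => k _; rewrite mulr_ge0 ?invr_ge0.
have : eps / 4 * H <= eps / 4 * (1 + ln n%:R) by rewrite ler_wpM2l// ltW.
move: SP lH lnC; set a := `|_ - S|; set b := `|_ - S|; set c := `|_ - _|.
have : 0 <= eps * (ln n%:R - 1) by rewrite mulr_ge0 ?subr_ge0// ltW.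
lra.
Unshelve. all: by end_near. Qed.

(** With [x = W^2] this bounds, pointwise and uniformly in [n], the sum of the normalized second
    moments of the truncated squares. The truncation leaves only [k + 1 >= x], where the sum of
    [1 / (k + 1)^2] is of order [1 / x]. *)
Lemma sum_truncated_sqr_le x n : 0 <= x ->
  \sum_(0 <= k < n) (if x <= k.+1%:R then x ^+ 2 else 0) / k.+1%:R ^+ 2 <= 2 * x.
Proof.
rewrite le_eqVlt => /predU1P[<-|x0].
  rewrite big1 ?mulr0// => k _; rewrite expr0n/=; case: ifP; by rewrite mul0r.
(* Strengthened for the induction: once [x <= n], the increments of [- x^2 / n] dominate the new
   terms [x^2 / (n + 1)^2]; before that the sum is empty of nonzero terms. *)
suff H : \sum_(0 <= k < n) (if x <= k.+1%:R then x ^+ 2 else 0) / k.+1%:R ^+ 2 <=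
    if x <= n%:R then 2 * x - x ^+ 2 / n%:R else 0.
  apply: le_trans H _; case: ifPn => [xn|_]; last by rewrite mulr_ge0// ltW.
  by rewrite gerBl mulr_ge0 ?sqr_ge0 ?invr_ge0.
elim: n => [|n IH]; first by rewrite big_geq//; case: ifPn => //; rewrite leNgt x0.
rewrite big_nat_recr//=; apply: le_trans (lerD IH (lexx _)) _ => {IH}.
have S0 : 0 < n.+1%:R :> R by [].
case: (lerP x n%:R) => xn.
  have n0 : 0 < n%:R :> R by apply: lt_le_trans xn.
  rewrite (le_trans xn) ?ler_nat//.
  rewrite -subr_ge0; have -> : n.+1%:R = n%:R + 1 :> R by rewrite natr1.
  have -> : 2 * x - x ^+ 2 / (n%:R + 1) - (2 * x - x ^+ 2 / n%:R + x ^+ 2 / (n%:R + 1) ^+ 2)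
     = x ^+ 2 / (n%:R * (n%:R + 1) ^+ 2).
    by field; rewrite !gt_eqF// addr_gt0.
  by rewrite divr_ge0 ?sqr_ge0// mulr_ge0 ?sqr_ge0// ltW.
rewrite add0r; case: (lerP x n.+1%:R) => xS; last by rewrite mul0r.
have n1 : 1 <= n.+1%:R :> R by rewrite ler1n.
move: (n.+1%:R) S0 xS n1 => y y0 xy y1; rewrite -subr_ge0.
have -> : 2 * x - x ^+ 2 / y - x ^+ 2 / y ^+ 2 = x / y * ((y - x) + (y - x / y)).
  by field; rewrite gt_eqF.
apply: mulr_ge0; first by rewrite divr_ge0 ?ltW.
apply: addr_ge0; rewrite subr_ge0//.
by rewrite (le_trans _ y1)// ler_pdivrMr// mul1r.
Qed.

(** Integrated with [x = W^2], it bounds the sum of the probabilities of [W^2 > k + 1] by the second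
    moment. The induction needs the sharper bound by the minimum of [x] and [n]. *)
Lemma sum_tail_indicator_le x n : 0 <= x ->
  \sum_(0 <= k < n) (if k.+1%:R < x then 1 else 0) <= x.
Proof.
move=> x0; suff : \sum_(0 <= k < n) (if k.+1%:R < x then 1 else 0) <= Num.min x n%:R.
  by rewrite le_min => /andP[].
elim: n => [|n]; first by rewrite big_geq// le_min x0/=.
rewrite big_nat_recr//= !le_min => /andP[ix ixn].
case: ltP => xn; last by rewrite addr0 ix (le_trans ixn) ?ler_nat.
rewrite -natr1 lerD2r ixn andbT (le_trans _ (ltW xn))//.
by rewrite -natr1 lerD2r.
Qed.

End harmonic_sums.

Lemma cvg_ratio_succ (R : realType) : k.+1%:R / k.+2%:R @[k --> \oo] --> (1 : R).
Proof.
have -> : (fun k => k.+1%:R / k.+2%:R) = (fun k => 1 - @harmonic R k.+1).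
  apply/funext => k; rewrite /harmonic/= -[k.+1%:R](addrK 1) natr1 mulrBl divff//.
  by rewrite mul1r.
rewrite -[X in _ --> X]subr0; apply: cvgB; first exact: cvg_cst.
by rewrite (cvg_shiftS (@harmonic R)); exact: cvg_harmonic.
Qed.

(** Between two consecutive points [2^((m+1)^2)] a monotone [q] is squeezed by its values there, at
    the cost of the ratio [((m+1) / (m+2))^2] of the logarithms, which tends to 1. The argument
    [n.+1] is harmless since [n < N (k n).+1]. *)
Lemma log_interpolation (R : realType) (q : nat -> R) (L : R) :
    {homo q : m n / (m <= n)%N >-> m <= n} -> (forall n, 0 <= q n) ->
    q (2 ^ m.+1 ^ 2)%N / ((m.+1 ^ 2)%:R * ln 2) @[m --> \oo] --> L ->
  q n.+1 / ln n%:R @[n --> \oo] --> L.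
Proof.
move=> qmono q0 qL; pose N m := (2 ^ m.+1 ^ 2)%N.
have Ninc m : (N m < N m.+1)%N by rewrite ltn_exp2l// ltn_exp2r.
have [k kP kinfty] := block_index Ninc.
have ln2 : 0 < ln (2 : R) by rewrite ln_gt0// ltr1n.
have lnN m : ln (N m)%:R = (m.+1 ^ 2)%:R * ln 2 :> R.
  by rewrite /N [in LHS]natrX lnXn// mulr_natl.
pose a m := q (N m) / ((m.+1 ^ 2)%:R * ln 2).
have aL : a m @[m --> \oo] --> L by [].
pose r m := m.+1%:R / m.+2%:R : R.
have r0 m : 0 < r m by rewrite divr_gt0.
have r1 : r m @[m --> \oo] --> (1 : R) by exact: cvg_ratio_succ.
have lower : a m * r m ^+ 2 @[m --> \oo] --> L.
  rewrite -[X in _ --> X]mulr1 -[X in _ * X](expr1n _ 2).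
  by apply: cvgM => //; exact: cvg_sqr.
have upper : a m.+1 * (r m)^-1 ^+ 2 @[m --> \oo] --> L.
  rewrite -[X in _ --> X]mulr1 -[X in _ * X](expr1n _ 2) -[X in X ^+ 2]invr1.
  apply: cvgM; first by rewrite (cvg_shiftS a).
  by apply: cvg_sqr; apply: cvgV => //; exact: oner_neq0.
apply: (squeeze_cvgr (f := fun n => a (k n) * r (k n) ^+ 2)
  (h := fun n => a (k n).+1 * (r (k n))^-1 ^+ 2)).
- near=> n.
  have n2 : (1 < n)%N by near: n; exact: nbhs_infty_ge.
  have /andP[kn nk] : (N (k n) <= n < N (k n).+1)%N by exact: kP.
  have n0 : 0 < n%:R :> R by rewrite ltr0n ltnW.
  have lnn : 0 < ln (n%:R : R) by rewrite ln_gt0// ltr1n.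
  have N0 m : 0 < (N m)%:R :> R by rewrite ltr0n expn_gt0.
  have l0 m : 0 < (m.+1 ^ 2)%:R * ln 2 :> R by rewrite mulr_gt0// ltr0n.
  have lnk : (((k n).+1 ^ 2)%:R * ln 2 : R) <= ln n%:R.
    by rewrite -lnN ler_ln ?posrE// ler_nat.
  have lnk1 : ln n%:R <= ((k n).+2 ^ 2)%:R * ln 2 :> R.
    by rewrite -lnN ler_ln ?posrE// ler_nat ltnW.
  apply/andP; split.
    apply: (@le_trans _ _ (q (N (k n)) / (((k n).+2 ^ 2)%:R * ln 2))).
      rewrite le_eqVlt; apply/orP; left; apply/eqP.
      rewrite /a /r !natrX; field.
      by rewrite !gt_eqF//.
    apply: ler_pM => //; first by rewrite invr_ge0 ltW.
      by apply: qmono; rewrite leqW.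
    by rewrite lef_pV2 ?posrE.
  apply: (@le_trans _ _ (q (N (k n).+1) / (((k n).+1 ^ 2)%:R * ln 2))).
    apply: ler_pM => //; first by rewrite invr_ge0 ltW.
      exact: qmono.
    by rewrite lef_pV2 ?posrE.
  rewrite le_eqVlt; apply/orP; left; apply/eqP.
  rewrite /a /r !natrX; field.
  by rewrite !gt_eqF//.
- exact: (cvg_comp _ _ kinfty lower).
- exact: (cvg_comp _ _ kinfty upper).
Unshelve. all: by end_near. Qed.

(** * Independence *)

Section independence_of_sigma_algebras.
Context d (Omega : measurableType d) (R : realType) (P : probability Omega R).

(** As functions of [A] both sides are finite measures; they agree on the pi-system [G], which
    contains the whole space, hence on the sigma-algebra it generates. *)
Lemma eq_prob_sigma_algebra (G : set (set Omega)) (B : set Omega) :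
    G `<=` measurable -> setI_closed G -> G setT -> measurable B ->
    (forall A, G A -> P (A `&` B) = (P A * P B)%E) ->
  forall A, <<s G >> A -> P (A `&` B) = (P A * P B)%E.
Proof.
move=> Gm GI GT mB GB A sA.
have PB0 : 0 <= fine (P B) by exact: fine_ge0.
have E := g_sigma_algebra_measure_unique G Gm (fun=> setT)
  (fun=> GT) _ (mrestr P mB) (mscale (NngNum PB0) P) GI.
have mscaleE C : mscale (NngNum PB0) P C = (P C * P B)%E.
  by rewrite /mscale/= fineK ?fin_num_measure// muleC.
rewrite -mscaleE -E//.
- by rewrite bigcup_const.
- by move=> C GC; have := mscaleE C; rewrite -GB// => <-.
- by move=> _; rewrite /= /mrestr setTI -ge0_fin_numE// fin_num_measure.
Qed.

Section disjoint_index_sets.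
Context (I : choiceType) (Z : I -> {RV P >-> R}).

Definition sigma_of_subfamily (D : set I) : set (set Omega) :=
  <<s \bigcup_(i in D) preimage_set_system setT (Z i) measurable >>.

(** The preimages that generate [sigma_of_subfamily D] are not stable under intersection; these
    finite-dimensional cylinders generate the same events and are, as uniqueness of measures
    requires. *)
Let cylinder (D : set I) : set (set Omega) :=
  [set A | exists (J : {fset I}) (B : I -> set R),
    [/\ [set` J] `<=` D, forall i, measurable (B i) &
        A = \bigcap_(i in [set` J]) (Z i @^-1` B i)]].

Let cylinder_measurable D A : cylinder D A -> measurable A.
Proof.
move=> [J [B [_ mB ->]]]; apply: fin_bigcap_measurable => // i _.
by rewrite -[X in measurable X]setTI; exact: measurable_funPT.
Qed.

Let setI_cylinder D : setI_closed (cylinder D).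
Proof.
move=> _ _ [J1 [B1 [JD1 mB1 ->]]] [J2 [B2 [JD2 mB2 ->]]].
exists (J1 `|` J2)%fset, (fun i => (if i \in J1 then B1 i else setT) `&`
                                   (if i \in J2 then B2 i else setT)).
split=> [i /=|i|].
- by rewrite in_fsetU => /orP[iJ|iJ]; [exact: JD1|exact: JD2].
- by apply: measurableI; case: ifP.
apply/seteqP; split=> w /=.
  move=> [w1 w2] i /= _; split; case: ifPn => // iJ;
    [exact: w1|exact: w2].
move=> w12; split=> i /= iJ.
  by have /= := w12 i; rewrite in_fsetU iJ/= => /(_ isT)[].
by have /= := w12 i; rewrite in_fsetU iJ orbT/= => /(_ isT)[].
Qed.

Let cylinderT D : cylinder D setT.
Proof.
exists fset0, (fun=> setT); split=> //.
by rewrite (_ : [set` fset0] = set0) ?bigcap_set0//; apply/seteqP; split.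
Qed.

Let sigma_cylinder D : sigma_of_subfamily D `<=` <<s cylinder D >>.
Proof.
apply: sub_sigma_algebra2 => A [i Di [B mB <-]].
exists [fset i]%fset, (fun=> B); split=> //.
  by move=> j /=; rewrite inE => /eqP ->.
rewrite setTI; apply/seteqP; split=> w /= wB; first by move=> j /=; rewrite inE => /eqP ->.
by apply: wB; rewrite /= inE.
Qed.

Let sigma_cylinder_measurable D A : <<s cylinder D >> A -> measurable A.
Proof.
apply: smallest_sub; last exact: cylinder_measurable.
exact: sigma_algebra_measurable.
Qed.

Hypothesis Zind : mutually_independent Z.

(** The uniqueness argument is applied to each of the two events in turn. For two cylinders the
    claim is the product formula over the disjoint union of their index sets. *)
Lemma mutually_independent_disjoint (D E : set I) A B : D `&` E = set0 ->
  sigma_of_subfamily D A -> sigma_of_subfamily E B ->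
  P (A `&` B) = (P A * P B)%E.
Proof.
move=> DE /sigma_cylinder sA /sigma_cylinder sB.
have mB := sigma_cylinder_measurable sB.
apply: eq_prob_sigma_algebra sA => //.
  exact: cylinder_measurable.
move=> {}A cA; have mA := cylinder_measurable cA.
rewrite setIC muleC; apply: eq_prob_sigma_algebra sB => //.
  exact: cylinder_measurable.
move=> {mB} _ [J2 [B2 [JD2 mB2 ->]]].
case: cA {mA} => J1 [B1 [JD1 mB1 ->]].
have J12 i : i \in J1 -> i \in J2 -> False.
  move=> i1 i2; rewrite -[False]/(set0 i) -DE; split; [exact: JD1|exact: JD2].
(* The two families of Borel sets merge into one because no index is shared. *)
pose C i := if i \in J1 then B1 i else B2 i.
have -> : \bigcap_(i in [set` J2]) (Z i @^-1` B2 i) `&`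
          \bigcap_(i in [set` J1]) (Z i @^-1` B1 i) =
          \bigcap_(i in [set` J1 `|` J2]%fset) (Z i @^-1` C i).
  apply/seteqP; split=> w /=.
    move=> [w2 w1] i /=; rewrite in_fsetU /C; case: ifPn => [iJ _|_ /= iJ].
      exact: w1.
    exact: w2.
  move=> w12; split=> i /= iJ; have /= := w12 i; rewrite in_fsetU iJ ?orbT/=;
    move=> /(_ isT); rewrite /C ?iJ//.
  by case: ifPn => // iJ1; case: (J12 i).
rewrite Zind; last by move=> i _; rewrite /C; case: ifP.
rewrite (perm_big (J2 ++ J1))/=; last first.
  apply: uniq_perm => //.
    rewrite cat_uniq !fset_uniq andbT/=; apply/hasPn => i i1.
    by apply/negP => i2; exact: (J12 i).
  by move=> i; rewrite mem_cat in_fsetU orbC.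
rewrite big_cat/= !Zind; do ?[by move=> i _].
congr (_ * _)%E; apply: eq_big_seq => i iJ; rewrite /C ?iJ//.
by case: ifPn => // iJ1; case: (J12 i).
Qed.

End disjoint_index_sets.
End independence_of_sigma_algebras.

Definition measurable_function d d' (T : measurableType d)
    (U : measurableType d') (f : T -> U) (mf : measurable_fun setT f) :
  {mfun T >-> U} := HB.pack f (isMeasurableFun.Build _ _ _ _ f mf).

Section product_of_independent.
Context d (Omega : measurableType d) (R : realType) (P : probability Omega R).

(** Stated for bare functions, so that it applies to products and partial sums without bundling them
    as random variables. *)
Definition independent_pair (A B : Omega -> R) :=
  forall S T : set R, measurable S -> measurable T ->
  P (A @^-1` S `&` B @^-1` T) = (P (A @^-1` S) * P (B @^-1` T))%E.

Lemma independent_pair_comp (A B : Omega -> R) (f g : R -> R) :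
    measurable_fun setT f -> measurable_fun setT g ->
  independent_pair A B -> independent_pair (f \o A) (g \o B).
Proof.
move=> mf mg AB S T mS mT;
apply: (AB (f @^-1` S) (g @^-1` T)); rewrite -[X in measurable X]setTI.
- exact: mf.
- exact: mg.
Qed.

Context (A B : Omega -> R).
Hypotheses (intA : P.-integrable setT (EFin \o A))
           (intB : P.-integrable setT (EFin \o B)).
Hypothesis AB : independent_pair A B.

Let mA : measurable_fun setT A.
Proof. exact/measurable_EFinP/(measurable_int P). Qed.
Let mB : measurable_fun setT B.
Proof. exact/measurable_EFinP/(measurable_int P). Qed.
Let lawA := distribution P (measurable_function mA).
Let lawB := distribution P (measurable_function mB).
Let pairAB w := (A w, B w).
Let mpairAB : measurable_fun setT pairAB.
Proof. exact: measurable_fun_pair. Qed.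
Let lawAB := distribution P (measurable_function mpairAB).

Let lawABE X : measurable X -> (lawA \x lawB)%E X = lawAB X.
Proof.
by apply: product_measure_unique => S T mS mT; exact: AB.
Qed.

Let mmul : measurable_fun setT (fun z : R * R => (z.1 * z.2)%:E).
Proof. by apply/measurable_EFinP/measurable_funM. Qed.

Let int_mul : (lawA \x lawB)%E.-integrable setT (fun z : R * R => (z.1 * z.2)%:E).
Proof.
apply/(integrable12ltyP _ _ mmul).
under eq_integral => x _.
  under eq_integral => y _ do rewrite /= normrM EFinM.
  rewrite ge0_integralZl//.
  rewrite (@ge0_integral_distribution _ _ _ _ _ P (measurable_function mB)
    (fun y => (`|y|)%:E))//; last exact/measurable_EFinP.
  over.
  exact/measurable_EFinP.
have Bfin : (\int[P]_w (`|B w|)%:E < +oo)%E.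
  by case/integrableP : intB => _; under eq_integral do rewrite /=.
have B0 : (0 <= \int[P]_w (`|B w|)%:E)%E by exact: integral_ge0.
have BE : (\int[P]_w (`|B w|)%:E = (fine (\int[P]_w (`|B w|)%:E))%:E)%E.
  by rewrite fineK// ge0_fin_numE.
under eq_integral => x _ do rewrite /comp/= BE.
rewrite ge0_integralZr//=; last 2 first.
- exact/measurable_EFinP.
- by rewrite lee_fin fine_ge0.
rewrite (@ge0_integral_distribution _ _ _ _ _ P (measurable_function mA)
    (fun y => (`|y|)%:E))//; last exact/measurable_EFinP.
apply: lte_mul_pinfty; last exact: ltry.
  by apply: integral_ge0 => w _; rewrite /= lee_fin.
rewrite ge0_fin_numE; last by apply: integral_ge0 => w _; rewrite /= lee_fin.
by case/integrableP : intA.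
Qed.

Let lawAB_int : lawAB.-integrable setT (fun z : R * R => (z.1 * z.2)%:E).
Proof.
apply/integrableP; split=> //.
rewrite (eq_measure_integral (lawA \x lawB)%E)//.
  by case/integrableP : int_mul.
by move=> S mS _; rewrite /= lawABE.
Qed.

(** The law of the pair is the product of the two laws, so Tonelli gives [E |A B| = E |A| * E |B|]:
    first moments suffice. *)
Lemma integrable_mul_independent :
  P.-integrable setT (EFin \o (fun w => A w * B w)).
Proof.
apply/integrableP; split; first exact/measurable_EFinP/measurable_funM.
have /integrableP[_] := lawAB_int.
rewrite (@ge0_integral_distribution _ _ _ _ _ P (measurable_function mpairAB)
    (fun z : R * R => (`|z.1 * z.2|)%:E))//.
exact/measurable_EFinP/measurableT_comp/measurable_funM.
Qed.

Lemma Rintegral_mul_independent :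
  \int[P]_w (A w * B w) = (\int[P]_w A w) * \int[P]_w B w.
Proof.
have EB : (\int[lawB]_y y%:E = \int[P]_w (B w)%:E)%E.
  by rewrite (@integral_distribution _ _ _ _ _ P (measurable_function mB)
    (EFin)).
have EA : (\int[lawA]_y y%:E = \int[P]_w (A w)%:E)%E.
  by rewrite (@integral_distribution _ _ _ _ _ P (measurable_function mA)
    (EFin)).
have : (\int[lawAB]_z (z.1 * z.2)%:E = \int[P]_w (A w)%:E * \int[P]_w (B w)%:E)%E.
  rewrite (eq_measure_integral (lawA \x lawB)%E); last first.
    by move=> S mS _; rewrite /= lawABE.
  rewrite -integral12_prod_meas1// /fubini_F -EB -EA.
  have fB : (\int[lawB]_y y%:E)%E \is a fin_num.
    by rewrite EB; exact: integrable_fin_num.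
  rewrite -[in RHS](fineK fB) -integralZr//; last first.
    apply: (@integrable_pushforward _ _ _ _ _ _ mA P setT EFin) => //.
  apply: eq_integral => x _ /=; rewrite fineK// -integralZl//.
  apply: (@integrable_pushforward _ _ _ _ _ _ mB P setT EFin) => //.
rewrite (@integral_distribution _ _ _ _ _ P (measurable_function mpairAB)
    (fun z : R * R => (z.1 * z.2)%:E))//; last exact: integrable_mul_independent.
rewrite /Rintegral /comp/= => ->; rewrite fineM//; exact: integrable_fin_num.
Qed.

End product_of_independent.

(** * Independence of functions of disjoint blocks of variables *)

Section mutual_independence.
Context d (Omega : measurableType d) (R : realType) (P : probability Omega R).

Lemma preimage_sigma_of_subfamily (I : choiceType) (Z : I -> {RV P >-> R})
    (D : set I) i (B : set R) : D i -> measurable B ->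
  sigma_of_subfamily Z D (Z i @^-1` B).
Proof.
by move=> Di mB; apply: sub_sigma_algebra; exists i => //; exists B; rewrite ?setTI.
Qed.

Lemma bigcap_sigma_of_subfamily (I K : choiceType) (Z : I -> {RV P >-> R})
    (D : K -> set I) (s : seq K) (A : K -> set Omega) :
    (forall k, k \in s -> sigma_of_subfamily Z (D k) (A k)) ->
  sigma_of_subfamily Z (\bigcup_(k in [set` s]) D k) (\bigcap_(k in [set` s]) A k).
Proof.
move=> sA.
(* A finite intersection is rewritten through complements and unions, the operations of a
   sigma-algebra. *)
have -> : \bigcap_(k in [set` s]) A k = ~` \bigcup_(k in [set` s]) ~` A k.
  by rewrite setC_bigcup; apply: eq_bigcapr => k _; rewrite setCK.
have DE k : k \in s -> D k `<=` \bigcup_(k in [set` s]) D k by move=> ks i; exists k.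
move: (\bigcup_(k in [set` s]) D k) DE => E DE.
have [S0 SC SU] := @smallest_sigma_algebra _ setT
  (\bigcup_(i in E) preimage_set_system setT (Z i) measurable).
have CS B : sigma_of_subfamily Z E B -> sigma_of_subfamily Z E (~` B).
  by rewrite -setTD; exact: SC.
apply: (CS); rewrite bigcup_seq big_seq; elim/big_ind : _ => [|B C sB sC|k ks].
- exact: S0.
- by rewrite -bigcup2E; apply: SU => -[|[|n]].
- apply: (CS); apply: sub_sigma_algebra2 (sA k ks) => B [i Di iB].
  by exists i => //; exact: DE Di.
Qed.

(** Induction on the finite set of indices: the first block is disjoint from the union of the
    remaining ones, so it splits off as one factor. *)
Lemma mutually_independent_blocks (I K : choiceType) (Z : I -> {RV P >-> R})
    (V : K -> {RV P >-> R}) (D : K -> set I) :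
    mutually_independent Z ->
    (forall k l, k != l -> D k `&` D l = set0) ->
    (forall k B, measurable B -> sigma_of_subfamily Z (D k) (V k @^-1` B)) ->
  mutually_independent V.
Proof.
move=> Zind DD VD J B mB.
have : uniq J by exact: fset_uniq.
have : {in (J : seq K), forall k, measurable (B k)} by [].
rewrite (_ : [set` J] = [set` (J : seq K)])//.
elim: {J mB}(J : seq K) => [_ _|k s IH mB /= /andP[ks us]].
  rewrite big_nil (_ : [set` [::]] = set0) ?bigcap_set0 ?probability_setT//.
  by apply/seteqP; split.
have mBs : {in s, forall k, measurable (B k)}.
  by move=> l ls; apply: mB; rewrite inE ls orbT.
rewrite big_cons -IH//.
rewrite (_ : [set` k :: s] = k |` [set` s]); last first.
  apply/seteqP; split=> l /=; rewrite inE.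
    by case/predU1P => [->|ls]; [left|right].
  by case=> [->|->]; rewrite ?eqxx ?orbT.
rewrite bigcap_setU1.
apply: (mutually_independent_disjoint Zind (D := D k)
  (E := \bigcup_(l in [set` s]) D l)).
- rewrite setI_bigcupr bigcup0// => l /= ls; apply: DD.
  by apply: contraNneq ks => ->.
- by apply: VD; apply: mB; rewrite inE eqxx.
- by apply: (bigcap_sigma_of_subfamily (A := fun l => V l @^-1` B l)) => l ls;
    apply: VD; exact: mBs.
Qed.

Definition sum_family (I J : Type) (X : I -> {RV P >-> R})
    (Y : J -> {RV P >-> R}) (k : I + J) : {RV P >-> R} :=
  match k with inl i => X i | inr j => Y j end.

(** Puts designs and noises into a single independent family, so that observation [i] depends on one
    block of it. The finite set [K] is split into its left and right indices; independence of the
    two families separates the halves, and independence within each family factors them. *)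
Lemma mutually_independent_sum (I J : choiceType) (X : I -> {RV P >-> R})
    (Y : J -> {RV P >-> R}) :
    mutually_independent X -> mutually_independent Y ->
    independent_families X Y ->
  mutually_independent (sum_family X Y).
Proof.
move=> Xind Yind XY K B mB.
pose getl (k : I + J) := if k is inl i then Some i else None.
pose getr (k : I + J) := if k is inr j then Some j else None.
pose s1 := pmap getl K; pose s2 := pmap getr K.
have s1E i : (i \in s1) = (inl i \in K).
  rewrite mem_pmap; apply/mapP/idP => [[[j|j]//= jK [->//]]|iK].
  by exists (inl i).
have s2E j : (j \in s2) = (inr j \in K).
  rewrite mem_pmap; apply/mapP/idP => [[[i|i]//= iK [->//]]|jK].
  by exists (inr j).
have us1 : uniq s1.
  apply: (@pmap_uniq _ _ getl inl) => //; first by case.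
  exact: fset_uniq.
have us2 : uniq s2.
  apply: (@pmap_uniq _ _ getr inr) => //; first by case.
  exact: fset_uniq.
have -> : \bigcap_(k in [set` K]) (sum_family X Y k @^-1` B k) =
    \bigcap_(i in [set` [fset i in s1]%fset]) (X i @^-1` B (inl i)) `&`
    \bigcap_(j in [set` [fset j in s2]%fset]) (Y j @^-1` B (inr j)).
  apply/seteqP; split=> w /=.
    move=> wK; split=> i /=; rewrite !inE ?s1E ?s2E => iK;
      by have /= := wK _ iK.
  move=> [w1 w2] [i|j] /= kK.
    by apply: w1; rewrite /= !inE s1E.
  by apply: w2; rewrite /= !inE s2E.
have sub (L : choiceType) (U : L -> {RV P >-> R}) (F : {fset L})
    (C : L -> set R) : (forall l, l \in F -> measurable (C l)) ->
    sigma_of_family U (\bigcap_(l in [set` F]) (U l @^-1` C l)).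
  move=> mC.
  have := @bigcap_sigma_of_subfamily L L U (fun=> setT) F (fun l => U l @^-1` C l).
  move=> H; apply: sub_sigma_algebra2 (H _) => [A [l _ lA]|l lF].
    by exists l.
  by apply: preimage_sigma_of_subfamily => //; exact: mC.
rewrite XY; last 2 first.
- by apply: sub => i; rewrite !inE s1E => /mB.
- by apply: sub => j; rewrite !inE s2E => /mB.
rewrite Xind; last by move=> i; rewrite !inE s1E => /mB.
rewrite Yind; last by move=> i; rewrite !inE s2E => /mB.
have fE (L : choiceType) (s : seq L) (F : L -> \bar R) : uniq s ->
    (\prod_(i <- [fset i in s]%fset) F i = \prod_(i <- s) F i)%E.
  by move=> us; apply/perm_big/uniq_perm => // i; rewrite !inE.
rewrite !fE// /s1 /s2; elim: {mB s1E s2E us1 us2}(K : seq _) => [|[i|j] s IH] /=.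
- by rewrite !big_nil mule1.
- by rewrite !big_cons -IH muleA.
- by rewrite !big_cons -IH muleCA.
Qed.

End mutual_independence.

Section past.
Context d (Omega : measurableType d) (R : realType) (P : probability Omega R).
Context (W : nat -> {RV P >-> R}).

(** The natural filtration, encoded as a measurable type on the same points: adaptedness is plain
    measurability from [past W n], and its stability under sums and products comes with that of
    measurable functions. *)
Definition past (n : nat) := g_sigma_algebraType
  (\bigcup_(i in [set i | (i < n)%N]) preimage_set_system setT (W i) measurable).

Lemma measurable_past n i : (i < n)%N ->
  measurable_fun (setT : set (past n)) (W i).
Proof.
by move=> ni _ B mB; rewrite setTI; exact: preimage_sigma_of_subfamily.
Qed.

Lemma past_mono n m d' (U : measurableType d') (A : Omega -> U) : (n <= m)%N ->
  measurable_fun (setT : set (past n)) A -> measurable_fun (setT : set (past m)) A.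
Proof.
move=> nm mA _ B mB; apply: sub_sigma_algebra2 (mA measurableT B mB) => C [i /= ni iC].
by exists i => //=; exact: leq_trans nm.
Qed.

Lemma independent_past n (A : Omega -> R) : mutually_independent W ->
  measurable_fun (setT : set (past n)) A -> independent_pair P A (W n).
Proof.
move=> Wind mA S T mS mT.
apply: (mutually_independent_disjoint Wind (D := [set i | (i < n)%N]) (E := [set n])).
- by apply/seteqP; split=> i //= -[] /[swap] ->; rewrite /= ltnn.
- by have := mA measurableT S mS; rewrite setTI.
- exact: preimage_sigma_of_subfamily.
Qed.

End past.

(** * Strong laws for real random variables *)

Section real_integral.
Context d (T : measurableType d) (R : realType) (mu : {finite_measure set T -> \bar R}).
Implicit Types f g : T -> R.

Local Notation int f := (mu.-integrable setT (EFin \o f)).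

Lemma EFin_Rintegral f : int f ->
  (\int[mu]_x (f x)%:E)%E = (\int[mu]_x f x)%:E.
Proof.
by move=> mf; rewrite /Rintegral fineK//; exact: (integrable_fin_num measurableT mf).
Qed.

Lemma Rintegrable_add f g : int f -> int g -> int (fun x => f x + g x).
Proof. by move=> mf mg; have := integrableD measurableT mf mg. Qed.

Lemma Rintegrable_scale c f : int f -> int (fun x => c * f x).
Proof. by move=> mf; have := integrableZl measurableT c mf. Qed.

Lemma Rintegrable_sub f g : int f -> int g -> int (fun x => f x - g x).
Proof. by move=> mf mg; have := integrableB measurableT mf mg. Qed.

Lemma Rintegrable_cst c : int (fun=> c).
Proof. exact: finite_measure_integrable_cst. Qed.

Lemma Rintegrable_sum I (s : seq I) (h : I -> T -> R) :
  (forall i, int (h i)) -> int (fun x => \sum_(i <- s) h i x).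
Proof.
move=> hi; rewrite (_ : _ \o _ = (fun x => \sum_(i <- s) (h i x)%:E)%E).
  by have := integrable_sum measurableT s (P := xpredT)
    (h := fun i x => (h i x)%:E) (fun i _ => hi i).
by apply/funext => x; rewrite /= sumEFin.
Qed.

Lemma Rintegral_sum I (s : seq I) (h : I -> T -> R) :
  (forall i, int (h i)) ->
  \int[mu]_x (\sum_(i <- s) h i x) = \sum_(i <- s) \int[mu]_x h i x.
Proof.
move=> hi; elim: s => [|i s IH].
  rewrite big_nil; under eq_Rintegral do rewrite big_nil.
  by rewrite Rintegral_cst// mul0r.
under eq_Rintegral do rewrite big_cons.
by rewrite big_cons -IH RintegralD//; exact: Rintegrable_sum.
Qed.

Lemma Rintegrable_le f g : measurable_fun setT f -> int g ->
  (forall x, `|f x| <= g x) -> int f.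
Proof.
move=> mf ig fg; apply: le_integrable ig => //; first exact/measurable_EFinP.
by move=> x _ /=; rewrite lee_fin (le_trans (fg x))// ler_norm.
Qed.

Lemma Rintegrable_bounded f M : measurable_fun setT f ->
  (forall x, `|f x| <= M) -> int f.
Proof. by move=> mf fM; apply: Rintegrable_le (Rintegrable_cst M) _. Qed.

Definition square_integrable f := measurable_fun setT f /\ int (fun x => f x ^+ 2).

Lemma square_integrable_mul f g : square_integrable f -> square_integrable g ->
  int (fun x => f x * g x).
Proof.
move=> [mf f2] [mg g2].
apply: Rintegrable_le (Rintegrable_add f2 g2) _ => [|x].
  exact: measurable_funM.
rewrite ler_norml; have := sqr_ge0 (f x + g x); have := sqr_ge0 (f x - g x).
by nra.
Qed.

Lemma square_integrable_cst c : square_integrable (fun=> c).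
Proof. by split=> //; exact: (Rintegrable_cst (c ^+ 2)). Qed.

Lemma square_integrable_int f : square_integrable f -> int f.
Proof.
move=> /square_integrable_mul/(_ (square_integrable_cst 1)).
by under [fun x => _ * _]eq_fun do rewrite mulr1.
Qed.

Lemma square_integrable_add f g : square_integrable f -> square_integrable g ->
  square_integrable (fun x => f x + g x).
Proof.
move=> sf sg; have [mf f2] := sf; have [mg g2] := sg.
split; first exact: measurable_funD.
under [fun x => _ ^+ 2]eq_fun do rewrite sqrrD -mulr_natl.
apply: Rintegrable_add => //; apply: Rintegrable_add => //.
exact/Rintegrable_scale/square_integrable_mul.
Qed.

Lemma square_integrable_scale c f : square_integrable f ->
  square_integrable (fun x => c * f x).
Proof.
move=> [mf f2]; split; first exact: measurable_funM.
under [fun x => _ ^+ 2]eq_fun do rewrite exprMn.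
exact: Rintegrable_scale.
Qed.

Lemma square_integrable_sum I (s : seq I) (h : I -> T -> R) :
  (forall i, square_integrable (h i)) ->
  square_integrable (fun x => \sum_(i <- s) h i x).
Proof.
move=> hi; elim: s => [|i s IH].
  under eq_fun do rewrite big_nil; exact: square_integrable_cst.
under eq_fun do rewrite big_cons; exact: square_integrable_add.
Qed.

Lemma square_integrable_bounded_mul f g M : measurable_fun setT f ->
  (forall x, `|f x| <= M) -> square_integrable g ->
  square_integrable (fun x => f x * g x).
Proof.
move=> mf fM [mg g2]; split; first exact: measurable_funM.
apply: Rintegrable_le (Rintegrable_scale (M ^+ 2) g2) _.
  exact/measurable_funX/measurable_funM.
move=> x; rewrite ger0_norm ?sqr_ge0// exprMn ler_wpM2r ?sqr_ge0//.
by rewrite -[leLHS]real_normK ?num_real// lerXn2r ?nnegrE ?(le_trans _ (fM x)).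
Qed.

End real_integral.

(** * Integrals depend only on the law *)

Section same_law.
Context d1 d2 (T1 : measurableType d1) (T2 : measurableType d2) (R : realType).
Context (P : probability T1 R) (Q : probability T2 R).
Context d' (E : measurableType d') (U : T1 -> E) (V : T2 -> E).
Hypotheses (mU : measurable_fun setT U) (mV : measurable_fun setT V).
Hypothesis UV : forall B, measurable B -> P (U @^-1` B) = Q (V @^-1` B).

Lemma equal_law_ge0_integral (f : E -> \bar R) :
    measurable_fun setT f -> (forall x, 0 <= f x)%E ->
  (\int[P]_w f (U w) = \int[Q]_w f (V w))%E.
Proof.
move=> mf f0.
rewrite -(@ge0_integral_distribution _ _ _ _ _ P (measurable_function mU) f)//.
rewrite -(@ge0_integral_distribution _ _ _ _ _ Q (measurable_function mV) f)//.
by apply: eq_measure_integral => S mS _; exact: UV.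
Qed.

Lemma equal_law_integrable (f : E -> R) : measurable_fun setT f ->
  Q.-integrable setT (EFin \o (f \o V)) -> P.-integrable setT (EFin \o (f \o U)).
Proof.
move=> mf /integrableP[_ iV]; apply/integrableP; split.
  exact/measurable_EFinP/measurableT_comp.
rewrite (equal_law_ge0_integral (f := fun x => `|(f x)%:E|%E))//.
by apply: measurableT_comp => //; exact/measurable_EFinP.
Qed.

Lemma equal_law_Rintegral (f : E -> R) : measurable_fun setT f ->
  Q.-integrable setT (EFin \o (f \o V)) ->
  \int[P]_w f (U w) = \int[Q]_w f (V w).
Proof.
move=> mf iV; have iU := equal_law_integrable mf iV.
have mEf : measurable_fun setT (EFin \o f) by exact/measurable_EFinP.
rewrite /Rintegral.
rewrite -(@integral_distribution _ _ _ _ _ P (measurable_function mU) _ mEf)//.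
rewrite -(@integral_distribution _ _ _ _ _ Q (measurable_function mV) _ mEf)//.
by congr fine; apply: eq_measure_integral => S mS _; exact: UV.
Qed.

End same_law.

(** Induction from [1 / (n + 1)^2 <= 1 / n - 1 / (n + 1)]. For [n = 0] the convention [0^-1 = 0]
    makes the bound 2. *)
Lemma sum_inv_sqr_le (R : realType) n :
  \sum_(0 <= k < n) (k.+1%:R ^+ 2)^-1 <= 2 - n%:R^-1 :> R.
Proof.
elim: n => [|[|n] IH]; first by rewrite big_geq// invr0; lra.
  by rewrite big_nat1 expr1n invr1; lra.
rewrite big_nat_recr//= (le_trans (lerD IH (lexx _)))//.
have -> : n.+2%:R = n.+1%:R + 1 :> R by rewrite natr1.
have n0 : 0 < n.+1%:R :> R by [].
move: (n.+1%:R) n0 => x x0; rewrite -subr_ge0.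
have -> : 2 - (x + 1)^-1 - (2 - x^-1 + ((x + 1) ^+ 2)^-1) = (x * (x + 1) ^+ 2)^-1.
  by field; rewrite !gt_eqF// addr_gt0.
by rewrite invr_ge0 mulr_ge0 ?sqr_ge0 ?ltW.
Qed.

(** * Almost sure convergence from summable expectations *)

Section almost_sure.
Context d (Omega : measurableType d) (R : realType) (P : probability Omega R).

Lemma Rintegral_probability_cst (c : R) : \int[P]_w c = c.
Proof.
rewrite Rintegral_cst// -[RHS]mulr1; congr (_ * _).
by transitivity (fine (1%E : \bar R)) => //; congr fine; exact: probability_setT. Qed.

Lemma ae_and (A B : Omega -> Prop) : {ae P, forall w, A w} ->
  {ae P, forall w, B w} -> {ae P, forall w, A w /\ B w}.
Proof. by move=> pA pB; apply: filterS2 pA pB. Qed.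

(** By monotone convergence the sum of the [Y m] has a finite expectation, so it is almost surely
    finite and its terms tend to 0. This plays the part of the Borel-Cantelli lemma throughout. *)
Lemma ae_cvg0_summable_expectation (Y : nat -> Omega -> R) (C : R) :
    (forall m, P.-integrable setT (EFin \o Y m)) ->
    (forall m w, 0 <= Y m w) ->
    (forall n, \sum_(0 <= m < n) \int[P]_w Y m w <= C) ->
  {ae P, forall w, Y m w @[m --> \oo] --> 0}.
Proof.
move=> iY Y0 YC.
have mY m : measurable_fun setT (fun w => (Y m w)%:E) by exact: measurable_int (iY m).
pose S w := (\sum_(0 <= m <oo) (Y m w)%:E)%E.
have S0 w : (0 <= S w)%E by apply: nneseries_ge0 => m _ _; rewrite lee_fin.
have mS : measurable_fun setT S.
  apply: ge0_emeasurable_sum => [m w _ _|m _]; first by rewrite lee_fin.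
  exact: mY.
have iS : P.-integrable setT S.
  apply/integrableP; split=> //; under eq_integral do rewrite gee0_abs//.
  rewrite integral_nneseries//; last by move=> m w _; rewrite lee_fin.
  apply: (@le_lt_trans _ _ C%:E); last exact: ltry.
  apply: lime_le.
    by apply: is_cvg_nneseries => m _ _; apply: integral_ge0 => w _; rewrite lee_fin.
  apply: nearW => n.
  have YE m : (\int[P]_w (Y m w)%:E = (\int[P]_w Y m w)%:E)%E.
    exact: EFin_Rintegral.
  under eq_bigr do rewrite YE.
  by rewrite sumEFin lee_fin.
have := integrable_ae measurableT iS.
apply: filterS => w /(_ Logic.I) Sfin.
have : cvgn (series (fun m => Y m w)).
  apply: nondecreasing_is_cvgn.
    by apply: nondecreasing_series => m _ _.
  exists (fine (S w)) => _ [n _ <-]; rewrite /series/= -lee_fin fineK// -sumEFin.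
  by apply: nneseries_lim_ge => k _ _; rewrite lee_fin.
exact: cvg_series_cvg_0.
Qed.

Lemma ae_cvg0_inv_sqr_expectation (Y : nat -> Omega -> R) (C : R) :
    (forall m, P.-integrable setT (EFin \o Y m)) ->
    (forall m w, 0 <= Y m w) ->
    (forall m, \int[P]_w Y m w <= C / m.+1%:R ^+ 2) ->
  {ae P, forall w, Y m w @[m --> \oo] --> 0}.
Proof.
move=> iY Y0 YC; apply: (ae_cvg0_summable_expectation (C := `|C| * 2)) => // n.
apply: (@le_trans _ _ (\sum_(0 <= k < n) `|C| * (k.+1%:R ^+ 2)^-1)).
  apply: ler_sum => k _; apply: le_trans (YC k) _.
  by rewrite ler_wpM2r ?invr_ge0 ?sqr_ge0// ler_norm.
rewrite -mulr_sumr ler_wpM2l//; apply: le_trans (sum_inv_sqr_le _ n) _.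
by rewrite gerBl invr_ge0.
Qed.

End almost_sure.

(** * Strong law and quadratic strong law for i.i.d. real variables *)

Section iid.
Context d (Omega : measurableType d) (R : realType) (P : probability Omega R).
Context (W : nat -> {RV P >-> R}).
Hypothesis Wind : mutually_independent W.

Local Notation int f := (P.-integrable setT (EFin \o f)).

Definition past_fun n := (fun A : Omega -> R =>
  measurable_fun (setT : set (past W n)) A).

(* The increments [phi i (W i)] are centered given the past, so the sums
   [\sum_(i < n) A i * phi i (W i)] form a martingale with orthogonal increments. *)
Section orthogonal_increments.
Context (A : nat -> Omega -> R) (phi : nat -> R -> R).
Hypotheses (pastA : forall i, past_fun i (A i))
  (sqA : forall i, square_integrable P (A i))
  (mphi : forall i, measurable_fun setT (phi i))
  (sqphi : forall i, square_integrable P (phi i \o W i))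
  (phi0 : forall i, \int[P]_w phi i (W i w) = 0).

Let M n w := \sum_(0 <= i < n) A i w * phi i (W i w).

Lemma past_increments n : past_fun n (M n).
Proof.
rewrite /M; elim: n => [|n IH].
  by under [X in past_fun _ X]eq_fun do rewrite big_geq//; exact: measurable_cst.
under [X in past_fun _ X]eq_fun do rewrite big_nat_recr//=.
apply: measurable_funD; first exact: past_mono (leqnSn n) IH.
apply: measurable_funM; first exact: past_mono (leqnSn n) (@pastA n).
by apply: measurableT_comp; [exact: mphi|exact: measurable_past].
Qed.

Let indep n (B : Omega -> R) (f : R -> R) : past_fun n B -> measurable_fun setT f ->
  independent_pair P B (f \o W n).
Proof.
move=> pB mf; apply: (@independent_pair_comp _ _ _ _ _ _ id) => //.
exact: independent_past.
Qed.

Let sq_term n : square_integrable P (fun w => A n w * phi n (W n w)).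
Proof.
split.
  apply: measurable_funM; first by case: (sqA n).
  exact: measurableT_comp.
under [fun x => _ ^+ 2]eq_fun do rewrite exprMn.
apply: (@integrable_mul_independent _ _ _ _ (fun w => A n w ^+ 2)
  (fun w => phi n (W n w) ^+ 2)).
- by case: (sqA n).
- by case: (sqphi n).
- apply: (@indep _ _ (fun x => phi n x ^+ 2)); last exact: measurable_funX.
  by apply: measurable_funX; exact: (@pastA n).
Qed.

Lemma square_integrable_increments n : square_integrable P (M n).
Proof. exact: square_integrable_sum. Qed.

(** The cross term factors as the expectation of [M n * A n], a variable of the past, times that of
    [phi n (W n)], which is 0. As a product of two square integrable functions, [M n * A n] is
    integrable, and the product rule for independent variables asks for no more. *)
Lemma Rintegral_sqr_increments n : \int[P]_w M n w ^+ 2 =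
  \sum_(0 <= i < n) (\int[P]_w A i w ^+ 2) * \int[P]_w phi i (W i w) ^+ 2.
Proof.
elim: n => [|n IH].
  under eq_Rintegral do rewrite /M big_geq// expr0n.
  by rewrite Rintegral_cst// mul0r big_geq.
have iM := square_integrable_increments n.
have iMA := square_integrable_mul iM (sqA n).
rewrite big_nat_recr//= -IH.
have iphi := square_integrable_int (sqphi n).
have MAphi : independent_pair P (fun w => M n w * A n w) (phi n \o W n).
  apply: indep => //; apply: measurable_funM; last exact: (@pastA n).
  exact: (@past_increments n).
have Aphi : independent_pair P (fun w => A n w ^+ 2) (fun w => phi n (W n w) ^+ 2).
  apply: (@indep _ _ (fun x => phi n x ^+ 2)); last exact: measurable_funX.
  by apply: measurable_funX; exact: (@pastA n).
have i1 := integrable_mul_independent iMA iphi MAphi.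
have [_ iA] := sqA n; have [_ iphi2] := sqphi n.
have i2 := integrable_mul_independent iA iphi2 Aphi.
have ME w : M n.+1 w ^+ 2 = M n w ^+ 2 + (2 * (M n w * A n w * phi n (W n w)) +
    A n w ^+ 2 * phi n (W n w) ^+ 2).
  rewrite {1}/M big_nat_recr//= -/(M n w); ring.
under eq_Rintegral do rewrite ME.
have i2' := Rintegrable_scale 2 i1.
case: iM => mM iM2.
rewrite RintegralD//; last exact: Rintegrable_add.
rewrite RintegralD// RintegralZl//.
rewrite (@Rintegral_mul_independent _ _ _ _ (fun w => M n w * A n w) (phi n \o W n))//.
rewrite phi0 mulr0 mulr0 add0r.
rewrite (@Rintegral_mul_independent _ _ _ _ (fun w => A n w ^+ 2)
  (fun w => phi n (W n w) ^+ 2))//.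
Qed.

End orthogonal_increments.
Hypothesis Wlaw : forall i, same_distribution P (W i) (W 0).
Hypothesis W2 : int (fun w => W 0 w ^+ 2).
Hypothesis W0 : \int[P]_w W 0 w = 0.

Let s2 := \int[P]_w W 0 w ^+ 2.

Let s2_ge0 : 0 <= s2.
Proof. by apply: Rintegral_ge0 => w _; exact: sqr_ge0. Qed.

Lemma iid_Rintegral i (f : R -> R) : measurable_fun setT f -> int (f \o W 0) ->
  int (f \o W i) /\ \int[P]_w f (W i w) = \int[P]_w f (W 0 w).
Proof.
move=> mf iW; split.
  by apply: (equal_law_integrable _ _ (@Wlaw i)).
by apply: (equal_law_Rintegral _ _ (@Wlaw i)).
Qed.

Let sqW i : square_integrable P (W i).
Proof.
split=> //; have [] := @iid_Rintegral i (fun x => x ^+ 2) _ W2; last by [].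
exact: measurable_funX.
Qed.

Let EW i : \int[P]_w W i w = 0.
Proof.
have [//|_ ->] := @iid_Rintegral i id _ (square_integrable_int (sqW 0)).
exact: W0.
Qed.

Let EW2 i : \int[P]_w W i w ^+ 2 = s2.
Proof.
have [] := @iid_Rintegral i (fun x => x ^+ 2) _ W2; last by [].
exact: measurable_funX.
Qed.

Definition partial_sum n w := \sum_(0 <= i < n) W i w.
Local Notation S := partial_sum.

(** The weights 0 and 1 turn [S n - S m] into an instance of the sums with orthogonal increments, so
    that its variance needs no separate computation. *)
Let increment m n w := \sum_(0 <= i < n) (m <= i)%:R * W i w.

Let incrementE m n w : (m <= n)%N -> increment m n w = S n w - S m w.
Proof.
move=> mn; rewrite /increment /S [X in _ = X - _](big_cat_nat (n := m))//=.
rewrite [LHS](big_cat_nat (n := m))//= addrAC subrr add0r.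
rewrite big_nat_cond big1 ?add0r => [|i /andP[/andP[_ im] _]]; last first.
  by rewrite leqNgt im mul0r.
rewrite big_nat_cond [RHS]big_nat_cond; apply: eq_bigr => i /andP[/andP[mi _] _].
by rewrite mi mul1r.
Qed.

Let increment_past m n : past_fun n (increment m n).
Proof.
apply: (@past_increments (fun i _ => (m <= i)%:R) (fun=> id)) => // i.
exact: measurable_cst.
Qed.

Let increment_sq m n : square_integrable P (increment m n).
Proof.
apply: (@square_integrable_increments (fun i _ => (m <= i)%:R) (fun=> id)) => // i.
  exact: measurable_cst.
exact: square_integrable_cst.
Qed.

Let increment_var m n : (m <= n)%N ->
  \int[P]_w increment m n w ^+ 2 = (n - m)%:R * s2.
Proof.
move=> mn; have := @Rintegral_sqr_increments (fun i _ => (m <= i)%:R) (fun=> id).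
move=> ->//; last 2 first.
- by move=> i; exact: measurable_cst.
- by move=> i; exact: square_integrable_cst.
rewrite (eq_bigr (fun i => (m <= i)%:R * s2)) => [|i _]; last first.
  by rewrite EW2 Rintegral_probability_cst; case: leqP => _;
    rewrite ?expr1n ?expr0n.
rewrite -mulr_suml; congr (_ * _).
rewrite (big_cat_nat (n := m))//= big_nat_cond big1 ?add0r; last first.
  by move=> i /andP[/andP[_ im] _]; rewrite leqNgt im.
rewrite big_nat_cond (eq_bigr (fun=> 1)) => [|i /andP[/andP[-> _] _]//].
by rewrite -big_nat_cond sumr_const_nat.
Qed.

Let S_increment n : S n = increment 0 n.
Proof. by apply/funext => w; rewrite incrementE// /S [X in _ - X]big_geq// subr0. Qed.

Lemma past_partial_sum n : past_fun n (S n).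
Proof. rewrite S_increment; exact: increment_past. Qed.

Lemma square_integrable_partial_sum n : square_integrable P (S n).
Proof. rewrite S_increment; exact: increment_sq. Qed.

Lemma Rintegral_sqr_partial_sum n : \int[P]_w S n w ^+ 2 = n%:R * s2.
Proof. by rewrite S_increment increment_var// subn0. Qed.

Theorem strong_law_of_large_numbers :
  {ae P, forall w, S n w / n%:R @[n --> \oo] --> 0}.
Proof.
pose N m := (m.+1 ^ 2)%N.
pose Y m w := (S (N m) w / (N m)%:R) ^+ 2.
(* Summing all squared fluctuations inside a block replaces a maximal inequality. A block has at
   most [3 (m + 1)] indices, each with a variance of at most [3 (m + 1) s2 / (m + 1)^4]; hence the
   bound [9 s2 / (m + 1)^2] on the expectation. *)
pose Z m w := \sum_(N m <= n < N m.+1) (increment (N m) n w / (N m)%:R) ^+ 2.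
have NE m : (N m)%:R = m.+1%:R ^+ 2 :> R by rewrite natrX.
have iS n (c : R) : int (fun w => (S n w / c) ^+ 2).
  have [] := square_integrable_scale c^-1 (square_integrable_partial_sum n).
  by move=> _; under eq_fun do rewrite mulrC.
have iI m n (c : R) : int (fun w => (increment m n w / c) ^+ 2).
  have [] := square_integrable_scale c^-1 (@increment_sq m n).
  by move=> _; under eq_fun do rewrite mulrC.
have Y0 : {ae P, forall w, Y m w @[m --> \oo] --> 0}.
  apply: (ae_cvg0_inv_sqr_expectation (C := s2)) => [m|m w|m].
  - exact: iS.
  - exact: sqr_ge0.
  - rewrite /Y; under eq_Rintegral do rewrite exprMn.
    rewrite RintegralZr//; last by case: (square_integrable_partial_sum (N m)).
    rewrite Rintegral_sqr_partial_sum NE le_eqVlt; apply/orP; left; apply/eqP.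
    by have : m.+1%:R != 0 :> R; [rewrite pnatr_eq0|move: (m.+1%:R) => y y0; field].
have Z0 : {ae P, forall w, Z m w @[m --> \oo] --> 0}.
  apply: (ae_cvg0_inv_sqr_expectation (C := 9 * s2)) => [m|m w|m].
  - by apply: Rintegrable_sum => n; exact: iI.
  - by apply: sumr_ge0 => n _; exact: sqr_ge0.
  rewrite /Z Rintegral_sum; last by move=> n; exact: iI.
  have le1 n : (N m <= n < N m.+1)%N ->
      \int[P]_w (increment (N m) n w / (N m)%:R) ^+ 2 <=
      (3 * m.+1)%:R * s2 / m.+1%:R ^+ 4.
    move=> /andP[mn nm]; under eq_Rintegral do rewrite exprMn.
    rewrite RintegralZr//; last by case: (@increment_sq (N m) n).
    rewrite increment_var// NE exprVn -exprM ler_wpM2r ?exprn_ge0 ?invr_ge0//.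
    rewrite ler_wpM2r// ler_nat leq_subLR.
    by apply: leq_trans (ltnW nm) _; rewrite /N; nia.
  rewrite big_nat_cond.
  apply: le_trans (ler_sum _ (G := fun=> (3 * m.+1)%:R * s2 / m.+1%:R ^+ 4) _) _.
    by move=> n /andP[/le1].
  rewrite -big_nat_cond sumr_const_nat -[leLHS]mulr_natl.
  have : (N m.+1 - N m <= 3 * m.+1)%N by rewrite /N; nia.
  rewrite -(ler_nat R) => H; apply: le_trans (ler_wpM2r _ H) _.
    by rewrite mulr_ge0 ?invr_ge0// mulr_ge0.
  rewrite natrM le_eqVlt; apply/orP; left; apply/eqP.
  by have : m.+1%:R != 0 :> R; [rewrite pnatr_eq0|move: (m.+1%:R) => y y0; field].
have Ninc m : (N m < N m.+1)%N by rewrite ltn_exp2r.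
have [k kP kinfty] := block_index Ninc.
apply: filterS2 Y0 Z0 => w Yw Zw.
have Yw' : `|S (N m) w / (N m)%:R| @[m --> \oo] --> (0 : R).
  by apply/norm_cvg0P; exact: sqr_cvg0.
have Zw' : Num.sqrt (Z m w) @[m --> \oo] --> (0 : R).
  by rewrite -[X in _ --> X](sqrtr0 R); apply: continuous_cvg => //; exact: sqrt_continuous.
apply/norm_cvg0P.
apply: (squeeze_cvgr (f := fun=> 0) (h := fun n =>
  `|S (N (k n)) w / (N (k n))%:R| + Num.sqrt (Z (k n) w))).
- near=> n.
  have n1 : (1 <= n)%N by near: n; exact: nbhs_infty_ge.
  have /andP[kn nk] : (N (k n) <= n < N (k n).+1)%N by exact: kP.
  rewrite normr_ge0/=.
  have NE0 : 0 < (N (k n))%:R :> R by rewrite ltr0n expn_gt0.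
  have n0 : 0 < n%:R :> R by rewrite ltr0n.
  apply: (@le_trans _ _ (`|S n w| / (N (k n))%:R)).
    rewrite normrM [X in _ * X]gtr0_norm ?invr_gt0// ler_wpM2l//.
    by rewrite lef_pV2 ?posrE// ler_nat.
  have -> : S n w = S (N (k n)) w + increment (N (k n)) n w.
    by rewrite incrementE// addrC subrK.
  apply: (@le_trans _ _ ((`|S (N (k n)) w| + `|increment (N (k n)) n w|) / (N (k n))%:R)).
    by apply: ler_wpM2r; rewrite ?ler_normD// invr_ge0 ltW.
  rewrite mulrDl normrM [X in _ <= _ * X + _]gtr0_norm ?invr_gt0// lerD2l.
  rewrite -[X in _ * X](@gtr0_norm _ (N (k n))%:R^-1) ?invr_gt0// -normrM -sqrtr_sqr.
  rewrite ler_wsqrtr//.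
  rewrite /Z (bigD1_seq n)/= ?mem_index_iota ?kn ?iota_uniq// lerDl.
  by apply: sumr_ge0 => i _; exact: sqr_ge0.
- exact: cvg_cst.
- rewrite -[X in _ --> X](addr0 (0 : R)); apply: cvgD.
    exact: (cvg_comp _ _ kinfty Yw').
  exact: (cvg_comp _ _ kinfty Zw').
Unshelve. all: by end_near. Qed.

(** The level [k + 1] is high enough to be exceeded only finitely often almost surely, and low
    enough for the truncated squares divided by [k + 1] to have summable second moments. *)
Let truncated_sqr (k : nat) (x : R) := if x ^+ 2 <= k.+1%:R then x ^+ 2 else 0.
Local Notation tr := truncated_sqr.

Let tr_ge0 k x : 0 <= tr k x.
Proof. by rewrite /tr; case: ifP => // _; exact: sqr_ge0. Qed.

Let tr_le_sqr k x : tr k x <= x ^+ 2.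
Proof. by rewrite /tr; case: ifP => // _; exact: sqr_ge0. Qed.

Let tr_le k x : tr k x <= k.+1%:R.
Proof. by rewrite /tr; case: ifP. Qed.

Let measurable_tr k : measurable_fun setT (tr k).
Proof.
apply: measurable_fun_ifT => //.
by apply: measurable_fun_ler => //; exact: measurable_funX.
Qed.

Let sq_tr k i : square_integrable P (tr k \o W i).
Proof.
split; first exact: measurableT_comp.
apply: (@Rintegrable_bounded _ _ _ _ _ (k.+1%:R ^+ 2)).
  by apply: measurable_funX; exact: measurableT_comp.
by move=> w /=; rewrite ger0_norm ?sqr_ge0// lerXn2r ?nnegrE.
Qed.

Let e k := \int[P]_w tr k (W 0 w).

(** Dominated convergence with [W 0 ^+ 2] as dominating function. *)
Let e_cvg : e k @[k --> \oo] --> s2.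
Proof.
have mtr k : measurable_fun setT (fun w => (tr k (W 0 w))%:E).
  by apply/measurable_EFinP; exact: measurableT_comp.
have : (\int[P]_w (tr k (W 0 w))%:E @[k --> \oo] --> \int[P]_w (W 0 w ^+ 2)%:E)%E.
  apply: (@dominated_cvg _ _ _ P setT measurableT
    (fun k w => (tr k (W 0 w))%:E) (fun w => (W 0 w ^+ 2)%:E)
    (fun w => (W 0 w ^+ 2)%:E)) => //.
  - move=> w _; apply: cvg_near_cst; near=> k.
    rewrite /tr ifT//; apply: (@le_trans _ _ k%:R); last by rewrite ler_nat.
    by near: k; exact: (cvgryPge _).1 (@cvgr_idn R) _.
  - by move=> k w _ /=; rewrite lee_fin ger0_norm.
have -> : (\int[P]_w (W 0 w ^+ 2)%:E)%E = s2%:E by exact: EFin_Rintegral.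
by move/fine_cvg.
Unshelve. all: by end_near. Qed.

Let phi k x := tr k x - e k.

Let mphi k : measurable_fun setT (phi k).
Proof. by apply: measurable_funB. Qed.

Let iid_tr k : \int[P]_w tr k (W k w) = e k /\
  \int[P]_w tr k (W k w) ^+ 2 = \int[P]_w tr k (W 0 w) ^+ 2.
Proof.
have [_ ->//] := @iid_Rintegral k (tr k) (@measurable_tr k) (square_integrable_int (sq_tr k 0)).
have [//|_ ->//] := @iid_Rintegral k (fun x => tr k x ^+ 2) _ (sq_tr k 0).2.
exact: measurable_funX.
Qed.

Let sq_phi k : square_integrable P (phi k \o W k).
Proof.
exact: square_integrable_add (sq_tr k k) (square_integrable_cst _ (- e k)).
Qed.

Let phi0 k : \int[P]_w phi k (W k w) = 0.
Proof.
rewrite /phi RintegralB//; last 2 first.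
  exact: square_integrable_int (sq_tr k k).
  exact: Rintegrable_cst.
by rewrite Rintegral_probability_cst (iid_tr k).1 subrr.
Qed.

Let phi2 k : \int[P]_w phi k (W k w) ^+ 2 <= \int[P]_w tr k (W 0 w) ^+ 2.
Proof.
have phiE w : phi k (W k w) ^+ 2 =
    tr k (W k w) ^+ 2 - (2 * e k * tr k (W k w) - e k ^+ 2) by rewrite /phi; ring.
under eq_Rintegral do rewrite phiE.
have itr := square_integrable_int (sq_tr k k).
have itr2 := Rintegrable_scale (2 * e k) itr.
have ic := @Rintegrable_cst _ _ _ P (e k ^+ 2).
rewrite RintegralB//; last 2 first.
- by case: (sq_tr k k).
- exact: Rintegrable_sub itr2 ic.
rewrite RintegralB// RintegralZl// Rintegral_probability_cst !(iid_tr k).1 (iid_tr k).2.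
by rewrite gerBl; have := sqr_ge0 (e k); lra.
Qed.

Let C n w := \sum_(0 <= k < n) k.+1%:R^-1 * phi k (W k w).
Let M n w := \sum_(0 <= k < n) k.+1%:R^-1 * S k w * W k w.
(** Telescoping [S_k^2 / k] yields the coefficient [1 / (k (k + 1))] instead of [1 / k^2]; the
    difference is [1 / (k^2 (k + 1))]. The term of index 0 vanishes. *)
Let D n w := \sum_(0 <= k < n) (k%:R ^+ 2 * k.+1%:R)^-1 * S k w ^+ 2.
Let G n w := \sum_(0 <= k < n) k.+1%:R^-1 * (W k w ^+ 2 - tr k (W k w)).

(* Obtained by telescoping [S_k^2 / k]; [M] and [C] are martingales. *)
Let quadratic_sum n w : \sum_(0 <= k < n) (S k w / k%:R) ^+ 2 =
  2 * M n w + (C n w + G n w + \sum_(0 <= k < n) e k / k.+1%:R)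
  - S n w ^+ 2 / n%:R + D n w.
Proof.
elim: n => [|n IH].
  rewrite /M /C /G /D /S !big_geq// expr0n/=; ring.
rewrite big_nat_recr//= IH /M /C /G /D ![\sum_(0 <= k < n.+1) _]big_nat_recr//=.
have -> : S n.+1 w = S n w + W n w by rewrite /S big_nat_recr.
rewrite /phi.
have n1 : n.+1%:R != 0 :> R by rewrite pnatr_eq0.
have [->|n0] := eqVneq n 0%N.
  have -> : S 0 w = 0 by rewrite /S big_geq.
  by rewrite !big_geq// !expr2 !(mul0r, mulr0, addr0, add0r, subr0) invr1; ring.
have n0' : n%:R != 0 :> R by rewrite pnatr_eq0.
have -> : n.+1%:R = n%:R + 1 :> R by rewrite natr1.
rewrite -natr1 in n1.
by field; rewrite n0' n1.
Qed.

(** Since [E S_k^2 / (k + 1)^2 <= s2 / (k + 1)], the variance of the martingale grows only like a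
    harmonic sum. *)
Let sqM n : square_integrable P (M n) /\
  \int[P]_w M n w ^+ 2 <= s2 ^+ 2 * \sum_(0 <= k < n) k.+1%:R^-1.
Proof.
have pA i : past_fun i (fun w => i.+1%:R^-1 * S i w).
  apply: measurable_funM; first exact: measurable_cst.
  exact: (@past_partial_sum i).
have sqA i : square_integrable P (fun w => i.+1%:R^-1 * S i w).
  exact: square_integrable_scale (square_integrable_partial_sum i).
split; first exact: (@square_integrable_increments _ (fun=> id)).
rewrite [leLHS](@Rintegral_sqr_increments _ (fun=> id))// mulr_sumr.
apply: ler_sum => k _; rewrite EW2.
under eq_Rintegral do rewrite exprMn.
rewrite RintegralZl//; last by case: (square_integrable_partial_sum k).
rewrite Rintegral_sqr_partial_sum.
have -> : k.+1%:R^-1 ^+ 2 * (k%:R * s2) * s2 = s2 ^+ 2 * k.+1%:R^-1 * (k%:R / k.+1%:R).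
  by ring.
rewrite ler_piMr ?mulr_ge0 ?sqr_ge0 ?invr_ge0//.
by rewrite ler_pdivrMr// mul1r ler_nat.
Qed.

(** Sum and expectation are exchanged after passing from [W k] to [W 0], which leaves a pointwise
    bound by [2 * W 0 ^+ 2]. The martingale is thus bounded in L^2. *)
Let sqC n : square_integrable P (C n) /\ \int[P]_w C n w ^+ 2 <= 2 * s2.
Proof.
have pA i : past_fun i (fun _ : Omega => i.+1%:R^-1 : R) by exact: measurable_cst.
have sqA i := @square_integrable_cst _ _ _ P i.+1%:R^-1.
split; first exact: (@square_integrable_increments _ phi).
rewrite [leLHS](@Rintegral_sqr_increments _ phi)//.
apply: (@le_trans _ _ (\sum_(0 <= k < n) \int[P]_w (tr k (W 0 w) ^+ 2 / k.+1%:R ^+ 2))).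
  apply: ler_sum => k _; rewrite Rintegral_probability_cst exprVn mulrC.
  rewrite RintegralZr//; last by case: (sq_tr k 0).
  by rewrite ler_wpM2r ?invr_ge0 ?sqr_ge0.
have itr k : int (fun w => tr k (W 0 w) ^+ 2 / k.+1%:R ^+ 2).
  under eq_fun do rewrite mulrC; apply: Rintegrable_scale.
  by case: (sq_tr k 0).
rewrite -Rintegral_sum// -RintegralZl//.
apply: le_Rintegral => //; [exact: Rintegrable_sum|exact: Rintegrable_scale|].
move=> w _; apply: le_trans (sum_truncated_sqr_le n (sqr_ge0 (W 0 w))).
by apply: ler_sum => k _; rewrite /tr; case: ifP => // _; rewrite expr0n.
Qed.

(** For [k >= 1] the expectation of the term is [s2 / (k (k + 1)) <= 2 s2 / (k + 1)^2], and the
    inverse squares sum to at most 2. *)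
Let intD n : int (D n) /\ \int[P]_w D n w <= 4 * s2.
Proof.
have iS k : int (fun w => (k%:R ^+ 2 * k.+1%:R)^-1 * S k w ^+ 2).
  by apply: Rintegrable_scale; case: (square_integrable_partial_sum k).
split; first exact: Rintegrable_sum.
rewrite Rintegral_sum//.
apply: (@le_trans _ _ (\sum_(0 <= k < n) 2 * s2 * (k.+1%:R ^+ 2)^-1)); last first.
  rewrite -mulr_sumr; have := sum_inv_sqr_le R n.
  have : 0 <= n%:R^-1 :> R by rewrite invr_ge0.
  move: (n%:R^-1) (\sum_(0 <= _ < _) _) => x y x0 yx.
  have : 0 <= s2 * (2 - y) by apply: mulr_ge0 => //; lra.
  by nra.
apply: ler_sum => -[|k] _.
  under eq_Rintegral do rewrite expr0n/= mul0r invr0 mul0r.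
  by rewrite Rintegral_probability_cst mulr_ge0 ?invr_ge0 ?sqr_ge0// mulr_ge0.
rewrite RintegralZl//; last by case: (square_integrable_partial_sum k.+1).
rewrite Rintegral_sqr_partial_sum.
have -> : k.+2%:R = k.+1%:R + 1 :> R by rewrite natr1.
have : 1 <= k.+1%:R :> R by rewrite ler1n.
move: (k.+1%:R) => x x1; rewrite -subr_ge0.
have -> : 2 * s2 * ((x + 1) ^+ 2)^-1 - (x ^+ 2 * (x + 1))^-1 * (x * s2) =
    s2 * (x - 1) / (x * (x + 1) ^+ 2).
  by field; rewrite !gt_eqF ?addr_gt0// (lt_le_trans _ x1).
have x0 : 0 <= x by exact: le_trans x1.
by rewrite divr_ge0 ?mulr_ge0 ?sqr_ge0 ?subr_ge0 ?addr_ge0.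
Qed.

(** The indicators of [W_k^2 > k + 1] have summable expectations because the [W_k] share one law and
    have a second moment; so they tend to 0 almost surely. *)
Let ae_untruncated :
  {ae P, forall w, \forall k \near \oo, tr k (W k w) = W k w ^+ 2}.
Proof.
pose I (k : nat) (x : R) : R := if k.+1%:R < x ^+ 2 then 1 else 0.
have mI k : measurable_fun setT (I k).
  apply: measurable_fun_ifT => //.
  by apply: measurable_fun_ltr => //; exact: measurable_funX.
have I1 k x : `|I k x| <= 1 by rewrite /I; case: ifP => _; rewrite ?normr1 ?normr0.
have iI k i : int (I k \o W i).
  apply: (@Rintegrable_bounded _ _ _ _ _ 1); first exact: measurableT_comp.
  by move=> w; exact: I1.
have : {ae P, forall w, I k (W k w) @[k --> \oo] --> 0}.
  apply: (ae_cvg0_summable_expectation (C := s2)) => [k|k w|n].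
  - exact: iI.
  - by rewrite /I; case: ifP.
  - rewrite (eq_bigr (fun k => \int[P]_w I k (W 0 w))) => [|k _]; last first.
      by have [_ ->] := @iid_Rintegral k (I k) (@mI k) (iI k 0%N).
    rewrite -Rintegral_sum => [|k]; last exact: iI.
    apply: le_Rintegral => //; first by apply: Rintegrable_sum => k; exact: iI.
    by move=> w _; exact: sum_tail_indicator_le (sqr_ge0 _).
apply: filterS => w Iw; near=> k.
(* An indicator at distance at most 1/2 from 0 is 0. *)
have : `|0 - I k (W k w)| <= 2^-1.
  by near: k; apply: (cvgrPdist_le _ _).1 Iw _ _; rewrite invr_gt0.
rewrite /I /tr; case: ltP => //; rewrite sub0r normrN normr1; lra.
Unshelve. all: by end_near. Qed.

(** In [quadratic_sum] only the sum of the [e k / (k + 1)] survives division by [ln n], and it is a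
    logarithmic mean of a sequence tending to [s2]. For the other terms, the first moment of the
    nonnegative ones and the second moment of the martingales are bounded by a constant over [c m],
    while [G] is eventually constant. *)
Theorem quadratic_strong_law : {ae P, forall w,
  (\sum_(0 <= k < n.+1) (S k w / k%:R) ^+ 2) / ln n%:R @[n --> \oo] --> s2}.
Proof.
(* The logarithm of [N m] is [c m * ln 2] with [c m = (m + 1)^2], so bounds of order [1 / c m] are
   summable. *)
pose N m := (2 ^ m.+1 ^ 2)%N.
pose c m : R := m.+1%:R ^+ 2.
have c1 m : 1 <= c m by rewrite exprn_ege1// ler1n.
have c0 m : 0 < c m by exact: lt_le_trans (c1 m).
have N0 m : 0 < (N m)%:R :> R by rewrite ltr0n expn_gt0.
have ln2 : 0 < ln (2 : R) by rewrite ln_gt0// ltr1n.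
have lnN m : ln (N m)%:R = c m * ln 2.
  by rewrite /N [in LHS]natrX lnXn// -[LHS]mulr_natl natrX.
have Nn0 m : (0 < N m)%N by rewrite expn_gt0.
have Ninc : {homo N : m n / (m < n)%N}.
  by apply: homo_ltn => [|m]; [exact: ltn_trans|rewrite ltn_exp2l// ltn_exp2r].
have Ninfty : N m @[m --> \oo] --> \oo.
  have mN m : (m <= N m)%N.
    by elim: m => // m IH; apply: leq_ltn_trans IH _; exact: Ninc.
  apply/cvgnyPge => K; near=> m.
  by apply: leq_trans (mN m); near: m; exact: nbhs_infty_ge.
have F1 : {ae P, forall w, S (N m) w ^+ 2 / (N m)%:R / c m @[m --> \oo] --> 0}.
  apply: (ae_cvg0_inv_sqr_expectation (C := s2)) => [m|m w|m].
  - under [fun w => _ / _ / _]eq_fun do rewrite -mulrA mulrC.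
    by apply: Rintegrable_scale; case: (square_integrable_partial_sum (N m)).
  - by rewrite !divr_ge0 ?sqr_ge0// ltW.
  - under eq_Rintegral do rewrite -mulrA.
    rewrite RintegralZr//; last by case: (square_integrable_partial_sum (N m)).
    rewrite Rintegral_sqr_partial_sum -/(c m).
    move: (N m)%:R (c m) (N0 m) (c0 m) => x y x0 y0.
    rewrite le_eqVlt; apply/orP; left; apply/eqP; field.
    by rewrite !gt_eqF.
have F2 : {ae P, forall w, M (N m) w / c m @[m --> \oo] --> 0}.
  suff : {ae P, forall w, (M (N m) w / c m) ^+ 2 @[m --> \oo] --> 0}.
    by apply: filterS => w; exact: sqr_cvg0.
  apply: (ae_cvg0_inv_sqr_expectation (C := s2 ^+ 2 * (1 + ln 2))) => [m|m w|m].
  - have [[mM iM] _] := sqM (N m).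
    by under eq_fun do rewrite exprMn mulrC; exact: Rintegrable_scale.
  - exact: sqr_ge0.
  - have [[mM iM] le] := sqM (N m).
    under eq_Rintegral do rewrite exprMn.
    rewrite RintegralZr//.
    have /andP[_] := @sum_inv_natS_bounds R (N m) (Nn0 m); rewrite lnN => leH.
    have {}le := le_trans le (ler_wpM2l (sqr_ge0 s2) leH).
    apply: le_trans (ler_wpM2r (sqr_ge0 _) le) _.
    rewrite -/(c m); move: (c m) (c1 m) (c0 m) => y y1 y0; rewrite -subr_ge0.
    have -> : s2 ^+ 2 * (1 + ln 2) / y - s2 ^+ 2 * (1 + y * ln 2) * y^-1 ^+ 2 =
        s2 ^+ 2 * (y - 1) / y ^+ 2 by field; rewrite gt_eqF.
    by rewrite divr_ge0 ?sqr_ge0// mulr_ge0 ?sqr_ge0// subr_ge0.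
have F3 : {ae P, forall w, D (N m) w / c m @[m --> \oo] --> 0}.
  apply: (ae_cvg0_inv_sqr_expectation (C := 4 * s2)) => [m|m w|m].
  - under eq_fun do rewrite mulrC; apply: Rintegrable_scale.
    by case: (intD (N m)).
  - rewrite divr_ge0 ?(ltW (c0 m))// sumr_ge0// => k _.
    by rewrite mulr_ge0 ?sqr_ge0// invr_ge0 mulr_ge0 ?sqr_ge0.
  - have [iD le] := intD (N m).
    by rewrite RintegralZr// -/(c m) ler_wpM2r ?invr_ge0 ?(ltW (c0 m)).
have F4 : {ae P, forall w, C (N m) w / c m @[m --> \oo] --> 0}.
  suff : {ae P, forall w, (C (N m) w / c m) ^+ 2 @[m --> \oo] --> 0}.
    by apply: filterS => w; exact: sqr_cvg0.
  apply: (ae_cvg0_inv_sqr_expectation (C := 2 * s2)) => [m|m w|m].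
  - have [[mM iM] _] := sqC (N m).
    by under eq_fun do rewrite exprMn mulrC; exact: Rintegrable_scale.
  - exact: sqr_ge0.
  - have [[mM iM] le] := sqC (N m).
    under eq_Rintegral do rewrite exprMn.
    rewrite RintegralZr//.
    apply: le_trans (ler_wpM2r (sqr_ge0 _) le) _.
    rewrite -/(c m) ler_wpM2l ?mulr_ge0//.
    by rewrite expr2 ler_piMl ?invr_ge0 ?(ltW (c0 m))// invf_le1.
have cinfty : (c m)^-1 @[m --> \oo] --> 0.
  have -> : (fun m => (c m)^-1) = (fun m => (@harmonic R m) ^+ 2).
    by apply/funext => m; rewrite /c /harmonic/= exprVn.
  rewrite -[X in _ --> X](expr0n _ 2); apply: cvg_sqr; exact: cvg_harmonic.
have F6 : (\sum_(0 <= k < N m) e k / k.+1%:R) / (c m * ln 2) @[m --> \oo] --> s2.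
  have := cvg_comp _ _ Ninfty (log_mean_cvg e_cvg).
  by apply: cvg_trans; apply: near_eq_cvg; near=> m; rewrite /= lnN.
have F := ae_and (ae_and (ae_and F1 F2) (ae_and F3 F4)) ae_untruncated.
apply: filterS F => w [[[F1w F2w] [F3w F4w]] [K _ KP]].
have F5w : G (N m) w / c m @[m --> \oo] --> 0.
  have GK n : (K <= n)%N -> G n w = G K w.
    move=> Kn; rewrite /G (big_cat_nat (n := K))//= [X in _ + X]big_nat_cond.
    rewrite [X in _ + X]big1 ?addr0// => k /andP[/andP[Kk _] _].
    by rewrite KP// subrr mulr0.
  have : G K w * (c m)^-1 @[m --> \oo] --> 0.
    by rewrite -[X in _ --> X](mulr0 (G K w)); apply: cvgM cinfty; exact: cvg_cst.
  apply: cvg_trans; apply: near_eq_cvg; near=> m; rewrite GK//.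
  near: m; exact: Ninfty _ (nbhs_infty_ge K).
apply: (@log_interpolation _ (fun n => \sum_(0 <= k < n) (S k w / k%:R) ^+ 2)).
- move=> m n mn; rewrite [leRHS](big_cat_nat (n := m))//= lerDl.
  by apply: sumr_ge0 => k _; exact: sqr_ge0.
- by move=> n; apply: sumr_ge0 => k _; exact: sqr_ge0.
have -> : (fun m => (\sum_(0 <= k < 2 ^ m.+1 ^ 2) (S k w / k%:R) ^+ 2) /
    ((m.+1 ^ 2)%:R * ln 2)) = (fun m =>
    (2 * (M (N m) w / c m) + (C (N m) w / c m + G (N m) w / c m)
      - S (N m) w ^+ 2 / (N m)%:R / c m + D (N m) w / c m) / ln 2 +
    (\sum_(0 <= k < N m) e k / k.+1%:R) / (c m * ln 2)).
  apply/funext => m; rewrite quadratic_sum -/(N m).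
  have -> : (m.+1 ^ 2)%:R = c m by rewrite /c natrX.
  move: (c m) (c0 m) (S _ _ ^+ 2 / _) (\sum_(_ <= _ < _) _) => x x0 y z.
  by field; rewrite !gt_eqF.
rewrite -[X in _ --> X]add0r; apply: cvgD; last exact: F6.
rewrite -[X in _ --> X](mul0r (ln 2)^-1); apply: cvgM; last exact: cvg_cst.
have -> : (0 : R) = 2 * 0 + (0 + 0) - 0 + 0 by rewrite !(mulr0, addr0, subr0).
apply: cvgD F3w; apply: cvgB F1w; apply: cvgD; last exact: cvgD.
by apply: cvgM F2w; exact: cvg_cst.
Unshelve. all: by end_near. Qed.

End iid.

(** * Convergence in distribution from cosine expectations *)

Section matrix_topology.
Context (R : realType).

Lemma cvg_mx (T : Type) (F : set_system T) (FF : Filter F) m n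
    (f : T -> 'M[R]_(m, n)) (l : 'M[R]_(m, n)) :
  (forall i j, f x i j @[x --> F] --> l i j) -> f x @[x --> F] --> l.
Proof.
move=> fl; apply/cvg_ballP => e e0; near=> x; split=> // i j.
have : forall ij : 'I_m * 'I_n, ball (l ij.1 ij.2) e (f x ij.1 ij.2).
  near: x; apply: filter_forall => -[i' j'] /=.
  by have /cvg_ballP/(_ e e0) := fl i' j'.
by move=> /(_ (i, j)).
Unshelve. all: by end_near. Qed.

Lemma compact_box p (M : R) : compact [set x : 'cV[R]_p | forall j, `|x j 0| <= M].
Proof.
have cr : compact [set x : 'rV[R]_p | forall j, `[- M, M]%classic (x ord0 j)].
  by apply: (@rV_compact R p (fun=> `[- M, M]%classic)) => j; exact: segment_compact.
have ct : continuous (@trmx R 1 p).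
  move=> x; apply: (@cvg_mx _ (nbhs x) (nbhs_filter x)) => i j; rewrite mxE.
  under eq_fun do rewrite mxE.
  exact: coord_continuous.
have := continuous_compact (continuous_subspaceT ct) cr.
congr compact; apply/seteqP; split=> [_ [x xM <-] j|x xM].
  by rewrite mxE; have := xM j; rewrite /= in_itv/= ler_norml.
exists x^T; last by rewrite trmxK.
by move=> j; rewrite /= in_itv/= mxE -ler_norml.
Qed.

End matrix_topology.

(** * Uniform approximation by trigonometric polynomials *)

Section trigonometric_polynomials.
Context (R : realType) (p : nat).
Implicit Types (u x : 'cV[R]_p) (l : seq (R * 'cV[R]_p * R)) (F G : 'cV[R]_p -> R).

Definition dot u x : R := \sum_j u j 0 * x j 0.

Lemma dotE u x : (u^T *m x) 0 0 = dot u x.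
Proof. by rewrite mxE; apply: eq_bigr => j _; rewrite mxE. Qed.

Lemma dotDl u v x : dot (u + v) x = dot u x + dot v x.
Proof. by rewrite -big_split; apply: eq_bigr => j _; rewrite mxE mulrDl. Qed.

Lemma dotNl u x : dot (- u) x = - dot u x.
Proof. by rewrite -sumrN; apply: eq_bigr => j _; rewrite mxE mulNr. Qed.

Lemma cvg_dot (T : Type) (F : set_system T) (FF : Filter F) u (f : T -> 'cV[R]_p) x :
  (forall j, f t j 0 @[t --> F] --> x j 0) -> dot u (f t) @[t --> F] --> dot u x.
Proof.
move=> fx; rewrite /dot; elim: (index_enum _) => [|j s IH].
  by under eq_fun do rewrite big_nil; rewrite big_nil; exact: cvg_cst.
under eq_fun do rewrite big_cons; rewrite big_cons.
by apply: cvgD => //; apply: cvgM; [exact: cvg_cst|exact: fx].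
Qed.

Lemma continuous_dot u : continuous (dot u).
Proof.
move=> x; apply: (@cvg_dot _ (nbhs x) (nbhs_filter x)) => j.
exact: coord_continuous.
Qed.

(** A triple [(c, u, b)] stands for [c * cos (u^T x + b)]; the phase [b] makes sines a special
    case. *)
Definition trig_poly l x := \sum_(t <- l) t.1.1 * cos (dot t.1.2 x + t.2).

Lemma trig_poly_le l x : `|trig_poly l x| <= \sum_(t <- l) `|t.1.1|.
Proof.
apply: le_trans (ler_norm_sum _ _ _) _; apply: ler_sum => t _.
by rewrite normrM ler_piMr// cos_max.
Qed.

(** Each pair of terms contributes [cos s * cos t = (cos (s + t) + cos (s - t)) / 2]. *)
Lemma trig_polyM l1 l2 : exists l, trig_poly l = trig_poly l1 \* trig_poly l2.
Proof.
pose term (s t : R * 'cV[R]_p * R) : seq (R * 'cV[R]_p * R) :=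
  [:: (s.1.1 * t.1.1 / 2, s.1.2 + t.1.2, s.2 + t.2);
      (s.1.1 * t.1.1 / 2, s.1.2 - t.1.2, s.2 - t.2)].
exists (flatten [seq flatten [seq term s t | t <- l2] | s <- l1]).
apply/funext => x; rewrite /trig_poly big_flatten/= big_map mulr_suml.
apply: eq_bigr => s _; rewrite big_flatten/= big_map mulr_sumr.
apply: eq_bigr => t _; rewrite !big_cons big_nil addr0/=.
rewrite !dotDl dotNl.
have -> : dot s.1.2 x + dot t.1.2 x + (s.2 + t.2) =
  (dot s.1.2 x + s.2) + (dot t.1.2 x + t.2) by ring.
have -> : dot s.1.2 x - dot t.1.2 x + (s.2 - t.2) =
  (dot s.1.2 x + s.2) - (dot t.1.2 x + t.2) by ring.
by rewrite cosD cosB; field.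
Qed.

(** Approximation is uniform on the whole space, so these are the real almost periodic functions.
    They form an algebra and a lattice, which is what the argument of Stone and Weierstrass uses,
    and global uniformity keeps the approximants bounded outside the box. *)
Definition almost_trig F := forall e, 0 < e ->
  exists l, forall x, `|F x - trig_poly l x| <= e.

Lemma almost_trig_limit F : (forall e, 0 < e ->
  exists2 G, almost_trig G & forall x, `|F x - G x| <= e) -> almost_trig F.
Proof.
move=> FG e e0; have e2 : 0 < e / 2 by rewrite divr_gt0.
have [G /(_ _ e2)[l Gl] FGe] := FG _ e2.
exists l => x; have := FGe x; have := Gl x.
have : `|F x - trig_poly l x| <= `|F x - G x| + `|G x - trig_poly l x|.
  by apply: le_trans (ler_normD _ _); rewrite addrA subrK.
lra.
Qed.

Lemma almost_trig_poly l : almost_trig (trig_poly l).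
Proof. by move=> e e0; exists l => x; rewrite subrr normr0 ltW. Qed.

Lemma almost_trig_cos c u b : almost_trig (fun x => c * cos (dot u x + b)).
Proof.
have := almost_trig_poly [:: (c, u, b)].
by congr almost_trig; apply/funext => x; rewrite /trig_poly big_cons big_nil addr0.
Qed.

Lemma almost_trig_cst c : almost_trig (fun=> c).
Proof.
have := almost_trig_cos c 0 0; congr almost_trig; apply/funext => x.
by rewrite /dot big1 ?addr0 ?cos0 ?mulr1// => j _; rewrite mxE mul0r.
Qed.

Lemma almost_trig_bounded F : almost_trig F -> exists B : R, forall x, `|F x| <= B.
Proof.
move=> /(_ 1 ltr01)[l Fl]; exists (1 + \sum_(t <- l) `|t.1.1|) => x.
rewrite -[F x](subrK (trig_poly l x)) (le_trans (ler_normD _ _))//.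
by rewrite lerD// trig_poly_le.
Qed.

Lemma almost_trigD F G : almost_trig F -> almost_trig G ->
  almost_trig (fun x => F x + G x).
Proof.
move=> aF aG e e0; have e2 : 0 < e / 2 by rewrite divr_gt0.
have [l1 H1] := aF _ e2; have [l2 H2] := aG _ e2.
exists (l1 ++ l2) => x; rewrite /trig_poly big_cat/= -!/(trig_poly _ x).
have := H1 x; have := H2 x; have := ler_normD (F x - trig_poly l1 x) (G x - trig_poly l2 x).
have -> : F x - trig_poly l1 x + (G x - trig_poly l2 x) =
  F x + G x - (trig_poly l1 x + trig_poly l2 x) by ring.
lra.
Qed.

Lemma almost_trigM F G : almost_trig F -> almost_trig G ->
  almost_trig (fun x => F x * G x).
Proof.
move=> aF aG e e0.
have [B FB] := almost_trig_bounded aF; have [C GC] := almost_trig_bounded aG.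
have B0 : 0 <= B by apply: le_trans (FB 0); exact: normr_ge0.
have C0 : 0 <= C by apply: le_trans (GC 0); exact: normr_ge0.
(* With error [e1 <= 1] on both factors, the second approximant is bounded by [C + 1], so the
   product is off by at most [B * e1 + e1 * (C + 1)]. *)
pose e1 := Num.min 1 (e / (B + C + 1)).
have BC : 0 < B + C + 1 by lra.
have e10 : 0 < e1 by rewrite lt_min ltr01/= divr_gt0.
have [l1 H1] := aF _ e10; have [l2 H2] := aG _ e10.
have [l lE] := trig_polyM l1 l2; exists l => x; rewrite lE/=.
have -> : F x * G x - trig_poly l1 x * trig_poly l2 x =
   F x * (G x - trig_poly l2 x) + (F x - trig_poly l1 x) * (G x - (G x - trig_poly l2 x)).
  by ring.
have e11 : e1 <= 1 by rewrite ge_min lexx.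
have e1e : e1 * (B + C + 1) <= e.
  by rewrite -ler_pdivlMr// ge_min lexx orbT.
apply: le_trans (ler_normD _ _) _; rewrite !normrM.
apply: le_trans e1e.
have -> : e1 * (B + C + 1) = B * e1 + e1 * (C + 1) by ring.
apply: lerD; first by rewrite ler_pM.
rewrite ler_pM//; apply: le_trans (ler_normB _ _) _.
by rewrite lerD// (le_trans (H2 x)).
Qed.

Lemma almost_trigZ c F : almost_trig F -> almost_trig (fun x => c * F x).
Proof. exact/almost_trigM/almost_trig_cst. Qed.

Lemma almost_trig_sum (I : Type) (s : seq I) (F : I -> 'cV[R]_p -> R) :
  (forall i, almost_trig (F i)) -> almost_trig (fun x => \sum_(i <- s) F i x).
Proof.
move=> aF; elim: s => [|i s IH].
  by under eq_fun do rewrite big_nil; exact: almost_trig_cst.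
by under eq_fun do rewrite big_cons; exact: almost_trigD.
Qed.

(* [|t|] is the uniform limit on [-1, 1] of the polynomials in [t] defined by
   [q_0 = 0] and [q_(k+1) = q_k + (t^2 - q_k^2) / 2]. *)
Lemma almost_trig_abs F : almost_trig F -> almost_trig (fun x => `|F x|).
Proof.
move=> aF; have [B FB] := almost_trig_bounded aF.
pose B1 : R := `|B| + 1; have B10 : 0 < B1 by rewrite ltr_pwDr.
pose f x : R := B1^-1 * F x.
have af : almost_trig f by exact: almost_trigZ.
have f1 x : `|f x| <= 1.
  rewrite /f normrM gtr0_norm ?invr_gt0// mulrC ler_pdivrMr// mul1r.
  by rewrite (le_trans (FB x))// (le_trans (ler_norm B))// lerDl.
suff : almost_trig (fun x => `|f x|).
  move=> /(almost_trigZ B1); congr almost_trig; apply/funext => x.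
  by rewrite /f normrM gtr0_norm ?invr_gt0// mulrA divff ?mul1r// gt_eqF.
pose q := fix q k x : R := if k is k'.+1 then q k' x + 2^-1 * (f x * f x + -1 * (q k' x * q k' x)) else 0.
have aq k : almost_trig (q k).
  elim: k => [|k IH]; first exact: almost_trig_cst.
  apply: almost_trigD => //; apply: almost_trigZ; apply: almost_trigD.
    exact: almost_trigM.
  by apply: almost_trigZ; exact: almost_trigM.
(* One step multiplies the error [z = t - q_k] by [1 - (t + q_k) / 2 <= 1 - z / 2]. As
   [z (1 - z / 2)] is increasing on [0, 1], the bound [2 / (k + 2)] propagates; it starts from 1 at
   [k = 0]. *)
have qP k x : 0 <= q k x /\ 0 <= `|f x| - q k x <= 2 / k.+2%:R.
  elim: k => [|k [IH0 /andP[IH1 IH2]]].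
    by split=> //=; rewrite subr0 normr_ge0/= divff ?pnatr_eq0// f1.
  have ff : f x * f x = `|f x| * `|f x| by rewrite -!expr2 real_normK// num_real.
  rewrite /= ff; move: (q k x) `|f x| (f1 x) IH0 IH1 IH2 => y t t1 y0 ty tk.
  have -> : t - (y + 2^-1 * (t * t + -1 * (y * y))) = (t - y) * (1 - (t + y) / 2) by field.
  have k2 : 0 < k.+2%:R :> R by [].
  have -> : k.+3%:R = k.+2%:R + 1 :> R by rewrite natr1.
  have k1 : 2 <= k.+2%:R :> R by rewrite ler_nat.
  move: (k.+2%:R) k2 k1 tk => z z0 z2 tk.
  split; first by nra.
  apply/andP; split; first by apply: mulr_ge0 => //; lra.
  apply: (@le_trans _ _ ((t - y) * (1 - (t - y) / 2))).
    by apply: ler_wpM2l => //; lra.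
  apply: (@le_trans _ _ (2 / z * (1 - 2 / z / 2))).
    have z1 : 2 / z <= 1 by rewrite ler_pdivrMr// mul1r.
    rewrite -subr_ge0; move: (2 / z) (t - y) tk z1 => a b ab a1.
    have -> : a * (1 - a / 2) - b * (1 - b / 2) = (a - b) * (1 - (a + b) / 2) by field.
    by apply: mulr_ge0; lra.
  rewrite -subr_ge0.
  have -> : 2 / (z + 1) - 2 / z * (1 - 2 / z / 2) = 2 / (z ^+ 2 * (z + 1)).
    by field; rewrite !gt_eqF// addr_gt0.
  by rewrite divr_ge0// mulr_ge0 ?sqr_ge0// ltW// addr_gt0.
apply: almost_trig_limit => e e0.
have [k ke] : exists k, 2 / k.+2%:R <= e.
  near \oo => k; exists k; rewrite ler_pdivrMr// mulrC -ler_pdivrMr//.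
  apply: (@le_trans _ _ k%:R); last by rewrite ler_nat leqW.
  by near: k; exact: (cvgryPge _).1 (@cvgr_idn R) _.
exists (q k) => // x; have [_ /andP[H0 H1]] := qP k x.
by rewrite ger0_norm// (le_trans H1).
Unshelve. all: by end_near. Qed.

Lemma almost_trig_min F G : almost_trig F -> almost_trig G ->
  almost_trig (fun x => Num.min (F x) (G x)).
Proof.
move=> aF aG; have aN := almost_trigZ (-1) aG.
have := almost_trigZ 2^-1 (almost_trigD (almost_trigD aF aG)
   (almost_trigZ (-1) (almost_trig_abs (almost_trigD aF aN)))).
congr almost_trig; apply/funext => x; rewrite !mulN1r.
by case: (leP (F x) (G x)) => FG; [rewrite ler0_norm|rewrite gtr0_norm]; lra.
Qed.

Lemma almost_trig_max F G : almost_trig F -> almost_trig G ->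
  almost_trig (fun x => Num.max (F x) (G x)).
Proof.
move=> aF aG; have aN := almost_trigZ (-1) aG.
have := almost_trigZ 2^-1 (almost_trigD (almost_trigD aF aG)
   (almost_trig_abs (almost_trigD aF aN))).
congr almost_trig; apply/funext => x; rewrite !mulN1r.
by case: (leP (F x) (G x)) => FG; [rewrite ler0_norm|rewrite gtr0_norm]; lra.
Qed.

Lemma almost_trig_bigmin (I : Type) (s : seq I) c (F : I -> 'cV[R]_p -> R) :
  (forall i, almost_trig (F i)) ->
  almost_trig (fun x => \big[Num.min/c]_(i <- s) F i x).
Proof.
move=> aF; elim: s => [|i s IH].
  by under eq_fun do rewrite big_nil; exact: almost_trig_cst.
by under eq_fun do rewrite big_cons; exact: almost_trig_min.
Qed.

(* For [x] and [y] in the box of half-width [M], the arguments of the cosines lie in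
   [-2, 2], where [1 - cos] vanishes only at [0]. *)
Let separation (M : R) (y x : 'cV[R]_p) := \sum_j (1 - cos ((x j 0 - y j 0) / M)).

Let separation_ge0 M y x : 0 <= separation M y x.
Proof.
apply: sumr_ge0 => j _; rewrite subr_ge0.
by apply: le_trans (cos_max _); exact: ler_norm.
Qed.

Let almost_trig_separation M y : almost_trig (separation M y).
Proof.
apply: almost_trig_sum => j.
have := almost_trigD (almost_trig_cst 1)
  (almost_trig_cos (-1) (M^-1 *: delta_mx j 0) (- (y j 0 / M))).
congr almost_trig; apply/funext => x; rewrite mulN1r; congr (_ - cos _).
rewrite mulrBl; congr (_ - _); rewrite /dot (bigD1 j)//= big1 => [|i ij].
  by rewrite !mxE !eqxx mulr1 addr0 mulrC.
by rewrite !mxE (negbTE ij) mulr0 mul0r.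
Qed.

Section approximation.
Context (h : 'cV[R]_p -> R) (H M : R).
Hypotheses (h_cont : continuous h) (hH : forall x, `|h x| <= H) (M0 : 0 < M).

Let box := [set x : 'cV[R]_p | forall j, `|x j 0| <= M].

Let H0 : 0 <= H.
Proof. by apply: le_trans (hH 0); exact: normr_ge0. Qed.

(** Near [y] continuity suffices. Away from [y], in the box, [separation M y] stays above
    [1 - cos r1], so a large multiple of it exceeds [2 * H], the largest possible oscillation of
    [h]. *)
Let majorant y e : box y -> 0 < e -> exists C : R,
  forall x, box x -> h x <= h y + e + C * separation M y x.
Proof.
move=> By e0.
have /cvg_ballP/(_ _ e0)/nbhs_ballP[r /= r0 hr] := @h_cont y.
(* The cap 2 keeps [r1] below [pi], where the cosine is decreasing. *)
pose r1 := Num.min (r / M) 2.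
have r10 : 0 < r1 by rewrite lt_min ltr0n andbT divr_gt0.
have r12 : r1 <= 2 by rewrite ge_min lexx orbT.
have pi2 := @pi_ge2 R.
have k0 : 0 < 1 - cos r1.
  rewrite subr_gt0 -[ltRHS]cos0 ltr_cos// in_itv/=; lra.
pose C := 2 * H / (1 - cos r1); exists C => x Bx.
have C0 : 0 <= C by rewrite divr_ge0 ?mulr_ge0// ltW.
have hxy : h x - h y <= 2 * H.
  by have := hH x; have := hH y; rewrite !ler_norml; lra.
have [near_y|] := pselect (forall j, `|y j 0 - x j 0| < r).
  have /hr : ball y r x by split=> // i j; rewrite ord1; exact: near_y.
  rewrite /ball/= ltr_norml => /andP[hy _].
  have := mulr_ge0 C0 (separation_ge0 M y x); lra.
move=> /existsNP[j /negP]; rewrite -leNgt => rj.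
have kD : 1 - cos r1 <= separation M y x.
  rewrite /separation (bigD1 j)//=.
  apply: (@le_trans _ _ (1 - cos ((x j 0 - y j 0) / M))); last first.
    rewrite lerDl; apply: sumr_ge0 => i _; rewrite subr_ge0.
    by apply: le_trans (cos_max _); exact: ler_norm.
  have -> : cos ((x j 0 - y j 0) / M) = cos (`|x j 0 - y j 0| / M).
    have [?|?] := leP 0 (x j 0 - y j 0); first by rewrite ger0_norm.
    by rewrite ltr0_norm// mulNr cosN.
  have t2 : `|x j 0 - y j 0| / M <= 2.
    rewrite ler_pdivrMr//; apply: le_trans (ler_normB _ _) _.
    by have := Bx j; have := By j; rewrite /box/=; lra.
  have rt : r1 <= `|x j 0 - y j 0| / M.
    by rewrite /r1 ge_min ler_pM2r ?invr_gt0// distrC rj.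
  rewrite lerD2l lerN2 leNgt ltr_cos -?leNgt// in_itv/=; apply/andP; split; lra.
have : 2 * H <= C * separation M y x.
  by rewrite /C -mulrA ler_peMr ?mulr_ge0// mulrC ler_pdivlMr// mul1r.
lra.
Qed.

(** Every majorant [F y] is within [3 * e4] of [h] near its own [y]; by compactness finitely many of
    these neighbourhoods cover the box, and the minimum of the corresponding majorants is uniformly
    close to [h] there. *)
Lemma trig_approximation e : 0 < e -> exists l,
  (forall x, `|trig_poly l x| <= H + e) /\
  (forall x, (forall j, `|x j 0| <= M) -> `|h x - trig_poly l x| <= e).
Proof.
move=> e0; pose e4 := e / 4; have e40 : 0 < e4 by rewrite divr_gt0.
have : forall y, exists C : R, box y ->
    forall x, box x -> h x <= h y + e4 + C * separation M y x.
  move=> y; have [By|nBy] := pselect (box y); last by exists 0.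
  by have [C CP] := majorant By e40; exists C.
move=> /choice[C CP].
pose F y x := h y + e4 + C y * separation M y x.
have sepc y : continuous (separation M y).
  move=> x; have Fx := nbhs_filter x.
  rewrite /separation; elim: (index_enum _) => [|j s IH].
    by under eq_fun do rewrite big_nil; exact: cst_continuous.
  under eq_fun do rewrite big_cons.
  apply: (@cvgD _ _ _ _ Fx) => //.
  apply: (@cvgB _ _ _ _ Fx); first exact: cvg_cst.
  apply: (@continuous_comp _ _ _ (fun x : 'cV[R]_p => (x j 0 - y j 0) / M) cos).
    apply: (@cvgM _ _ _ Fx); last exact: cvg_cst.
    by apply: (@cvgB _ _ _ _ Fx); [exact: coord_continuous|exact: cvg_cst].
  exact: continuous_cos.
have Fc y : continuous (fun x => h x + 3 * e4 - F y x).
  move=> x; have Fx := nbhs_filter x.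
  apply: (@cvgB _ _ _ _ Fx).
    by apply: (@cvgD _ _ _ _ Fx); [exact: h_cont|exact: cvg_cst].
  apply: (@cvgD _ _ _ _ Fx); first exact: cvg_cst.
  by apply: (@cvgM _ _ _ Fx); [exact: cvg_cst|exact: sepc].
pose U y := (fun x => h x + 3 * e4 - F y x) @^-1` [set t | 0 < t].
have Uo y : open (U y).
  by apply: open_comp (@open_gt R 0) => x _; exact: Fc.
have := compact_box (p := p) (M := M).
rewrite compact_cover => /(_ _ box U (fun y _ => Uo y)).
case=> [y By|s sB sU].
  exists y => //; rewrite /U/= /F /separation big1 => [|j _]; last first.
    by rewrite subrr mul0r cos0 subrr.
  by rewrite mulr0; lra.
(* The default [H] of the minimum and the maximum with [- H] clip the function to [[- H, H]]
   everywhere, without spoiling the approximation in the box, where [h] has the same bounds. *)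
pose Phi x := Num.max (- H) (\big[Num.min/H]_(y <- s) F y x).
have aPhi : almost_trig Phi.
  apply: almost_trig_max; first exact: almost_trig_cst.
  apply: almost_trig_bigmin => y.
  apply: almost_trigD; first exact: almost_trig_cst.
  exact/almost_trigZ/almost_trig_separation.
have PhiH x : `|Phi x| <= H.
  by rewrite ler_norml le_max lexx/= ge_max ge0_cp// bigmin_le_id.
have hPhi x : box x -> h x <= Phi x <= h x + 3 * e4.
  move=> Bx; apply/andP; split.
    rewrite le_max; apply/orP; right; rewrite big_seq.
    elim/big_ind : _ => [|a b ha hb|y ys].
    - by rewrite (le_trans (ler_norm _)).
    - by rewrite le_min ha hb.
    - by apply: CP => //; exact/set_mem/sB.
  rewrite ge_max; apply/andP; split.
    by have := hH x; rewrite ler_norml => /andP[]; lra.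
  have [y /= ys] := sU x Bx; rewrite /U/= subr_gt0 => hU.
  have : y \in (s : seq _) by [].
  elim: (s : seq _) => // z r IH; rewrite inE big_cons ge_min => /predU1P[<-|/IH ->].
    by rewrite (ltW hU).
  by rewrite orbT.
have [l lP] := aPhi _ e40; exists l; split=> x.
  have := PhiH x; have := lP x.
  have : `|trig_poly l x| <= `|Phi x| + `|Phi x - trig_poly l x|.
    by rewrite distrC; apply: le_trans (ler_normD _ _); rewrite addrC subrK.
  by rewrite /e4; lra.
move=> /hPhi/andP[]; have := lP x; rewrite !ler_norml /e4; lra.
Qed.

End approximation.

End trigonometric_polynomials.

(** * Borel measurability of random vectors and tightness *)

Section borel_vectors.
Context (R : realType) (p : nat).

(** By separability an open set is the union of the countably many open cubes with rational center
    and half-width [1 / (n + 1)] that it contains; the preimage of a cube is a finite intersection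
    of coordinate events. *)
Lemma measurable_cV_open d (T : measurableType d) (Z : T -> 'cV[R]_p)
    (U : set 'cV[R]_p) : (forall j, measurable_fun setT (fun w => Z w j 0)) ->
  open U -> measurable (Z @^-1` U).
Proof.
move=> mZ Uo.
pose c (q : 'cV[rat]_p) : 'cV[R]_p := \col_j ratr (q j 0).
pose B (qn : 'cV[rat]_p * nat) := [set x : 'cV[R]_p |
  forall j, `|c qn.1 j 0 - x j 0| < qn.2.+1%:R^-1].
have mB qn : measurable (Z @^-1` B qn).
  have -> : Z @^-1` B qn = \bigcap_(j in [set: 'I_p])
      ((fun w => Z w j 0) @^-1` [set t | `|c qn.1 j 0 - t| < qn.2.+1%:R^-1]).
    by apply/seteqP; split=> w /= wB j; [move=> _|]; exact: wB.
  apply: fin_bigcap_measurable => // j _; rewrite -[X in measurable X]setTI.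
  apply: mZ => //.
  have -> : [set t | `|c qn.1 j 0 - t| < qn.2.+1%:R^-1] = ball (c qn.1 j 0) qn.2.+1%:R^-1.
    by apply/seteqP; split.
  exact: measurable_ball.
have -> : Z @^-1` U = \bigcup_qn (if `[< B qn `<=` U >] then Z @^-1` B qn else set0).
  apply/seteqP; split=> [w /= Uw|w [qn _]]; last first.
    by case: asboolP => // BU; exact: BU.
  have /nbhs_ballP[r /= r0 rU] : nbhs (Z w) U by exact: open_nbhs_nbhs.
  have [n nr] : exists n, 2 * n.+1%:R^-1 < r.
    near \oo => n; exists n; rewrite -ltr_pdivlMl// mulrC.
    by near: n; apply: near_infty_natSinv_lt (PosNum (_ : 0 < r / 2)); rewrite divr_gt0.
  have /choice[q qP] : forall j : 'I_p, exists q : rat,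
      ratr q \in `]Z w j 0 - n.+1%:R^-1, Z w j 0 + n.+1%:R^-1[.
    by move=> j; apply: rat_in_itvoo; rewrite ltrD2l gtrN ?invr_gt0.
  exists (\col_j q j, n) => //.
  have Zw : B (\col_j q j, n) (Z w).
    move=> j; rewrite /c !mxE; have := qP j; rewrite in_itv/= ltr_norml.
    by move: (n.+1%:R^-1) => t; lra.
  rewrite asboolT// => x Bx; apply: rU; split=> // i j; rewrite ord1 /ball/=.
  have := Bx i; have := Zw i; move=> /= H1 H2.
  rewrite -(subrK (c (\col_j q j) i 0) (Z w i 0)) -addrA.
  apply: le_lt_trans (ler_normD _ _) _; rewrite [X in X + _]distrC.
  by move: (n.+1%:R^-1) nr H1 H2 => t; lra.
apply: countable_bigcupT_measurable => [|qn].
  exact: countableP.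
by case: ifP.
Unshelve. all: by end_near. Qed.

Lemma measurable_cV d (T : measurableType d) (Z : T -> 'cV[R]_p) :
    (forall j, measurable_fun setT (fun w => Z w j 0)) ->
  measurable_fun setT (Z : T -> borel 'cV[R]_p).
Proof.
move=> mZ; apply: (@measurability _ _ T (borel 'cV[R]_p) setT Z (@open 'cV[R]_p) erefl).
by move=> _ [U Uo <-]; rewrite setTI; exact: measurable_cV_open.
Qed.

Lemma measurable_continuous (h : 'cV[R]_p -> R) : continuous h ->
  measurable_fun setT (h : borel 'cV[R]_p -> R).
Proof.
move=> ch;
apply: (measurability _ (RGenOInfty.measurableE R)).
move=> _ [_ [x ->] <-]; rewrite setTI; apply: sub_sigma_algebra.
by apply: open_comp => [y _|]; [exact: ch|exact: interval_open].
Qed.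

Lemma measurable_coord j :
  measurable_fun setT (fun x : borel 'cV[R]_p => (x : 'cV[R]_p) j 0).
Proof. by apply: measurable_continuous => x; exact: coord_continuous. Qed.

Lemma measurable_dot (u : 'cV[R]_p) :
  measurable_fun setT (dot u : borel 'cV[R]_p -> R).
Proof. by apply: measurable_continuous; exact: continuous_dot. Qed.

Section trig_poly_expectation.
Context d (T : measurableType d) (Q : probability T R) (Z : T -> 'cV[R]_p).
Hypothesis mZ : forall j, measurable_fun setT (fun w => Z w j 0).

Lemma measurable_cos_dot u b : measurable_fun setT (fun w => cos (dot u (Z w) + b)).
Proof.
apply: (measurableT_comp (f := cos)).
  by apply: continuous_measurable_fun; exact: continuous_cos.
apply: measurable_funD => //; apply: (measurableT_comp (measurable_dot u)).
exact: measurable_cV.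
Qed.

Lemma integrable_cos_dot u b : Q.-integrable setT (EFin \o (fun w => cos (dot u (Z w) + b))).
Proof.
apply: (@Rintegrable_bounded _ _ _ _ _ 1); first exact: measurable_cos_dot.
by move=> w; exact: cos_max.
Qed.

Lemma integrable_trig_poly l : Q.-integrable setT (EFin \o (fun w => trig_poly l (Z w))).
Proof.
by apply: Rintegrable_sum => t; apply: Rintegrable_scale; exact: integrable_cos_dot.
Qed.

Lemma Rintegral_trig_poly l : \int[Q]_w trig_poly l (Z w) =
  \sum_(t <- l) t.1.1 * \int[Q]_w cos (dot t.1.2 (Z w) + t.2).
Proof.
rewrite Rintegral_sum => [|t]; last by apply: Rintegrable_scale; exact: integrable_cos_dot.
by apply: eq_bigr => t _; rewrite RintegralZl//; exact: integrable_cos_dot.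
Qed.

Context (C : R).
Hypothesis Z2 : forall j, Q.-integrable setT (EFin \o (fun w => Z w j 0 ^+ 2)) /\
  \int[Q]_w Z w j 0 ^+ 2 <= C.

(** Inside the box the error is at most [e]. Outside, it is at most [2 * H + e], and there the sum
    of the squared coordinates divided by [M ^+ 2] is at least 1. The resulting pointwise bound is
    integrated. *)
Lemma trig_poly_expectation_error (h : 'cV[R]_p -> R) (H M e : R)
    (l : seq (R * 'cV[R]_p * R)) :
    continuous h -> (forall x, `|h x| <= H) -> 0 < M -> 0 < e ->
    (forall x, `|trig_poly l x| <= H + e) ->
    (forall x : 'cV[R]_p, (forall j, `|x j 0| <= M) -> `|h x - trig_poly l x| <= e) ->
  Q.-integrable setT (EFin \o (fun w => h (Z w))) /\
  `|\int[Q]_w h (Z w) - \int[Q]_w trig_poly l (Z w)| <=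
    e + (2 * H + e) / M ^+ 2 * (C *+ p).
Proof.
move=> ch hH M0 e0 lH hl.
have mh : measurable_fun setT (fun w => h (Z w)).
  by apply: (measurableT_comp (measurable_continuous ch)); exact: measurable_cV.
have ih : Q.-integrable setT (EFin \o (fun w => h (Z w))).
  exact: (@Rintegrable_bounded _ _ _ _ _ H).
split=> //.
have il := integrable_trig_poly l.
rewrite -RintegralB//.
have id := Rintegrable_sub ih il.
apply: le_trans (le_normr_Rintegral measurableT id) _.
have H0 : 0 <= H by apply: le_trans (hH 0); exact: normr_ge0.
have He : 0 <= (2 * H + e) / M ^+ 2.
  by rewrite divr_ge0 ?sqr_ge0// addr_ge0 ?mulr_ge0// ltW.
have isum : Q.-integrable setT (EFin \o (fun w => \sum_j Z w j 0 ^+ 2)).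
  by apply: Rintegrable_sum => j; case: (Z2 j).
apply: (@le_trans _ _ (\int[Q]_w (e + (2 * H + e) / M ^+ 2 * \sum_j Z w j 0 ^+ 2))).
  apply: le_Rintegral => //.
  - exact: integrable_norm.
  - by apply: Rintegrable_add; [exact: Rintegrable_cst|exact: Rintegrable_scale].
  move=> w _.
  have S0 : 0 <= \sum_j Z w j 0 ^+ 2 by apply: sumr_ge0 => j _; exact: sqr_ge0.
  have [bx|] := pselect (forall j, `|Z w j 0| <= M).
    by rewrite (le_trans (hl _ bx))// lerDl mulr_ge0.
  move=> /existsNP[j /negP]; rewrite -ltNge => Mj.
  have M1 : 1 <= (\sum_j Z w j 0 ^+ 2) / M ^+ 2.
    rewrite ler_pdivlMr ?exprn_gt0// mul1r (bigD1 j)//=.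
    rewrite (@le_trans _ _ (Z w j 0 ^+ 2))//.
      by rewrite -[leRHS]real_normK ?num_real// lerXn2r ?nnegrE ?(ltW M0)// ltW.
    by rewrite lerDl; apply: sumr_ge0 => i _; exact: sqr_ge0.
  apply: le_trans (ler_normB _ _) _.
  apply: (@le_trans _ _ (2 * H + e)).
    by have := hH (Z w); have := lH (Z w); lra.
  rewrite -[leLHS]add0r; apply: lerD; first exact: ltW.
  rewrite -mulrA [_^-1 * _]mulrC ler_peMr//.
  by rewrite addr_ge0 ?mulr_ge0// ltW.
rewrite RintegralD//; last 2 first.
- exact: Rintegrable_cst.
- exact: Rintegrable_scale.
rewrite Rintegral_probability_cst lerD2l RintegralZl// ler_wpM2l//.
rewrite Rintegral_sum; last by move=> j; case: (Z2 j).
apply: (@le_trans _ _ (\sum_(j < p) C)).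
  by apply: ler_sum => j _; case: (Z2 j).
by rewrite sumr_const card_ord.
Qed.

End trig_poly_expectation.

(* Chebyshev's inequality makes the laws uniformly tight, and on a large box a
   continuous function is uniformly approximated by trigonometric polynomials. *)
Lemma cvg_in_distribution_cos d (Omega : measurableType d) (P : probability Omega R)
    (Z : nat -> Omega -> 'cV[R]_p) (N : probability (borel 'cV[R]_p) R) (C : R) :
    (forall n j, measurable_fun setT (fun w => Z n w j 0)) ->
    (forall n j, P.-integrable setT (EFin \o (fun w => Z n w j 0 ^+ 2)) /\
       \int[P]_w Z n w j 0 ^+ 2 <= C) ->
    (forall j, N.-integrable setT (EFin \o (fun x : 'cV[R]_p => x j 0 ^+ 2)) /\
       \int[N]_x (x : 'cV[R]_p) j 0 ^+ 2 <= C) ->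
    (forall u b, \int[P]_w cos (dot u (Z n w) + b) @[n --> \oo] -->
       \int[N]_x cos (dot u x + b)) ->
  cvg_in_distribution P Z N.
Proof.
move=> mZ Z2 N2 cosZ h ch [H [_ hH']].
have hH x : `|h x| <= H + 1 by apply: hH'; rewrite ?ltrDl.
move: (H + 1) hH => {H hH'} H hH.
have mid j : measurable_fun setT (fun x : borel 'cV[R]_p => (x : 'cV[R]_p) j 0).
  exact: measurable_coord.
have H0 : 0 <= H by apply: le_trans (hH 0); exact: normr_ge0.
have ihZ n : P.-integrable setT (EFin \o (h \o Z n)).
  apply: (@Rintegrable_bounded _ _ _ _ _ H) => [|w]; last exact: hH.
  by apply: (measurableT_comp (measurable_continuous ch)); exact: measurable_cV.
have ihN : N.-integrable setT (EFin \o h).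
  by apply: (@Rintegrable_bounded _ _ _ _ _ H); first exact: measurable_continuous.
suff hR : \int[P]_w h (Z n w) @[n --> \oo] --> \int[N]_x h x.
  rewrite unlock [X in _ --> X](EFin_Rintegral ihN); apply/fine_cvgP; split.
    by apply: nearW => n; rewrite [X in X \is a fin_num](EFin_Rintegral (ihZ n)).
  exact: hR.
apply/cvgrPdist_le => eps eps0.
(* Each of the two laws costs [2 * e], for the box and for the tail, and the convergence of the
   trigonometric expectations costs [e]. *)
pose e : R := eps / 5; have e0 : 0 < e by rewrite divr_gt0.
pose A := (2 * H + e) * (`|C| *+ p).
have A0 : 0 <= A by rewrite mulr_ge0 ?mulrn_wge0// addr_ge0 ?mulr_ge0// ltW.
(* Makes the tail term, which is at most [A / M ^+ 2], no larger than [e]. *)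
pose M := Num.sqrt (A / e + 1).
have A1 : 0 < A / e + 1 by rewrite ltr_wpDl ?divr_ge0// ltW.
have M0 : 0 < M by rewrite sqrtr_gt0.
have M2 : (2 * H + e) / M ^+ 2 * (C *+ p) <= e.
  rewrite /M sqr_sqrtr ?(ltW A1)// mulrAC ler_pdivrMr//.
  apply: (@le_trans _ _ A).
    apply: ler_wpM2l; first by rewrite addr_ge0 ?mulr_ge0// ltW.
    by rewrite lerMn2r ler_norm orbT.
  by rewrite mulrDr mulr1 mulrC divfK ?gt_eqF// lerDl ltW.
have [l [lH hl]] := trig_approximation ch hH M0 e0.
have [_ errN] := trig_poly_expectation_error mid N2 ch hH M0 e0 lH hl.
have errZ n := (trig_poly_expectation_error (mZ n) (Z2 n) ch hH M0 e0 lH hl).2.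
have lcvg : \int[P]_w trig_poly l (Z n w) @[n --> \oo] --> \int[N]_x trig_poly l x.
  rewrite (Rintegral_trig_poly _ mid).
  under eq_fun do rewrite Rintegral_trig_poly//.
  elim: (l) => [|t s IH].
    rewrite big_nil; have -> : (fun n => \sum_(t <- [::]) t.1.1 *
      \int[P]_w cos (dot t.1.2 (Z n w) + t.2)) = (fun=> 0 : R).
      by apply/funext => n; rewrite big_nil.
    exact: cvg_cst.
  rewrite big_cons; have -> : (fun n => \sum_(t <- t :: s) t.1.1 *
    \int[P]_w cos (dot t.1.2 (Z n w) + t.2)) = (fun n => t.1.1 *
    \int[P]_w cos (dot t.1.2 (Z n w) + t.2) + \sum_(t <- s) t.1.1 *
    \int[P]_w cos (dot t.1.2 (Z n w) + t.2)).
    by apply/funext => n; rewrite big_cons.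
  by apply: cvgD => //; apply: cvgM; [exact: cvg_cst|exact: cosZ].
near=> n.
have lZ : `|\int[N]_x trig_poly l x - \int[P]_w trig_poly l (Z n w)| <= e.
  by near: n; exact: (cvgrPdist_le _ _).1 lcvg _ e0.
move: errN (errZ n) lZ M2; rewrite /e.
move: (\int[N]_x h x) (\int[P]_w h (Z n w)) (\int[N]_x trig_poly l x)
  (\int[P]_w trig_poly l (Z n w)) ((_ / _) * _) => a b a' b' c.
by rewrite !ler_norml; lra.
Unshelve. all: by end_near. Qed.

End borel_vectors.

(** * The standard normal law *)

Section density.
Local Open Scope ereal_scope.
Context d (T : measurableType d) (R : realType).
Context (mu nu : {measure set T -> \bar R}) (g : T -> R).
Hypotheses (mg : measurable_fun setT g) (g0 : forall x, (0 <= g x)%R).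
Hypothesis nuE : forall B, measurable B -> nu B = \int[mu]_(x in B) (g x)%:E.

Let mEg : measurable_fun setT (EFin \o g).
Proof. exact/measurable_EFinP. Qed.

Let density_indic E : measurable E ->
  \int[nu]_x (\1_E x)%:E = \int[mu]_x ((\1_E x)%:E * (g x)%:E).
Proof.
move=> mE; rewrite integral_indic// setIT nuE// integral_mkcond.
apply: eq_integral => x _; rewrite patchE indicE.
by case: (x \in E); rewrite ?mul1e ?mul0e.
Qed.

Import HBNNSimple.

Let density_nnsfun (h : {nnsfun T >-> R}) :
  \int[nu]_x (h x)%:E = \int[mu]_x ((h x)%:E * (g x)%:E).
Proof.
under [LHS]eq_integral do rewrite fimfunE -fsumEFin//.
rewrite [LHS]ge0_integral_fsum//; last 2 first.
  - by move=> r; exact/measurable_EFinP/measurableT_comp.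
  - by move=> n x _; rewrite EFinM nnfun_muleindic_ge0.
under [RHS]eq_integral.
  move=> x xD; rewrite fimfunE -fsumEFin// ge0_mule_fsuml; last first.
    by move=> r; rewrite EFinM nnfun_muleindic_ge0.
  over.
rewrite [RHS]ge0_integral_fsum//; last 2 first.
  - move=> r; apply: emeasurable_funM => //.
    by apply/measurable_EFinP/measurableT_comp.
  - move=> n x _; apply: mule_ge0; last by rewrite lee_fin.
    by rewrite EFinM nnfun_muleindic_ge0.
apply: eq_fsbigr => r _.
have [r0|r0] := leP 0%R r; last first.
  by rewrite preimage_nnfun0// !integral0_eq// => x _; rewrite indic0 mulr0 ?mul0e.
under eq_integral do rewrite EFinM.
rewrite ge0_integralZl//; last exact/measurable_EFinP.
rewrite density_indic// -ge0_integralZl//.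
- by apply: eq_integral => x _; rewrite muleA EFinM.
- by apply: emeasurable_funM => //; exact/measurable_EFinP.
- by move=> x _; rewrite mule_ge0 ?lee_fin.
Qed.

(** The usual passage from indicators to simple functions to monotone limits. It serves both the
    normal density and the density [g] of the design. *)
Lemma ge0_integral_density (f : T -> \bar R) : measurable_fun setT f ->
  (forall x, 0 <= f x) -> \int[nu]_x f x = \int[mu]_x (f x * (g x)%:E).
Proof.
move=> mf f0; pose f_ := nnsfun_approx measurableT mf.
transitivity (limn (fun n => \int[nu]_x (f_ n x)%:E)).
  rewrite -monotone_convergence//=.
  - by apply: eq_integral => x _; apply/esym/cvg_lim => //; exact: cvg_nnsfun_approx.
  - by move=> n; exact/measurable_EFinP.
  - by move=> n x _; rewrite lee_fin.
  - by move=> x _ a b ab; rewrite lee_fin//; exact/lefP/nd_nnsfun_approx.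
transitivity (limn (fun n => \int[mu]_x ((f_ n x)%:E * (g x)%:E))).
  by congr (limn _); apply/funext => n; exact: density_nnsfun.
rewrite -monotone_convergence//=.
- apply: eq_integral => x _; apply/cvg_lim => //.
  apply: cvgeZr => //; exact: cvg_nnsfun_approx.
- by move=> n; apply: emeasurable_funM => //; exact/measurable_EFinP.
- by move=> n x _; rewrite mule_ge0 ?lee_fin.
- move=> x _ a b ab; rewrite lee_wpmul2r ?lee_fin//.
  exact/lefP/nd_nnsfun_approx.
Qed.

End density.

Section lebesgue_affine.
Context (R : realType).
Local Notation mu := (@lebesgue_measure R).

Let affine (c a : R) (x : R) : R := c * x + a.

Let measurable_affine c a : measurable_fun [set: measurableTypeR R]
  (affine c a : _ -> measurableTypeR R).
Proof. by apply: measurable_funD => //; exact: measurable_funM. Qed.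

Let image_measure (c a : R) : {measure set (measurableTypeR R) -> \bar R}.
Proof.
pose m : {measure set (measurableTypeR R) -> \bar R} :=
  pushforward mu (affine c a : _ -> measurableTypeR R).
exact: (m (measurable_affine c a)).
Defined.

(** The scaled image measure agrees with Lebesgue measure on half-open intervals, which determine
    the latter. For [c < 0] the preimage is half-open on the other side, with the same length. *)
Let lebesgue_affine_set (c a : R) (B : set R) : c != 0 -> measurable B ->
  (mu B = `|c|%:E * mu (affine c a @^-1` B))%E.
Proof.
move=> c0 mB.
have c0' : 0 < `|c| by rewrite normr_gt0.
pose nu : {measure set (measurableTypeR R) -> \bar R} :=
  mscale (NngNum (ltW c0')) (image_measure c a).
have -> : (`|c|%:E * mu (affine c a @^-1` B))%E = nu B by [].
apply: (@lebesgue_measure_unique _ nu _ _ mB) => _ [[u v] _ <-] /=.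
rewrite /nu /mscale/= /pushforward/=.
have -> : affine c a @^-1` `]u, v]%classic = if 0 < c
    then `](u - a) / c, (v - a) / c]%classic else `[(v - a) / c, (u - a) / c[%classic.
  apply/seteqP; split=> x; rewrite /= /affine in_itv/=; case: ifPn => cp;
    rewrite /= in_itv/=.
  - by rewrite ltr_pdivrMr// ler_pdivlMr// ![x * c]mulrC ltrBlDr lerBrDr.
  - have cn : c < 0 by rewrite lt_neqAle c0/= leNgt.
    rewrite ler_ndivrMr// ltr_ndivlMr// ![x * c]mulrC ltrBlDr lerBrDr.
    by rewrite andbC.
  - by rewrite ltr_pdivrMr// ler_pdivlMr// ![x * c]mulrC ltrBlDr lerBrDr.
  - have cn : c < 0 by rewrite lt_neqAle c0/= leNgt.
    rewrite ler_ndivrMr// ltr_ndivlMr// ![x * c]mulrC ltrBlDr lerBrDr.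
    by rewrite andbC.
case: ifPn => cp; rewrite !lebesgue_measure_itv/= !lte_fin.
  rewrite ltr_pM2r ?invr_gt0// ltrD2r; case: ifPn => uv; last by rewrite mule0.
  rewrite -!EFinD -EFinM; congr (_%:E); rewrite gtr0_norm//.
  by field.
have cn : c < 0 by rewrite lt_neqAle c0/= leNgt.
rewrite ltr_nM2r ?invr_lt0// ltrD2r; case: ifPn => uv; last by rewrite mule0.
rewrite -!EFinD -EFinM; congr (_%:E); rewrite ltr0_norm//.
by field.
Qed.

Lemma lebesgue_ge0_integral_affine (c a : R) (f : R -> \bar R) : c != 0 ->
  measurable_fun setT f -> (forall x, 0 <= f x)%E ->
  (\int[mu]_x f x = `|c|%:E * \int[mu]_x f (c * x + a)%R)%E.
Proof.
move=> c0 mf f0.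
have c0' : 0 < `|c| by rewrite normr_gt0.
have := @ge0_integral_pushforward _ _ _ _ _ _ (@measurable_affine c a) mu setT f
  measurableT mf (fun x _ => f0 x).
rewrite preimage_setT /comp => <-.
rewrite -(@ge0_integral_mscale _ _ _ (image_measure c a) _ measurableT
  (NngNum (ltW c0')))//.
by apply: eq_measure_integral => B mB _; exact: lebesgue_affine_set.
Qed.

End lebesgue_affine.

(** * Scaling, convolution and moments of the standard normal law *)

Section standard_normal.
Context (R : realType).
Local Notation mu := (@lebesgue_measure R).
Local Notation gamma := (@normal_prob R 0 1).

Lemma normal_pdf_affine (a s x : R) : s != 0 ->
  `|s| * normal_pdf a s (s * x + a) = normal_pdf 0 1 x.
Proof.
move=> s0; rewrite !normal_pdfE ?oner_eq0// /normal_peak /normal_fun.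
have -> : s * x + a - a = s * x by ring.
rewrite subr0 expr1n !mul1r mulrA; congr (_ * expR _); last first.
  by rewrite exprMn; field.
rewrite -[s ^+ 2 * pi *+ 2]mulrnAr sqrtrM ?sqr_ge0// sqrtr_sqr invfM mulrA divff ?mul1r//.
by rewrite normr_eq0.
Qed.

Lemma normal_prob_affine (a s : R) (B : set R) : s != 0 -> measurable B ->
  normal_prob a s B = gamma [set x | B (s * x + a)].
Proof.
move=> s0 mB; rewrite /normal_prob integral_mkcond [RHS]integral_mkcond.
rewrite (@lebesgue_ge0_integral_affine _ s a)//; last 2 first.
- apply/(measurable_restrictT _ _).1 => //; apply/measurable_EFinP.
  by apply: measurable_funTS; exact: measurable_normal_pdf.
- by move=> x; rewrite patchE; case: ifP => // _; rewrite lee_fin normal_pdf_ge0.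
rewrite -ge0_integralZl//.
- apply: eq_integral => x _; rewrite !patchE.
  have -> : (x \in [set x | B (s * x + a)]) = (s * x + a \in B) by [].
  by case: ifP => _; rewrite ?mule0// -EFinM normal_pdf_affine.
- apply: (measurableT_comp (f := (fun x => (normal_pdf a s x)%:E) \_ B)).
    apply/(measurable_restrictT _ _).1 => //; apply/measurable_EFinP.
    by apply: measurable_funTS; exact: measurable_normal_pdf.
  by apply: measurable_funD => //; exact: measurable_funM.
- by move=> x _; rewrite patchE; case: ifP => // _; rewrite lee_fin normal_pdf_ge0.
Qed.

(** At [s = 0] the map is constant, which matches the Dirac branch; otherwise the density depends on
    [s] only through its square. Degenerate normal laws need no special treatment afterwards. *)
Lemma normal_lawE (s : R) (B : set R) : measurable B ->
  normal_law 0 (s ^+ 2) B = gamma [set x | B (s * x)].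
Proof.
move=> mB; rewrite /normal_law sqrf_eq0; case: ifPn => [/eqP->|s0].
  rewrite diracE; have [B0|B0] := pselect (B 0).
    rewrite mem_set//; have -> : [set x | B (0 * x)] = setT.
      by apply/seteqP; split=> // x _ /=; rewrite mul0r.
    by rewrite probability_setT.
  rewrite memNset//; have -> : [set x | B (0 * x)] = set0.
    by apply/seteqP; split=> // x /=; rewrite mul0r.
  by rewrite measure0.
have -> : normal_prob 0 (Num.sqrt (s ^+ 2)) B = normal_prob 0 s B.
  rewrite /normal_prob; apply: eq_integral => x _; congr (_%:E).
  rewrite !normal_pdfE ?sqrtr_eq0 -?ltNge ?exprn_even_gt0//.
  by rewrite /normal_peak /normal_fun sqr_sqrtr ?sqr_ge0.
by rewrite normal_prob_affine//; under eq_set do rewrite addr0.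
Qed.

Lemma normal_pdfS (a s x : R) : s != 0 ->
  normal_pdf a s x = `|s|^-1 * normal_pdf 0 1 ((x - a) / s).
Proof.
move=> s0; rewrite -(@normal_pdf_affine a s)// mulKf ?normr_eq0//.
by congr normal_pdf; field.
Qed.

Lemma ge0_integral_gamma (f : R -> \bar R) : measurable_fun setT f ->
  (forall x, 0 <= f x)%E ->
  (\int[gamma]_x f x = \int[mu]_x (f x * (normal_pdf 0 1 x)%:E))%E.
Proof.
move=> mf f0; apply: ge0_integral_density => //.
- exact: measurable_normal_pdf.
- by move=> x; exact: normal_pdf_ge0.
Qed.

(* Completing the square in the Gaussian exponents. *)
Let pdf_mul (s c r y z : R) : 0 < s -> 0 < r -> r ^+ 2 = s ^+ 2 + c ^+ 2 ->
  normal_pdf (c * z) s y * normal_pdf 0 1 z =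
  normal_pdf 0 r y * normal_pdf (c * y / r ^+ 2) (s / r) z.
Proof.
move=> s0 r0 rE.
have sr0 : 0 < s / r by rewrite divr_gt0.
have pE (t : R) : 0 < t -> normal_peak t = t^-1 * @normal_peak R 1.
  move=> t0; rewrite /normal_peak expr1n mul1r -[t ^+ 2 * pi *+ 2]mulrnAr sqrtrM ?sqr_ge0//.
  by rewrite sqrtr_sqr invfM gtr0_norm.
rewrite !normal_pdfE ?oner_eq0 ?gt_eqF// (pE s)// (pE r)// (pE (s / r))//.
rewrite /normal_fun [LHS]mulrACA [RHS]mulrACA -!expRD; congr (_ * expR _).
  by field; rewrite !gt_eqF.
have rne : r != 0 by rewrite gt_eqF.
have sne : s != 0 by rewrite gt_eqF.
have cE : c ^+ 2 = r ^+ 2 - s ^+ 2 by rewrite rE; ring.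
have : s ^+ 2 * r ^+ 2 * (- (y - c * z) ^+ 2 / (s ^+ 2 *+ 2) + - (z - 0) ^+ 2 / (1 ^+ 2 *+ 2)) =
  s ^+ 2 * r ^+ 2 * (- (y - 0) ^+ 2 / (r ^+ 2 *+ 2) +
    - (z - c * y / r ^+ 2) ^+ 2 / ((s / r) ^+ 2 *+ 2)).
  transitivity (- (r ^+ 2 * (y ^+ 2 - 2 * c * y * z + c ^+ 2 * z ^+ 2) + s ^+ 2 * r ^+ 2 * z ^+ 2) / 2).
    by field.
  transitivity (- (s ^+ 2 * y ^+ 2 + r ^+ 4 * z ^+ 2 - 2 * r ^+ 2 * c * y * z + c ^+ 2 * y ^+ 2) / 2); last by field; rewrite rne.
  by rewrite cE; field.
by apply: mulfI; rewrite mulf_neq0// expf_neq0.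
Qed.

(** Convolution of two centered normal laws, written as the mixture that sections of a product
    measure produce. [pdf_mul] factors the joint density into the density of the sum and a
    conditional density of [z], which integrates to 1 after exchanging the integrals. *)
Lemma normal_stable (s c : R) (B : set R) : 0 <= s -> measurable B ->
  (\int[gamma]_z gamma [set y | B (s * y + c * z)%R] =
   gamma [set x | B (Num.sqrt (s ^+ 2 + c ^+ 2) * x)%R])%E.
Proof.
move=> s0 mB.
rewrite -normal_lawE// sqr_sqrtr ?addr_ge0 ?sqr_ge0//.
(* For [s = 0] the law of the inner variable has no density: it is the point mass at [c * z]. *)
have [->|sn0] := eqVneq s 0.
  rewrite expr0n/= add0r normal_lawE//.
  have mC : measurable [set z | B (c * z)].
    rewrite -[X in measurable X]setTI.
    by apply: (@measurable_funM _ _ _ setT (cst c) id) => //.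
  transitivity (\int[gamma]_z (\1_[set z | B (c * z)] z)%:E)%E; last first.
    by rewrite integral_indic// setIT.
  apply: eq_integral => z _; rewrite indicE.
  have [Bz|Bz] := pselect (B (c * z)).
    rewrite mem_set//; have -> : [set y | B (0 * y + c * z)] = setT.
      by apply/seteqP; split=> // x _ /=; rewrite mul0r add0r.
    by rewrite probability_setT.
  rewrite memNset//; have -> : [set y | B (0 * y + c * z)] = set0.
    by apply/seteqP; split=> // x /=; rewrite mul0r add0r.
  by rewrite measure0.
have {s0 sn0} s0 : 0 < s by rewrite lt_neqAle eq_sym sn0.
set q := s ^+ 2 + c ^+ 2; pose r := Num.sqrt q.
have q0 : 0 < q by rewrite ltr_pwDl ?exprn_gt0 ?sqr_ge0.
have r0 : 0 < r by rewrite sqrtr_gt0.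
have rE : r ^+ 2 = q by rewrite sqr_sqrtr ?ltW.
have mpdf : measurable_fun setT (fun zy : R * R => normal_pdf (c * zy.1) s zy.2).
  under eq_fun do rewrite normal_pdfS ?gt_eqF//.
  apply: measurable_funM => //; apply: measurableT_comp.
    exact: measurable_normal_pdf.
  by apply: measurable_funM => //; apply: measurable_funB => //; exact: measurable_funM.
pose F (zy : R * R) : \bar R :=
  ((\1_B zy.2 * normal_pdf (c * zy.1) s zy.2)%:E * (normal_pdf 0 1 zy.1)%:E)%E.
have F0 zy : (0 <= F zy)%E by rewrite /F -EFinM lee_fin !mulr_ge0 ?normal_pdf_ge0.
have mF : measurable_fun setT F.
  apply/measurable_EFinP; apply: measurable_funM.
    apply: measurable_funM => //.
    have m1B : measurable_fun setT (\1_B : R -> R) by exact: measurable_indic.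
    exact: (measurableT_comp m1B (@measurable_snd _ _ R R)).
  exact: (measurableT_comp (measurable_normal_pdf 0 1) (@measurable_fst _ _ R R)).
transitivity (\int[mu]_z \int[mu]_y F (z, y))%E.
  rewrite ge0_integral_gamma//.
  - apply: eq_integral => z _; rewrite -(@normal_prob_affine (c * z))// ?gt_eqF//.
    rewrite /normal_prob integral_mkcond muleC -ge0_integralZl//.
    + apply: eq_integral => y _; rewrite /F/= patchE indicE [RHS]muleC.
      by case: (y \in B); rewrite ?mul1r ?mul0r.
    + apply/(measurable_restrictT _ _).1 => //; apply/measurable_EFinP.
      by apply: measurable_funTS; exact: measurable_normal_pdf.
    + by move=> y _; rewrite patchE; case: ifP => // _; rewrite lee_fin normal_pdf_ge0.
    + by rewrite lee_fin normal_pdf_ge0.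
  - pose A := [set zy : R * R | B (s * zy.2 + c * zy.1)].
    have mA : measurable A.
      rewrite -[X in measurable X]setTI.
      have mh : measurable_fun setT (fun zy : R * R => s * zy.2 + c * zy.1).
        by apply: measurable_funD; exact: measurable_funM.
      exact: mh.
    have := @measurable_fun_xsection _ _ _ _ R gamma _ mA.
    apply: eq_measurable_fun => z _ /=; congr (gamma _).
    by apply/seteqP; split=> y; rewrite /xsection/= inE.
rewrite (@fubini_tonelli _ _ _ _ _ mu mu)//.
rewrite /normal_law gt_eqF// -/r /normal_prob [RHS]integral_mkcond.
apply: eq_integral => y _; rewrite patchE.
transitivity (\int[mu]_z ((\1_B y * normal_pdf 0 r y)%:E *
    (normal_pdf (c * y / r ^+ 2) (s / r) z)%:E))%E.
  apply: eq_integral => z _; rewrite /F/= -!EFinM -[in LHS]mulrA (@pdf_mul s c r)//.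
  by rewrite [in LHS]mulrA.
rewrite ge0_integralZl//.
- rewrite integral_normal_pdf mule1 indicE.
  by case: ifP => _; rewrite ?mul1r ?mul0r.
- by apply/measurable_EFinP; exact: measurable_normal_pdf.
- by move=> z _; rewrite lee_fin normal_pdf_ge0.
- by rewrite lee_fin mulr_ge0 ?normal_pdf_ge0.
Qed.

Let gammaN (B : set R) : measurable B -> gamma B = gamma (-%R @^-1` B).
Proof.
move=> mB; have := @normal_prob_affine 0 (-1) B.
rewrite oppr_eq0 oner_eq0 => /(_ isT mB).
have -> : [set x | B (-1 * x + 0)] = -%R @^-1` B.
  by apply/seteqP; split=> x /=; rewrite addr0 mulN1r.
move=> <-; rewrite /normal_prob; apply: eq_integral => x _; congr (_%:E).
by rewrite !normal_pdfE ?oppr_eq0 ?oner_eq0// /normal_peak /normal_fun sqrrN.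
Qed.

(** Multiplied by this exponential, the standard normal density becomes [1 / s] times the normal
    density of standard deviation [1 / s]. *)
Let exp_moment (s : R) : 0 < s ->
  (\int[gamma]_x (expR (- ((s ^+ 2 - 1) * (x ^+ 2 / 2))))%:E = s^-1%:E)%E.
Proof.
move=> s0; rewrite ge0_integral_gamma//; last first.
  apply/measurable_EFinP; apply: measurableT_comp => //; apply: measurableT_comp => //.
  by apply: measurable_funM => //; apply: measurable_funM => //; exact: measurable_funX.
have si0 : 0 < s^-1 by rewrite invr_gt0.
transitivity (\int[mu]_x (s^-1%:E * (normal_pdf 0 s^-1 x)%:E))%E.
  apply: eq_integral => x _; rewrite -!EFinM; congr (_%:E).
  rewrite (@normal_pdfS 0 s^-1) ?gt_eqF// (gtr0_norm si0) mulVKf ?gt_eqF//.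
  rewrite subr0 invrK !normal_pdfE ?oner_eq0// /normal_fun mulrCA -expRD.
  by congr (_ * expR _); field.
rewrite ge0_integralZl//.
- by rewrite integral_normal_pdf mule1.
- by apply/measurable_EFinP; exact: measurable_normal_pdf.
- by move=> x _; rewrite lee_fin normal_pdf_ge0.
- by rewrite lee_fin ltW.
Qed.

(* [(1 - exp (- t y)) / t] increases to [y] as [t] decreases to [0]; with
   [y = x^2 / 2] and [t = s^2 - 1] its expectation is [1 / (s (s + 1))]. *)
Let half_square_lower (s x : R) := (1 - expR (- ((s ^+ 2 - 1) * (x ^+ 2 / 2)))) / (s ^+ 2 - 1).

Let measurable_half_square_lower s :
  measurable_fun setT (fun x => (half_square_lower s x)%:E).
Proof.
apply/measurable_EFinP; apply: measurable_funM => //; apply: measurable_funB => //.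
apply: measurableT_comp => //; apply: measurableT_comp => //.
by apply: measurable_funM => //; apply: measurable_funM => //; exact: measurable_funX.
Qed.

Let half_square_lower_integral (s : R) : 1 < s ->
  (\int[gamma]_x (half_square_lower s x)%:E = (s * (s + 1))^-1%:E)%E.
Proof.
move=> s1; have s0 : 0 < s by rewrite (lt_trans _ s1).
have t0 : 0 < s ^+ 2 - 1 by nra.
have me : measurable_fun setT (fun x : R => expR (- ((s ^+ 2 - 1) * (x ^+ 2 / 2)))).
  apply: measurableT_comp => //; apply: measurableT_comp => //.
  by apply: measurable_funM => //; apply: measurable_funM => //; exact: measurable_funX.
have ie : gamma.-integrable setT (EFin \o (fun x : R => expR (- ((s ^+ 2 - 1) * (x ^+ 2 / 2))))).
  apply: (@Rintegrable_bounded _ _ _ _ _ 1) => // x.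
  rewrite ger0_norm ?expR_ge0// -[leRHS]expR0 ler_expR oppr_le0.
  by rewrite mulr_ge0 ?(ltW t0)// divr_ge0// sqr_ge0.
have i1 : gamma.-integrable setT (EFin \o (fun x : R => 1 - expR (- ((s ^+ 2 - 1) * (x ^+ 2 / 2))))).
  by apply: Rintegrable_sub => //; exact: Rintegrable_cst.
rewrite /half_square_lower.
under eq_integral do rewrite mulrC.
rewrite EFin_Rintegral; last exact: Rintegrable_scale.
rewrite RintegralZl// RintegralB//; last exact: Rintegrable_cst.
rewrite Rintegral_probability_cst.
rewrite [X in 1 - X]/Rintegral exp_moment//=; congr (_%:E); field.
by rewrite !gt_eqF//= addr_gt0.
Qed.

Let sq2 (x : R) := x ^+ 2 / 2.

Let msq2 : measurable_fun setT (EFin \o sq2).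
Proof. by apply/measurable_EFinP; apply: measurable_funM => //; exact: measurable_funX. Qed.

Let sq2_ge0 x : 0 <= sq2 x.
Proof. by rewrite divr_ge0// sqr_ge0. Qed.

Let integral_sq2_ge s : 1 < s -> ((s * (s + 1))^-1%:E <= \int[gamma]_x (sq2 x)%:E)%E.
Proof.
move=> s1; rewrite -half_square_lower_integral//; apply: ge0_le_integral => //.
- move=> x _; rewrite lee_fin divr_ge0//; last by nra.
  rewrite subr_ge0 -[leRHS]expR0 ler_expR oppr_le0 mulr_ge0 ?sq2_ge0//; nra.
- exact: measurable_half_square_lower.
- move=> x _; rewrite lee_fin ler_pdivrMr; last by nra.
  have := expR_ge1Dx (- ((s ^+ 2 - 1) * (x ^+ 2 / 2))).
  by rewrite /sq2; lra.
Qed.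

(** From [exp (t y) >= 1 + t y] comes [y / (1 + t y) <= (1 - exp (- t y)) / t], whose right side has
    expectation below 1/2. The left side increases to [y] along [t = 1 / (n + 1)], and monotone
    convergence applies. *)
Let integral_sq2_le : (\int[gamma]_x (sq2 x)%:E <= (2^-1)%:E)%E.
Proof.
pose k (n : nat) (x : R) := sq2 x / (1 + n.+1%:R^-1 * sq2 x).
have den n x : 0 < 1 + n.+1%:R^-1 * sq2 x :> R.
  by rewrite ltr_pwDl// mulr_ge0// invr_ge0.
have k0 n x : 0 <= k n x by rewrite divr_ge0// ltW.
have mk n : measurable_fun setT (EFin \o k n).
  apply/measurable_EFinP; apply: continuous_measurable_fun => x.
  have csq : sq2 y @[y --> x] --> sq2 x.
    by apply: cvgM; [exact: exprn_continuous|exact: cvg_cst].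
  apply: cvgM => //; apply: cvgV; first by rewrite gt_eqF.
  by apply: cvgD; [exact: cvg_cst|apply: cvgM => //; exact: cvg_cst].
have kcvg x : k n x @[n --> \oo] --> sq2 x.
  rewrite [X in _ --> X](_ : _ = sq2 x / (1 + 0 * sq2 x)); last by rewrite mul0r addr0 divr1.
  apply: cvgM; first exact: cvg_cst.
  apply: cvgV; first by rewrite mul0r addr0 oner_neq0.
  apply: cvgD; first exact: cvg_cst.
  by apply: cvgM; [exact: cvg_harmonic|exact: cvg_cst].
have := @cvg_monotone_convergence _ _ _ gamma _ measurableT (fun n => EFin \o k n) mk
  (fun n x _ => k0 n x).
have -> : (\int[gamma]_x limn ((fun n => EFin \o k n)^~ x) = \int[gamma]_x (sq2 x)%:E)%E.
  apply: eq_integral => x _; apply/cvg_lim => //.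
  by apply: cvg_EFin (kcvg x); exact: nearW.
move=> /(_ _)/cvge_to_le; apply.
  move=> x _ a b ab; rewrite lee_fin ler_wpM2l// lef_pV2 ?posrE//.
  by rewrite lerD2l ler_wpM2r// lef_pV2 ?posrE// ler_nat.
apply: nearW => n.
pose s : R := Num.sqrt (1 + n.+1%:R^-1).
have t0 : 0 < n.+1%:R^-1 :> R by rewrite invr_gt0.
have sE : s ^+ 2 = 1 + n.+1%:R^-1 by rewrite sqr_sqrtr// addr_ge0// ltW.
have s1 : 1 < s by rewrite -[ltLHS]sqrtr1 ltr_sqrt ?ltrDl// addr_gt0.
apply: (@le_trans _ _ (\int[gamma]_x (half_square_lower s x)%:E)%E).
  apply: ge0_le_integral => //.
  - by move=> x _; rewrite lee_fin.
  - exact: mk.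
  - exact: measurable_half_square_lower.
  - move=> x _; rewrite lee_fin /half_square_lower sE addrAC subrr add0r /k.
    move: (n.+1%:R^-1) t0 (den n x) => t t0; rewrite -/(sq2 x) => d0.
    rewrite ler_pdivlMr// mulrAC ler_pdivrMr//.
    have : expR (- (t * sq2 x)) * (1 + t * sq2 x) <= 1.
      rewrite -[leRHS](expRxMexpNx_1 (t * sq2 x)) mulrC ler_wpM2r ?expR_ge0//.
      exact: expR_ge1Dx.
    by move: (expR _) => e; lra.
rewrite half_square_lower_integral// lee_fin lef_pV2 ?posrE//; nra.
Qed.

Lemma gamma_square :
  gamma.-integrable setT (EFin \o (fun x => x ^+ 2)) /\ \int[gamma]_x (x ^+ 2) = 1.
Proof.
have isq2 : gamma.-integrable setT (EFin \o sq2).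
  apply/integrableP; split=> //.
  under eq_integral do rewrite /= ger0_norm ?sq2_ge0//.
  by apply: le_lt_trans integral_sq2_le _; rewrite ltry.
have E (x : R) : x ^+ 2 = 2 * sq2 x by rewrite mulrC divfK.
split; first by under [fun x => x ^+ 2]eq_fun do rewrite E; exact: Rintegrable_scale.
under eq_Rintegral do rewrite E.
rewrite RintegralZl//; apply/eqP.
have /eqP -> : \int[gamma]_x sq2 x == 2^-1; last by rewrite divff.
move: integral_sq2_le integral_sq2_ge; rewrite EFin_Rintegral//.
move: (\int[gamma]_x sq2 x) => r; rewrite lee_fin => r2 rge.
rewrite eq_le r2/= leNgt; apply/negP => rlt.
have r0 : 0 <= r by have := rge 2; rewrite ltr1n lee_fin => /(_ isT); apply: le_trans; rewrite invr_ge0 mulr_ge0.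
(* If [r < 1/2], then [r = (1 - 3 e) / 2] with [e > 0], and the lower bound at [s = 1 + e] fails
   since [(1 - 3 e) (1 + e) (2 + e) < 2]. *)
pose e := (1 - 2 * r) / 3.
have e0 : 0 < e by rewrite /e; lra.
have e1 : e <= 1 by rewrite /e; lra.
have := rge (1 + e); rewrite ltrDl lee_fin => /(_ e0).
have p0 : 0 < (1 + e) * (1 + e + 1) by nra.
rewrite -div1r ler_pdivrMr//.
have -> : r = (1 - 3 * e) / 2 by rewrite /e; lra.
by have := exprn_gt0 3 e0; rewrite exprS; nra.
Qed.

Lemma gamma_mean : \int[gamma]_x x = 0.
Proof.
have ix : gamma.-integrable setT (EFin \o id).
  apply: square_integrable_int; split=> //; exact: gamma_square.1.
have : \int[gamma]_x x = \int[gamma]_x (- x).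
  have mN : measurable_fun [set: measurableTypeR R] (-%R : _ -> measurableTypeR R) by [].
  have mI : measurable_fun [set: measurableTypeR R] (id : _ -> measurableTypeR R) by [].
  have H := @equal_law_Rintegral _ _ _ _ _ gamma gamma _ _ _ _ mN mI (fun B mB => esym (gammaN mB)) id.
  by apply/esym; exact: H.
rewrite (_ : (fun x : R => - x) = (fun x => -1 * x)); last first.
  by apply/funext => x; rewrite mulN1r.
by rewrite RintegralZl//; lra.
Qed.

End standard_normal.

(** * Gaussian vectors *)

Section positive_semidefinite.
Context (R : realType) (p : nat).
Implicit Types (S : 'M[R]_p) (u b : 'cV[R]_p) (s : seq 'cV[R]_p).

Definition quad S u : R := (u^T *m S *m u) 0 0.

Lemma quad_shift S u i t : S^T = S ->
  quad S (u - t *: delta_mx i 0) =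
  quad S u - 2 * t * (S *m u) i 0 + t ^+ 2 * S i i.
Proof.
move=> Ssym; rewrite /quad.
have -> : (u - t *: delta_mx i 0)^T = u^T - t *: delta_mx 0 i.
  by rewrite linearB/= linearZ/= trmx_delta.
have entries (A B C D : 'M[R]_1) : (A - t *: B - (t *: C - t *: (t *: D))) 0 0 =
  A 0 0 - t * B 0 0 - (t * C 0 0 - t * (t * D 0 0)) by rewrite !mxE.
rewrite !(mulmxBl, mulmxBr) -!(scalemxAl, scalemxAr) entries.
have -> : (u^T *m S *m delta_mx i (0 : 'I_1)) 0 0 = (S *m u) i 0.
  by rewrite -colE -[X in u^T *m X]Ssym -trmx_mul mxE mxE.
have -> : (delta_mx (0 : 'I_1) i *m S *m u) 0 0 = (S *m u) i 0.
  by rewrite -mulmxA -rowE mxE.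
have -> : (delta_mx (0 : 'I_1) i *m S *m delta_mx i (0 : 'I_1)) 0 0 = S i i.
  by rewrite -colE mxE -rowE mxE.
by ring.
Qed.

Lemma quad_delta S i : quad S (delta_mx i 0) = S i i.
Proof. by rewrite /quad trmx_delta -colE mxE -rowE mxE. Qed.

Lemma quadDl S T u : quad (S + T) u = quad S u + quad T u.
Proof. by rewrite /quad mulmxDr mulmxDl mxE. Qed.

Definition sum_outer s : 'M[R]_p := \sum_(b <- s) b *m b^T.

Lemma quad_outer b u : quad (b *m b^T) u = dot u b ^+ 2.
Proof.
rewrite /quad mulmxA -mulmxA mxE big_ord1 expr2; congr (_ * _).
  by rewrite dotE.
by rewrite mxE; apply: eq_bigr => j _; rewrite mxE mulrC.
Qed.

(** Induction on the number of nonzero diagonal entries, which admits singular matrices: a zero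
    diagonal entry of a positive semidefinite matrix forces its whole column to vanish. *)
Lemma sum_outer_decomposition S : S^T = S -> (forall u, 0 <= quad S u) ->
  exists s, S = sum_outer s.
Proof.
have [n] := ubnP #|[pred i | S i i != 0]|; elim: n S => // n IH S Sn Ssym Spos.
have Sjj j : 0 <= S j j.
  by rewrite -quad_delta.
have zero i j : S j j = 0 -> S i j = 0.
  move=> Sj; apply/eqP; apply: contraT => Sij.
  (* The multiple of the second basis vector is tuned so that the form takes the value -1. *)
  have := Spos (delta_mx i 0 - ((S i i + 1) / (2 * S i j)) *: delta_mx j 0).
  rewrite quad_shift// Sj mulr0 addr0 quad_delta -colE mxE.
  have -> : S j i = S i j by rewrite -[in LHS]Ssym mxE.
  have -> : 2 * ((S i i + 1) / (2 * S i j)) * S i j = S i i + 1 by field.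
  lra.
(* One step of the Cholesky decomposition, clearing the i-th row and column. *)
have [i /= Si0|S0] := pickP [pred i | S i i != 0]; last first.
  exists [::]; rewrite /sum_outer big_nil; apply/matrixP => i j; rewrite mxE.
  by apply: zero; apply/eqP/negbFE; exact: S0.
have Si : 0 < S i i by rewrite lt_neqAle eq_sym Si0 Sjj.
pose b := (Num.sqrt (S i i))^-1 *: col i S.
have bE k l : (b *m b^T) k l = S k i * S l i / S i i.
  rewrite mxE big_ord1 !mxE mulrACA -invfM -expr2 sqr_sqrtr ?ltW//.
  by rewrite mulrC.
have dE k l : (S - b *m b^T) k l = S k l - S k i * S l i / S i i.
  by rewrite -bE !mxE.
have [|||s SE] := IH (S - b *m b^T).
- rewrite -ltnS; apply: leq_trans Sn; rewrite ltnS; apply: proper_card.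
  apply/properP; split.
    apply/fintype.subsetP => j; rewrite !inE; apply: contra => /eqP Sj.
    have := zero i _ Sj; rewrite -[in X in X -> _]Ssym mxE dE Sj => ->.
    by rewrite !mul0r subr0.
  exists i; first by rewrite inE.
  by rewrite inE negbK dE mulfK ?subrr.
- by rewrite linearB/= trmx_mul trmxK Ssym.
(* This shift minimizes the form along the i-th direction, and the minimum is the value of the
   reduced form at [u], which is therefore nonnegative. *)
- move=> u; have := Spos (u - ((S *m u) i 0 / S i i) *: delta_mx i 0).
  rewrite quad_shift//.
  have -> : quad (S - b *m b^T) u = quad S u - (S *m u) i 0 ^+ 2 / S i i.
    have := quadDl (S - b *m b^T) (b *m b^T) u; rewrite subrK => ->.
    rewrite quad_outer; suff -> : dot u b ^+ 2 = (S *m u) i 0 ^+ 2 / S i i by ring.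
    have -> : dot u b = (Num.sqrt (S i i))^-1 * (S *m u) i 0.
      rewrite /dot mxE mulr_sumr; apply: eq_bigr => j _; rewrite !mxE.
      have -> : S j i = S i j by rewrite -[in LHS]Ssym mxE.
      by rewrite mulrCA [u j 0 * _]mulrC.
    by rewrite exprMn exprVn sqr_sqrtr ?(ltW Si)// mulrC.
  suff -> : quad S u - 2 * ((S *m u) i 0 / S i i) * (S *m u) i 0 +
    ((S *m u) i 0 / S i i) ^+ 2 * S i i = quad S u - (S *m u) i 0 ^+ 2 / S i i by [].
  by field.
exists (b :: s); rewrite /sum_outer big_cons -/(sum_outer s) -SE.
by rewrite addrC subrK.
Qed.

End positive_semidefinite.

Section gaussian_vectors.
Context (R : realType) (p : nat).
Local Notation gamma := (@normal_prob R 0 1).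
Implicit Types (s : seq 'cV[R]_p) (N : probability (borel 'cV[R]_p) R).

Lemma quad_sum_outer s u : quad (sum_outer s) u = \sum_(b <- s) dot u b ^+ 2.
Proof.
elim: s => [|b s IH]; rewrite /sum_outer ?big_nil ?big_cons.
  by rewrite /quad mulmx0 mul0mx mxE.
by rewrite quadDl quad_outer IH.
Qed.

(** The Gaussian property phrased through the standard normal law alone, so that forms of variance 0
    are not a separate case. *)
Definition gaussian_forms s N := forall u B, measurable B ->
  N [set x | B (dot u x)] =
  gamma [set y | B (Num.sqrt (\sum_(b <- s) dot u b ^+ 2) * y)].

(** Starting from the point mass at 0, each vector [b] adds an independent [z *: b] through a
    product measure. The form [u] then gains the variance [dot u b ^+ 2], by [normal_stable]. *)
Lemma gaussian_forms_exists s : exists N, gaussian_forms s N.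
Proof.
elim: s => [|b s [N NP]].
  exists (\d_(0 : borel 'cV[R]_p) : probability (borel 'cV[R]_p) R) => u B mB.
  rewrite big_nil sqrtr0 -(@normal_lawE R 0)// expr0n/= /normal_law eqxx.
  rewrite !diracE; congr (_%:E); congr (nat_of_bool _)%:R.
  by apply/idP/idP; rewrite !inE /= /dot big1// => j _; rewrite mxE mulr0.
pose m (zx : measurableTypeR R * borel 'cV[R]_p) : borel 'cV[R]_p := zx.2 + zx.1 *: b.
have mm : measurable_fun setT m.
  apply: measurable_cV => j; under eq_fun do rewrite !mxE.
  apply: measurable_funD; last exact: measurable_funM.
  exact: (measurableT_comp (@measurable_coord R p j) measurable_snd).
pose gN : probability (measurableTypeR R * borel 'cV[R]_p)%type R := (gamma \x N)%E.
exists (distribution gN (measurable_function mm)) => u B mB.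
have dotm z x : dot u (m (z, x)) = dot u x + dot u b * z.
  rewrite /m/= /dot mulr_suml -big_split/=; apply: eq_bigr => j _.
  by rewrite !mxE; ring.
rewrite big_cons addrC.
set q := \sum_(b <- s) _.
have q0 : 0 <= q by apply: sumr_ge0 => ? _; exact: sqr_ge0.
rewrite -[q in RHS]sqr_sqrtr// -normal_stable ?sqrtr_ge0//.
rewrite /distribution/= /pushforward/= /product_measure1/=.
apply: eq_integral => z _ /=.
rewrite (_ : xsection _ z = [set x : borel 'cV[R]_p | [set y | B (y + dot u b * z)] (dot u x)]).
  rewrite NP//.
  rewrite -[X in measurable X]setTI.
  have mh : measurable_fun setT (fun y : R => y + dot u b * z) by exact: measurable_funD.
  exact: mh.
apply/seteqP; split=> x; rewrite /xsection/= inE/= dotm//; exact.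
Qed.

Lemma gaussian_forms_normal s N : gaussian_forms s N ->
  is_multivariate_normal 0 (sum_outer s) N.
Proof.
move=> NP u B mB; rewrite mulmx0 mxE -/(quad _ u) quad_sum_outer.
under eq_set do rewrite dotE.
have q0 : 0 <= \sum_(b <- s) dot u b ^+ 2 by apply: sumr_ge0 => b _; exact: sqr_ge0.
rewrite (NP _ _ mB); set q := \sum_(b <- s) _ in q0 *.
by rewrite -(@normal_lawE R (Num.sqrt q) B mB) sqr_sqrtr.
Qed.

Section gaussian_integrals.
Context s N (NP : gaussian_forms s N).

Let gaussian_integral u (f : R -> R) : measurable_fun setT f ->
  gamma.-integrable setT (EFin \o (fun y => f (Num.sqrt (quad (sum_outer s) u) * y))) ->
  N.-integrable setT (EFin \o (fun x : borel 'cV[R]_p => f (dot u x))) /\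
  \int[N]_x f (dot u x) = \int[gamma]_y f (Num.sqrt (quad (sum_outer s) u) * y).
Proof.
move=> mf if_.
have mU := @measurable_dot R p u.
have mV : measurable_fun [set: measurableTypeR R]
  (fun y => Num.sqrt (quad (sum_outer s) u) * y) by exact: measurable_funM.
have UV B : measurable B -> N (dot u @^-1` B) =
    gamma ((fun y => Num.sqrt (quad (sum_outer s) u) * y) @^-1` B).
  by move=> mB; rewrite quad_sum_outer; exact: NP.
split; first exact: (equal_law_integrable mU mV UV mf if_).
exact: (equal_law_Rintegral mU mV UV mf if_).
Qed.

Lemma gaussian_forms_cos u b : \int[N]_x cos (dot u x + b) =
  \int[gamma]_y cos (Num.sqrt (quad (sum_outer s) u) * y + b).
Proof.
have mc : measurable_fun setT (fun y : R => cos (y + b)).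
  apply: measurableT_comp; last exact: measurable_funD.
  by apply: continuous_measurable_fun; exact: continuous_cos.
apply: (gaussian_integral (f := fun y => cos (y + b)) _ _).2 => //.
apply: (@Rintegrable_bounded _ _ _ _ _ 1) => [|y]; last first.
  by rewrite ler_norml cos_geN1 cos_le1.
apply: (measurableT_comp mc); exact: measurable_funM.
Qed.

Lemma gaussian_forms_square j :
  N.-integrable setT (EFin \o (fun x : borel 'cV[R]_p => (x : 'cV[R]_p) j 0 ^+ 2)) /\
  \int[N]_x ((x : 'cV[R]_p) j 0 ^+ 2) = sum_outer s j j.
Proof.
have dj (x : 'cV[R]_p) : x j 0 = dot (delta_mx j 0) x.
  rewrite /dot (bigD1 j)//= mxE !eqxx mul1r big1 ?addr0// => k kj.
  by rewrite mxE (negbTE kj) mul0r.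
under eq_Rintegral do rewrite dj.
under [fun x => (x : 'cV[R]_p) j 0 ^+ 2]eq_fun do rewrite dj.
have sE (y : R) : (Num.sqrt (quad (sum_outer s) (delta_mx j 0)) * y) ^+ 2 =
    sum_outer s j j * y ^+ 2.
  rewrite exprMn sqr_sqrtr ?quad_delta// -quad_delta quad_sum_outer.
  by apply: sumr_ge0 => b _; exact: sqr_ge0.
have [||i1 i2] := @gaussian_integral (delta_mx j 0) (fun y => y ^+ 2).
- exact: measurable_funX.
- under [fun y => (_ * y) ^+ 2]eq_fun do rewrite sE.
  exact: (Rintegrable_scale _ (gamma_square R).1).
split=> //; rewrite i2; under eq_Rintegral do rewrite sE.
by rewrite RintegralZl ?(gamma_square R).2 ?mulr1//; exact: (gamma_square R).1.
Qed.

End gaussian_integrals.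

End gaussian_vectors.

(** * The central limit theorem *)

Section trigonometric_bounds.
Context (R : realType).
Implicit Types x : R.

Let sin_mean_value x : 0 <= x -> exists2 c, 0 <= c <= x & sin x = cos c * x.
Proof.
move=> x0; have [|c] := @MVT_segment R sin cos 0 x x0.
  by apply: continuous_subspaceT => y; exact: continuous_sin.
by rewrite in_itv/= sin0 !subr0 => cx ->; exists c.
Qed.

Lemma sin_le x : `|sin x| <= `|x|.
Proof.
wlog x0 : x / 0 <= x => [H|].
  have [/H//|xn] := leP 0 x; rewrite -[leLHS]normrN -sinN -[leRHS]normrN.
  by apply: H; rewrite oppr_ge0 ltW.
have [c _ ->] := sin_mean_value x0.
by rewrite normrM ler_piMl// cos_max.
Qed.

Let half_angle x : 1 - cos x = 2 * sin (x / 2) ^+ 2.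
Proof.
have -> : cos x = cos ((x / 2) *+ 2) by congr cos; rewrite -mulr_natr divfK.
by rewrite cos_mulr2n cos2sin2; ring.
Qed.

Lemma one_sub_cos_le x : 0 <= 1 - cos x <= x ^+ 2 / 2.
Proof.
rewrite half_angle mulr_ge0 ?sqr_ge0//=.
have : sin (x / 2) ^+ 2 <= (x / 2) ^+ 2.
  by rewrite -[leLHS]real_normK ?num_real// -[leRHS]real_normK ?num_real// lerXn2r ?nnegrE// sin_le.
by lra.
Qed.

(** By the mean value theorem [sin x - x = (cos c - 1) x] with [0 <= c <= x], and
    [1 - cos c <= c^2 / 2]. *)
Lemma sin_sub_le x : `|sin x - x| <= `|x| ^+ 3.
Proof.
wlog x0 : x / 0 <= x => [H|].
  have [/H//|xn] := leP 0 x.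
  have := H (- x); rewrite normrN sinN oppr_ge0 (ltW xn) => /(_ isT).
  by rewrite -opprB opprK normrN addrC.
have [c /andP[c0 cx] ->] := sin_mean_value x0.
have -> : cos c * x - x = (cos c - 1) * x by ring.
rewrite normrM (ger0_norm x0) exprSr.
rewrite ler_wpM2r// distrC; have /andP[c1 c2] := one_sub_cos_le c.
rewrite ger0_norm// (le_trans c2)// (@le_trans _ _ (c ^+ 2))//.
  by have := sqr_ge0 c; lra.
by rewrite lerXn2r ?nnegrE.
Qed.

(** The half-angle formula turns the left side into twice the difference of the squares of [x / 2]
    and [sin (x / 2)]; its factors are bounded by the two estimates on the sine. The bound is
    written as a cube times [|x|] to fit [rescaled_cvg0]. *)
Lemma cos_expansion_le x : `|cos x - (1 - x ^+ 2 / 2)| <= `|x| ^+ 3 * `|x|.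
Proof.
have -> : cos x - (1 - x ^+ 2 / 2) = 2 * ((x / 2 - sin (x / 2)) * (x / 2 + sin (x / 2))).
  by have := half_angle x; set s := sin _; lra.
rewrite normrM ger0_norm//.
have h : `|x / 2| = `|x| / 2 by rewrite normrM (@ger0_norm _ 2^-1) ?invr_ge0.
have b1 := sin_sub_le (x / 2); rewrite distrC h in b1.
have b2 : `|x / 2 + sin (x / 2)| <= `|x|.
  by rewrite (le_trans (ler_normD _ _))//; have := sin_le (x / 2); rewrite h; lra.
rewrite normrM.
apply: (@le_trans _ _ (2 * ((`|x| / 2) ^+ 3 * `|x|))).
  by rewrite ler_wpM2l// ler_pM.
rewrite mulrA ler_wpM2r// exprMn.
by have := exprn_ge0 3 (normr_ge0 x); move: (`|x| ^+ 3) => t t0; lra.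
Qed.

End trigonometric_bounds.

Section cosine_recursion.
Context (R : realType).

(* The recursion satisfied by [F k b = E cos (A_1 + ... + A_k + b)] when the
   [A_i] are i.i.d. with [c = E cos A_i] and [s = E sin A_i]. *)
Lemma cosine_recursion (F : nat -> R -> R) (c s r d : R) : 0 <= d ->
  (forall b, F 0 b = cos b) -> (forall k b, `|F k b| <= 1) ->
  (forall k b, F k.+1 b = c * F k b + s * F k (b + pi / 2)) ->
  `|r| <= 1 -> `|c - r| <= d -> `|s| <= d ->
  forall k b, `|F k b - r ^+ k * cos b| <= k%:R * (2 * d).
Proof.
move=> d0 F0 F1 FS r1 cr s1; elim=> [|k IH] b.
  by rewrite F0 expr0 mul1r subrr normr0 mul0r.
have -> : F k.+1 b - r ^+ k.+1 * cos b =
    r * (F k b - r ^+ k * cos b) + ((c - r) * F k b + s * F k (b + pi / 2)).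
  by rewrite FS exprS; ring.
have -> : k.+1%:R * (2 * d) = k%:R * (2 * d) + (d + d).
  by rewrite -natr1; ring.
rewrite (le_trans (ler_normD _ _))// lerD//.
  by rewrite normrM (le_trans _ (IH b))// ler_piMl.
rewrite (le_trans (ler_normD _ _))// !normrM lerD//.
  by rewrite -[leRHS]mulr1 ler_pM.
by rewrite -[leRHS]mulr1 ler_pM.
Qed.

End cosine_recursion.

Section cosine_of_independent_sum.
Context d (Omega : measurableType d) (R : realType) (P : probability Omega R).

Let measurable_cos_shift (b : R) : measurable_fun setT (fun x : R => cos (x + b)).
Proof.
apply: measurableT_comp; last exact: measurable_funD.
by apply: continuous_measurable_fun; exact: continuous_cos.
Qed.

Let measurable_sin : measurable_fun setT (@sin R).
Proof. by apply: continuous_measurable_fun; exact: continuous_sin. Qed.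

Lemma cos_le_integrable (A : Omega -> R) b : measurable_fun setT A ->
  P.-integrable setT (EFin \o (fun w => cos (A w + b))).
Proof.
move=> mA; apply: (@Rintegrable_bounded _ _ _ _ _ 1) => [|w]; last exact: cos_max.
exact: (measurableT_comp (measurable_cos_shift b) mA).
Qed.

Lemma Rintegral_cos_le1 (A : Omega -> R) b : measurable_fun setT A ->
  `|\int[P]_w cos (A w + b)| <= 1.
Proof.
move=> mA; apply: le_trans (le_normr_Rintegral _ _) _ => //.
  exact: cos_le_integrable.
rewrite -[leRHS](Rintegral_probability_cst P 1).
apply: le_Rintegral => //.
- exact/integrable_norm/cos_le_integrable.
- exact: Rintegrable_cst.
- by move=> w _; exact: cos_max.
Qed.

(** The addition formula, with [- sin (A + b)] rewritten as a cosine of phase [b + pi / 2]. This is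
    the step of the linear recursion. *)
Lemma cos_sum_independent (A B : Omega -> R) b :
  measurable_fun setT A -> measurable_fun setT B -> independent_pair P A B ->
  \int[P]_w cos (A w + B w + b) =
  (\int[P]_w cos (B w)) * (\int[P]_w cos (A w + b)) +
  (\int[P]_w sin (B w)) * (\int[P]_w cos (A w + (b + pi / 2))).
Proof.
move=> mA mB AB.
have iB : P.-integrable setT (EFin \o (fun w => cos (B w))).
  by have := cos_le_integrable 0 mB; under eq_fun do rewrite addr0.
have isB : P.-integrable setT (EFin \o (fun w => sin (B w))).
  apply: (@Rintegrable_bounded _ _ _ _ _ 1) => [|w]; last exact: sin_max.
  exact: measurableT_comp.
have E w : cos (A w + B w + b) =
    cos (A w + b) * cos (B w) + cos (A w + (b + pi / 2)) * sin (B w).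
  have -> : A w + B w + b = (A w + b) + B w by rewrite addrAC.
  have -> : A w + (b + pi / 2) = (A w + b) + pi / 2 by rewrite addrA.
  by rewrite cosDpihalf (cosD (A w + b)) mulNr.
under eq_Rintegral do rewrite E.
have mc : measurable_fun setT (@cos R).
  by apply: continuous_measurable_fun; exact: continuous_cos.
have AB1 := independent_pair_comp (measurable_cos_shift b) mc AB.
have AB2 := independent_pair_comp (measurable_cos_shift (b + pi / 2)) measurable_sin AB.
have iA := cos_le_integrable b mA; have iA' := cos_le_integrable (b + pi / 2) mA.
rewrite RintegralD//.
- by rewrite (Rintegral_mul_independent iA iB AB1) (Rintegral_mul_independent iA' isB AB2); ring.
- exact: (integrable_mul_independent iA iB AB1).
- exact: (integrable_mul_independent iA' isB AB2).
Qed.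

End cosine_of_independent_sum.

Section characteristic_asymptotics.
Context d (Omega : measurableType d) (R : realType) (P : probability Omega R).
Context (Y : Omega -> R) (sqY : square_integrable P Y) (Y0 : \int[P]_w Y w = 0).

Let v := \int[P]_w Y w ^+ 2.
(** Shifted by one, so that the scale is never the inverse of 0. *)
Let t (n : nat) : R := (Num.sqrt n.+1%:R)^-1.

Let t_gt0 n : 0 < t n.
Proof. by rewrite invr_gt0 sqrtr_gt0. Qed.

Let t_sqr n : t n ^+ 2 = n.+1%:R^-1.
Proof. by rewrite exprVn sqr_sqrtr. Qed.

Let t_cvg0 : t n @[n --> \oo] --> 0.
Proof.
apply: sqr_cvg0; under eq_cvg do rewrite t_sqr; exact: cvg_harmonic.
Qed.

Let mY : measurable_fun setT Y := sqY.1.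
Let iY : P.-integrable setT (EFin \o Y) := square_integrable_int sqY.
Let iY2 : P.-integrable setT (EFin \o (fun w => Y w ^+ 2)) := sqY.2.

Let mcos : measurable_fun setT (@cos R).
Proof. by apply: continuous_measurable_fun; exact: continuous_cos. Qed.

Let msin : measurable_fun setT (@sin R).
Proof. by apply: continuous_measurable_fun; exact: continuous_sin. Qed.

(** Dominated convergence: the quadratic bound gives the dominating function [3 * Y ^+ 2], and the
    cubic bound the pointwise limit 0. No moment beyond the second enters, in keeping with the
    noise. *)
Let rescaled_cvg0 (h : R -> R) : measurable_fun setT h ->
  (forall x, `|h x| <= 3 * x ^+ 2) -> (forall x, `|h x| <= `|x| ^+ 3 * (1 + `|x|)) ->
  n.+1%:R * (\int[P]_w h (t n * Y w)) @[n --> \oo] --> 0.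
Proof.
move=> mh h2 h3.
pose f_ n w := (n.+1%:R * h (t n * Y w))%:E.
have mf n : measurable_fun setT (f_ n).
  apply/measurable_EFinP; apply: measurable_funM => //.
  by apply: (measurableT_comp mh); exact: measurable_funM.
have nt n : n.+1%:R * t n ^+ 2 = 1 :> R by rewrite t_sqr divff.
have bnd n w : `|n.+1%:R * h (t n * Y w)| <= 3 * Y w ^+ 2.
  rewrite normrM ger0_norm//.
  apply: le_trans (ler_wpM2l _ (h2 _)) _ => //.
  by rewrite exprMn mulrCA [_ * (t n ^+ 2 * _)]mulrA nt mul1r.
have ih n : P.-integrable setT (EFin \o (fun w => h (t n * Y w))).
  apply: Rintegrable_le (Rintegrable_scale (3 * t n ^+ 2) iY2) _.
    by apply: (measurableT_comp mh); exact: measurable_funM.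
  by move=> w; rewrite -mulrA -exprMn.
have cvg0 w : n.+1%:R * h (t n * Y w) @[n --> \oo] --> 0.
  have : t n * (`|Y w| ^+ 3 * (1 + t n * `|Y w|)) @[n --> \oo] --> 0.
    rewrite [X in _ --> X](_ : _ = 0 * (`|Y w| ^+ 3 * (1 + 0 * `|Y w|))); last by rewrite mul0r.
    apply: cvgM => //; apply: cvgM; first exact: cvg_cst.
    by apply: cvgD; [exact: cvg_cst|apply: cvgM => //; exact: cvg_cst].
  move=> c0;
  have c0N : - (t n * (`|Y w| ^+ 3 * (1 + t n * `|Y w|))) @[n --> \oo] --> (0 : R).
    by rewrite -oppr0; exact: cvgN.
  apply: (squeeze_cvgr _ c0N c0); apply: nearW => n.
  rewrite /= -ler_norml normrM ger0_norm//.
  apply: le_trans (ler_wpM2l _ (h3 _)) _ => //.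
  rewrite normrM (gtr0_norm (t_gt0 n)) exprMn.
  suff -> : n.+1%:R * (t n ^+ 3 * `|Y w| ^+ 3 * (1 + t n * `|Y w|)) =
    (n.+1%:R * t n ^+ 2) * (t n * (`|Y w| ^+ 3 * (1 + t n * `|Y w|))) by rewrite nt mul1r.
  by ring.
have -> : (fun n => n.+1%:R * (\int[P]_w h (t n * Y w))) =
    (fun n => fine (\int[P]_w f_ n w)%E).
  apply/funext => n; rewrite -RintegralZl//.
have := @dominated_cvg _ _ _ P setT measurableT f_ (cst 0%E) (fun w => (3 * Y w ^+ 2)%:E) mf.
rewrite integral0 => H.
have {}H : (\int[P]_w f_ n w @[n --> \oo] --> 0)%E.
  apply: H.
  - by move=> w _; apply: cvg_EFin (cvg0 w); exact: nearW.
  - by [].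
  - exact: Rintegrable_scale.
  - by move=> n w _; rewrite lee_fin.
by move/fine_cvg: H.
Qed.

Let mtY n : measurable_fun setT (fun w => t n * Y w).
Proof. exact: measurable_funM. Qed.

Let icos n : P.-integrable setT (EFin \o (fun w => cos (t n * Y w))).
Proof.
by have := cos_le_integrable P 0 (mtY n); under [fun w => cos _]eq_fun do rewrite addr0.
Qed.

Let isin n : P.-integrable setT (EFin \o (fun w => sin (t n * Y w))).
Proof.
apply: (@Rintegrable_bounded _ _ _ _ _ 1) => [|w]; last exact: sin_max.
exact: measurableT_comp.
Qed.

Let c n := \int[P]_w cos (t n * Y w).
Let s n := \int[P]_w sin (t n * Y w).
Let r n := 1 - v / 2 * n.+1%:R^-1.

Let c_cvg : n.+1%:R * (c n - r n) @[n --> \oo] --> 0.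
Proof.
have := @rescaled_cvg0 (fun x => cos x - (1 - x ^+ 2 / 2)).
have E n : \int[P]_w (cos (t n * Y w) - (1 - (t n * Y w) ^+ 2 / 2)) = c n - r n.
  have isq : P.-integrable setT (EFin \o (fun w => (t n * Y w) ^+ 2 / 2)).
    under [fun w => _ / 2]eq_fun do rewrite exprMn mulrAC.
    exact: Rintegrable_scale.
  have i1 := Rintegrable_sub (Rintegrable_cst P 1) isq.
  rewrite RintegralB// RintegralB//; last exact: Rintegrable_cst.
  rewrite Rintegral_probability_cst.
  under [X in 1 - X]eq_Rintegral do rewrite exprMn mulrAC.
  rewrite RintegralZl// t_sqr /r -/(c n) -/v.
  by move: (n.+1%:R^-1) => x; ring.
under eq_cvg do rewrite E; apply.
- apply: measurable_funB => //; apply: measurable_funB => //.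
  by apply: measurable_funM => //; exact: measurable_funX.
- move=> x; have /andP[c0 c1] := one_sub_cos_le x; have x2 := sqr_ge0 x.
  by rewrite ler_norml; apply/andP; split; lra.
- move=> x; apply: le_trans (cos_expansion_le x) _.
  by rewrite ler_wpM2l ?exprn_ge0// lerDr.
Qed.

(** Because [Y] is centered, its linear term can be subtracted from the sine inside the
    expectation. *)
Let s_cvg : n.+1%:R * s n @[n --> \oo] --> 0.
Proof.
have := @rescaled_cvg0 (fun x => sin x - x).
have E n : \int[P]_w (sin (t n * Y w) - t n * Y w) = s n.
  rewrite RintegralB//; last exact: Rintegrable_scale.
  by rewrite RintegralZl// Y0 mulr0 subr0.
under eq_cvg do rewrite E; apply.
- exact: measurable_funB.
- move=> x; have x2 := real_normK (num_real x).
  have [x1|x1] := leP `|x| 1.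
    apply: le_trans (sin_sub_le x) _; rewrite exprS x2.
    by rewrite (@le_trans _ _ (1 * x ^+ 2)) ?ler_wpM2r ?sqr_ge0//; have := sqr_ge0 x; lra.
  rewrite (le_trans (ler_normB _ _))//; have := sin_max x.
  by rewrite -x2; nra.
- move=> x; apply: le_trans (sin_sub_le x) _.
  by rewrite ler_peMr ?exprn_ge0// lerDl.
Qed.

(* [F n k b] plays the role of [E cos (t n (Y_1 + ... + Y_k) + b)]. *)
Lemma cosine_limit (F : nat -> nat -> R -> R) b :
  (forall n b, F n 0 b = cos b) -> (forall n k b, `|F n k b| <= 1) ->
  (forall n k b, F n k.+1 b = c n * F n k b + s n * F n k (b + pi / 2)) ->
  F n n.+1 b - r n ^+ n.+1 * cos b @[n --> \oo] --> 0.
Proof.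
move=> F0 F1 FS.
(* This is [n + 1] steps times the error [2 * d] per step, with [d = |c n - r n| + |s n|]. *)
pose e n := 2 * (`|n.+1%:R * (c n - r n)| + `|n.+1%:R * s n|).
have e0 : e n @[n --> \oo] --> 0.
  have -> : 0 = 2 * (`|0 : R| + `|0 : R|) :> R by rewrite normr0 addr0 mulr0.
  apply: cvgM; first exact: cvg_cst.
  by apply: cvgD; apply: cvg_norm.
have e0N : - e n @[n --> \oo] --> (0 : R) by rewrite -oppr0; exact: cvgN.
apply: (squeeze_cvgr _ e0N e0).
have v0 : 0 <= v by apply: Rintegral_ge0 => w _; exact: sqr_ge0.
near=> n; rewrite -ler_norml.
have r1 : `|r n| <= 1.
  have : v / 2 * n.+1%:R^-1 <= 1.
    rewrite ler_pdivrMr// mul1r (@le_trans _ _ n%:R) ?ler_nat//.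
    by near: n; exact: nbhs_infty_ger.
  have : 0 <= v / 2 * n.+1%:R^-1 by rewrite mulr_ge0// divr_ge0.
  by rewrite /r ler_norml; move: (v / 2 * _) => x x0 x1; apply/andP; split; lra.
have d0 : 0 <= `|c n - r n| + `|s n| by rewrite addr_ge0.
have cd : `|c n - r n| <= `|c n - r n| + `|s n| by rewrite lerDl.
have sd : `|s n| <= `|c n - r n| + `|s n| by rewrite lerDr.
have := cosine_recursion d0 (F0 n) (F1 n) (FS n) r1 cd sd n.+1 b.
suff -> : n.+1%:R * (2 * (`|c n - r n| + `|s n|)) = e n by [].
by rewrite /e !(normrM n.+1%:R) (ger0_norm (ler0n _ n.+1)) -mulrDr mulrCA.
Unshelve. all: by end_near. Qed.

End characteristic_asymptotics.

Section gaussian_cosine.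
Context (R : realType).
Local Notation gamma := (@normal_prob R 0 1).

Let gamma2 : probability (measurableTypeR R * measurableTypeR R)%type R :=
  (gamma \x gamma)%E.

Let gammaT : gamma [set: measurableTypeR R] = 1%E.
Proof. exact: probability_setT. Qed.

Let rectangle S T : measurable S -> measurable T ->
  gamma2 (S `*` T) = (gamma S * gamma T)%E.
Proof. by move=> mS mT; rewrite /gamma2/= product_measure1E. Qed.

Let preimage_fst (S : set R) :
  (fun z : measurableTypeR R * measurableTypeR R => z.1 : R) @^-1` S = S `*` setT.
Proof. by apply/seteqP; split=> z //= []. Qed.

Let preimage_snd (S : set R) :
  (fun z : measurableTypeR R * measurableTypeR R => z.2 : R) @^-1` S = setT `*` S.
Proof. by apply/seteqP; split=> z //= []. Qed.

Let independent_coordinates :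
  independent_pair gamma2 (fun z => z.2 : R) (fun z => z.1 : R).
Proof.
move=> S T mS mT.
rewrite preimage_fst preimage_snd -setXI setTI setIT !rectangle// gammaT.
by rewrite mul1e mule1 muleC.
Qed.

Let marginal (h : R -> R) : measurable_fun setT h -> (forall x, `|h x| <= 1) ->
  \int[gamma2]_z h z.1 = \int[gamma]_y h y /\ \int[gamma2]_z h z.2 = \int[gamma]_y h y.
Proof.
move=> mh h1.
have ih : gamma.-integrable setT (EFin \o (h \o (id : measurableTypeR R -> R))).
  exact: (@Rintegrable_bounded _ _ _ _ _ 1).
have m1 : measurable_fun setT (fun z : measurableTypeR R * measurableTypeR R => z.1 : R).
  exact: measurable_fst.
have m2 : measurable_fun setT (fun z : measurableTypeR R * measurableTypeR R => z.2 : R).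
  exact: measurable_snd.
have mI : measurable_fun [set: measurableTypeR R] (id : measurableTypeR R -> R) by [].
split.
- apply: (equal_law_Rintegral m1 mI _ mh ih) => S mS.
  by rewrite preimage_fst rectangle// gammaT mule1.
- apply: (equal_law_Rintegral m2 mI _ mh ih) => S mS.
  by rewrite preimage_snd rectangle// gammaT mul1e.
Qed.

(** The left expectation does not depend on [n]: the normal law is its own normalized sum, so
    [cosine_limit] applies to it and gives the same comparison sequence as for a sample of variance
    [sigma ^+ 2]. *)
Lemma gaussian_cosine_limit (sigma b : R) :
  \int[gamma]_y cos (sigma * y + b) -
    (1 - sigma ^+ 2 / 2 * n.+1%:R^-1) ^+ n.+1 * cos b @[n --> \oo] --> 0.
Proof.
have sqY : square_integrable gamma (fun y => sigma * y).
  by apply: square_integrable_scale; split=> //; exact: (gamma_square R).1.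
have Y0 : \int[gamma]_y (sigma * y) = 0.
  rewrite RintegralZl// ?gamma_mean ?mulr0//.
  by apply: square_integrable_int; split=> //; exact: (gamma_square R).1.
have Y2 : \int[gamma]_y (sigma * y) ^+ 2 = sigma ^+ 2.
  under eq_Rintegral do rewrite exprMn.
  by rewrite RintegralZl ?(gamma_square R).2 ?mulr1//; exact: (gamma_square R).1.
pose t (n : nat) : R := (Num.sqrt n.+1%:R)^-1.
(* A sum of [k] independent standard normal variables is represented by [Num.sqrt k%:R] times one of
   them; at [k = n + 1] the scale [t n] cancels the root. The recursion in [k] is [normal_stable]
   with coefficient 1 for the new summand. *)
pose F n k b := \int[gamma]_y cos (t n * sigma * Num.sqrt k%:R * y + b).
have := cosine_limit sqY Y0 (F := F) b.
have Fn n : F n n.+1 b = \int[gamma]_y cos (sigma * y + b).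
  rewrite /F /t; apply: eq_Rintegral => y _; congr (cos (_ * _ + _)).
  by rewrite mulrAC mulVf ?mul1r// sqrtr_eq0 -ltNge.
rewrite Y2; under eq_cvg do rewrite Fn; apply.
- move=> n b'; rewrite /F sqrtr0 mulr0.
  under eq_Rintegral do rewrite mul0r add0r.
  exact: Rintegral_probability_cst.
- move=> n k b'; apply: Rintegral_cos_le1; exact: measurable_funM.
move=> n k b'.
pose A (z : measurableTypeR R * measurableTypeR R) : R := t n * sigma * Num.sqrt k%:R * z.2.
pose B (z : measurableTypeR R * measurableTypeR R) : R := t n * sigma * z.1.
have mA : measurable_fun setT A by apply: measurable_funM => //; exact: measurable_snd.
have mB : measurable_fun setT B by apply: measurable_funM => //; exact: measurable_fst.
have AB : independent_pair gamma2 A B.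
  apply: (independent_pair_comp (f := fun y => t n * sigma * Num.sqrt k%:R * y)
    (g := fun y => t n * sigma * y) _ _ independent_coordinates);
    exact: measurable_funM.
have step : F n k.+1 b' = \int[gamma2]_z cos (A z + B z + b').
  have mU : measurable_fun setT (fun z : measurableTypeR R * measurableTypeR R =>
      Num.sqrt k%:R * z.2 + z.1 : R).
    by apply: measurable_funD; [apply: measurable_funM => //; exact: measurable_snd|exact: measurable_fst].
  have mV : measurable_fun [set: measurableTypeR R] (fun y => Num.sqrt k.+1%:R * y : R).
    exact: measurable_funM.
  have UV S : measurable S ->
      gamma2 ((fun z => Num.sqrt k%:R * z.2 + z.1 : R) @^-1` S) =
      gamma ((fun y => Num.sqrt k.+1%:R * y : R) @^-1` S).
    move=> mS; have := @normal_stable R (Num.sqrt k%:R) 1 S (sqrtr_ge0 _) mS.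
    rewrite sqr_sqrtr// expr1n natr1 => <-.
    rewrite /gamma2/= /product_measure1/=; apply: eq_integral => z _ /=.
    congr (gamma _); apply/seteqP; split=> y; rewrite /xsection/= inE/= mul1r//.
  have mf : measurable_fun setT (fun x : R => cos (t n * sigma * x + b')).
    apply: measurableT_comp; first by apply: continuous_measurable_fun; exact: continuous_cos.
    by apply: measurable_funD => //; exact: measurable_funM.
  have if_ : gamma.-integrable setT (EFin \o ((fun x : R => cos (t n * sigma * x + b')) \o
      (fun y => Num.sqrt k.+1%:R * y : R))).
    apply: (@Rintegrable_bounded _ _ _ _ _ 1) => [|y]; last exact: cos_max.
    exact: (measurableT_comp mf mV).
  have := equal_law_Rintegral mU mV UV mf if_.
  rewrite /F; under [in X in _ = X -> _]eq_Rintegral do rewrite mulrA.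
  move=> <-; apply: eq_Rintegral => z _; congr (cos (_ + _)).
  by rewrite /A /B; ring.
rewrite step (cos_sum_independent _ mA mB AB).
have mcos c x : measurable_fun setT (fun y : R => cos (c * y + x)).
  apply: measurableT_comp; first by apply: continuous_measurable_fun; exact: continuous_cos.
  by apply: measurable_funD => //; exact: measurable_funM.
have [_ EA] := marginal (mcos (t n * sigma * Num.sqrt k%:R) b') (fun x => cos_max _).
have [_ EA'] := marginal (mcos (t n * sigma * Num.sqrt k%:R) (b' + pi / 2)) (fun x => cos_max _).
have msin : measurable_fun setT (fun y : R => sin (t n * sigma * y)).
  apply: measurableT_comp; first by apply: continuous_measurable_fun; exact: continuous_sin.
  exact: measurable_funM.
have [EBs _] := marginal msin (fun x => sin_max _).
have mc0 : measurable_fun setT (fun y : R => cos (t n * sigma * y)).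
  by have := mcos (t n * sigma) 0; under eq_fun do rewrite addr0.
have [EBc _] := marginal mc0 (fun x => cos_max _).
rewrite /A /B EA EA' EBs EBc -/(F n k b') -/(F n k (b' + pi / 2)).
by congr (_ * _ + _ * _); apply: eq_Rintegral => y _; rewrite mulrA.
Qed.

End gaussian_cosine.

Section central_limit.
Context d (Omega : measurableType d) (R : realType) (P : probability Omega R).
Context (W : nat -> {RV P >-> R}).
Hypotheses (Wind : mutually_independent W)
  (Wlaw : forall i, same_distribution P (W i) (W 0))
  (W2 : P.-integrable setT (EFin \o (fun w => W 0 w ^+ 2)))
  (W0 : \int[P]_w W 0 w = 0).

Theorem cos_central_limit b :
  \int[P]_w cos ((Num.sqrt n.+1%:R)^-1 * partial_sum W n.+1 w + b) @[n --> \oo] -->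
  \int[@normal_prob R 0 1]_y cos (Num.sqrt (\int[P]_w W 0 w ^+ 2) * y + b).
Proof.
set v := \int[P]_w W 0 w ^+ 2.
have v0 : 0 <= v by apply: Rintegral_ge0 => w _; exact: sqr_ge0.
have sqW0 : square_integrable P (W 0) by [].
pose t (n : nat) : R := (Num.sqrt n.+1%:R)^-1.
pose F n k b := \int[P]_w cos (t n * partial_sum W k w + b).
have mS k : measurable_fun setT (partial_sum W k) := (square_integrable_partial_sum Wind Wlaw W2 k).1.
have lim1 : F n n.+1 b - (1 - v / 2 * n.+1%:R^-1) ^+ n.+1 * cos b @[n --> \oo] --> 0.
  apply: (cosine_limit sqW0 W0).
  - move=> n b'; rewrite /F /partial_sum.
    under eq_Rintegral do rewrite big_geq// mulr0 add0r.
    exact: Rintegral_probability_cst.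
  - move=> n k b'; apply: Rintegral_cos_le1; exact: measurable_funM.
  move=> n k b'.
  have mtS : measurable_fun setT (fun w => t n * partial_sum W k w) by exact: measurable_funM.
  have mtW : measurable_fun setT (fun w => t n * W k w) by exact: measurable_funM.
  have ind : independent_pair P (fun w => t n * partial_sum W k w) (fun w => t n * W k w).
    apply: (independent_pair_comp (f := fun x => t n * x) (g := fun x => t n * x));
      [exact: measurable_funM|exact: measurable_funM|].
    exact: (independent_past Wind (@past_partial_sum _ _ _ _ W k)).
  have mcos : measurable_fun setT (fun x : R => cos (t n * x)).
    apply: measurableT_comp; last exact: measurable_funM.
    by apply: continuous_measurable_fun; exact: continuous_cos.
  have msin : measurable_fun setT (fun x : R => sin (t n * x)).
    apply: measurableT_comp; last exact: measurable_funM.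
    by apply: continuous_measurable_fun; exact: continuous_sin.
  have ic : P.-integrable setT (EFin \o ((fun x => cos (t n * x)) \o W 0)).
    apply: (@Rintegrable_bounded _ _ _ _ _ 1) => [|w]; last exact: cos_max.
    exact: measurableT_comp.
  have is_ : P.-integrable setT (EFin \o ((fun x => sin (t n * x)) \o W 0)).
    apply: (@Rintegrable_bounded _ _ _ _ _ 1) => [|w]; last exact: sin_max.
    exact: measurableT_comp.
  have [_ Ec] := iid_Rintegral Wlaw k mcos ic.
  have [_ Es] := iid_Rintegral Wlaw k msin is_.
  rewrite -/(t n) -Ec -Es /F -cos_sum_independent//.
  apply: eq_Rintegral => w _; rewrite /partial_sum big_nat_recr//=.
  by rewrite mulrDr.
have := @gaussian_cosine_limit R (Num.sqrt v) b; rewrite sqr_sqrtr// => lim2.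
set G := \int[_]_y _ in lim2 *.
pose q n := (1 - v / 2 * n.+1%:R^-1) ^+ n.+1 * cos b.
have : (F n n.+1 b - q n) - (G - q n) + G @[n --> \oo] --> 0 - 0 + G.
  by apply: cvgD; [exact: cvgB|exact: cvg_cst].
rewrite subrr add0r; under eq_cvg do rewrite opprB addrA subrK subrK.
exact.
Qed.

End central_limit.

(** * Means of i.i.d. random vectors *)

Section iid_vectors.
Context d (Omega : measurableType d) (R : realType) (P : probability Omega R).
Context (p : nat) (xi : nat -> Omega -> 'cV[R]_p) (Gamma : 'M[R]_p).
Context (form : 'cV[R]_p -> nat -> {RV P >-> R}).
Hypotheses (formE : forall u i w, form u i w = dot u (xi i w))
  (form_indep : forall u, mutually_independent (form u))
  (form_law : forall u i, same_distribution P (form u i) (form u 0))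
  (form_sqr : forall u, P.-integrable setT (EFin \o (fun w => form u 0 w ^+ 2)))
  (form_mean : forall u, \int[P]_w form u 0 w = 0)
  (Gamma_sym : Gamma^T = Gamma)
  (form_var : forall u, \int[P]_w form u 0 w ^+ 2 = quad Gamma u).

Definition sample_mean n w : 'cV[R]_p := n%:R^-1 *: \sum_(i < n) xi i w.
Local Notation mean := sample_mean.
Local Notation e j := (delta_mx j 0 : 'cV[R]_p).

Let dot_mean u n w : dot u (mean n w) = partial_sum (form u) n w / n%:R.
Proof.
rewrite /partial_sum big_mkord mulrC /mean /dot.
under [in RHS]eq_bigr do rewrite formE /dot.
rewrite exchange_big mulr_sumr; apply: eq_bigr => j _.
by rewrite mxE summxE mulrCA mulr_sumr.
Qed.

Let coordE (x : 'cV[R]_p) j : x j 0 = dot (e j) x.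
Proof.
rewrite /dot (bigD1 j)//= mxE !eqxx mul1r big1 ?addr0// => k kj.
by rewrite mxE (negbTE kj) mul0r.
Qed.

Lemma sample_mean_strong_law :
  {ae P, forall w, forall j : 'I_p, mean n w j 0 @[n --> \oo] --> 0}.
Proof.
apply: filter_forall => j.
have := strong_law_of_large_numbers (form_indep (e j)) (form_law (e j))
  (form_sqr (e j)) (form_mean (e j)).
by apply: filterS => w; under [X in _ -> X]eq_cvg do rewrite coordE dot_mean.
Qed.

Let Gamma_polar j k :
  Gamma j k = (quad Gamma (e j + e k) - quad Gamma (e j - e k)) / 4.
Proof.
have E t : quad Gamma (e j - t *: e k) = Gamma j j - 2 * t * Gamma j k + t ^+ 2 * Gamma k k.
  rewrite quad_shift// quad_delta -colE mxE.
  by have -> : Gamma k j = Gamma j k by rewrite -[in LHS]Gamma_sym mxE.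
have := E (-1); have := E 1; rewrite scale1r scaleN1r opprK => -> ->.
by field.
Qed.

Lemma sample_mean_quadratic_strong_law : {ae P, forall w,
  (ln n%:R)^-1 *: \sum_(1 <= i < n.+1) (mean i w *m (mean i w)^T) @[n --> \oo] -->
  Gamma}.
Proof.
have qsl u := quadratic_strong_law (form_indep u) (form_law u) (form_sqr u) (form_mean u).
have : {ae P, forall w, forall jk : 'I_p * 'I_p,
  ((\sum_(0 <= i < n.+1) (partial_sum (form (e jk.1 + e jk.2)) i w / i%:R) ^+ 2) / ln n%:R
    @[n --> \oo] --> quad Gamma (e jk.1 + e jk.2)) /\
  ((\sum_(0 <= i < n.+1) (partial_sum (form (e jk.1 - e jk.2)) i w / i%:R) ^+ 2) / ln n%:R
    @[n --> \oo] --> quad Gamma (e jk.1 - e jk.2))}.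
  apply: filter_forall => -[j k] /=.
  have := ae_and (qsl (e j + e k)) (qsl (e j - e k)).
  by rewrite !form_var.
apply: filterS => w H; apply: cvg_mx => j k.
have [H1 H2] := H (j, k); rewrite Gamma_polar.
suff E n : ((ln n%:R)^-1 *: \sum_(1 <= i < n.+1) (mean i w *m (mean i w)^T)) j k =
    ((\sum_(0 <= i < n.+1) (partial_sum (form (e j + e k)) i w / i%:R) ^+ 2) / ln n%:R -
     (\sum_(0 <= i < n.+1) (partial_sum (form (e j - e k)) i w / i%:R) ^+ 2) / ln n%:R) / 4.
  under eq_cvg do rewrite E.
  by apply: cvgM; [exact: cvgB|exact: cvg_cst].
rewrite -mulrBl -sumrB mulrAC mulr_suml.
have S0 u : partial_sum (form u) 0 w = 0 by rewrite /partial_sum big_geq.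
(* The term of index 0 is 0, so the sums from 0 and from 1 agree. *)
rewrite [in RHS]big_nat_recl// !S0 !mul0r subrr mul0r add0r.
rewrite mxE summxE big_add1/= [RHS]mulrC; congr (_ * _).
apply: eq_bigr => i _; rewrite -!dot_mean; move: (mean _ _) => x.
rewrite mxE big_ord1 mxE (coordE x j) (coordE x k) !dotDl dotNl.
by field.
Qed.

Lemma sample_mean_central_limit :
  exists2 N : probability (borel 'cV[R]_p) R, is_multivariate_normal 0 Gamma N &
    cvg_in_distribution P (fun n w => Num.sqrt n%:R *: mean n w) N.
Proof.
have [|s Gs] := sum_outer_decomposition Gamma_sym.
  by move=> u; rewrite -form_var; apply: Rintegral_ge0 => w _; exact: sqr_ge0.
have [N NP] := gaussian_forms_exists s.
exists N; first by rewrite Gs; exact: gaussian_forms_normal.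
have G0 j : 0 <= Gamma j j.
  by rewrite -quad_delta -form_var; apply: Rintegral_ge0 => w _; exact: sqr_ge0.
have dotZ u n w : dot u (Num.sqrt n%:R *: mean n w) =
    Num.sqrt n%:R * (partial_sum (form u) n w / n%:R).
  by rewrite -dot_mean /dot mulr_sumr; apply: eq_bigr => j _; rewrite mxE mulrCA.
have dotZS u n w : dot u (Num.sqrt n.+1%:R *: mean n.+1 w) =
    (Num.sqrt n.+1%:R)^-1 * partial_sum (form u) n.+1 w.
  rewrite dotZ; have {2}-> : n.+1%:R = Num.sqrt n.+1%:R ^+ 2 :> R by rewrite sqr_sqrtr.
  have : Num.sqrt n.+1%:R != 0 :> R by rewrite sqrtr_eq0 -ltNge.
  by move: (Num.sqrt _) => x x0; field.
have sqS u n := square_integrable_partial_sum (form_indep u) (form_law u) (form_sqr u) n.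
have coordZ n w j : (Num.sqrt n%:R *: mean n w) j 0 =
    Num.sqrt n%:R / n%:R * partial_sum (form (e j)) n w.
  by rewrite coordE dotZ mulrCA mulrC mulrAC.
(* The trace of [Gamma] bounds all second moments at once: that of coordinate [j] is [Gamma j j], or
   0 when [n = 0]. *)
apply: (@cvg_in_distribution_cos _ _ _ _ _ _ _ (\sum_j Gamma j j)).
- move=> n j; under eq_fun do rewrite coordZ.
  by apply: measurable_funM => //; exact: (sqS _ _).1.
- move=> n j; under [fun w => _ ^+ 2]eq_fun do rewrite coordZ.
  split; first exact: (square_integrable_scale _ (sqS (e j) n)).2.
  under eq_Rintegral do rewrite exprMn.
  rewrite RintegralZl//; last exact: (sqS (e j) n).2.
  rewrite Rintegral_sqr_partial_sum// form_var quad_delta.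
  apply: (@le_trans _ _ (Gamma j j)); last first.
    by rewrite (bigD1 j)//= lerDl; exact: sumr_ge0.
  case: n => [|n]; first by rewrite mul0r mulr0.
  rewrite expr_div_n sqr_sqrtr// mulrA.
  have n0 : n.+1%:R != 0 :> R by [].
  by move: (n.+1%:R) n0 => x x0; rewrite le_eqVlt; apply/orP; left; apply/eqP; field.
- move=> j; have [i1 i2] := gaussian_forms_square NP j; split=> //.
  rewrite i2 -Gs (bigD1 j)//= lerDl; exact: sumr_ge0.
- move=> u b; rewrite -cvg_shiftS (gaussian_forms_cos NP).
  have := cos_central_limit (form_indep u) (form_law u) (form_sqr u) (form_mean u) (b := b).
  rewrite form_var -Gs; apply: cvg_trans; apply: near_eq_cvg; apply: nearW => n.
  by apply: eq_Rintegral => w _; rewrite dotZS.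
Qed.

End iid_vectors.

(** * The shape invariant model *)

Section periodic_integral.
Context (R : realType).
Local Notation mu := (@lebesgue_measure R).
Local Open Scope ereal_scope.

Lemma lebesgue_integral_translate (F : R -> \bar R) (a b c : R) :
  measurable_fun setT F -> (forall x, 0 <= F x) ->
  \int[mu]_(x in `[a, b[) F (x + c)%R = \int[mu]_(x in `[(a + c)%R, (b + c)%R[) F x.
Proof.
move=> mF F0; rewrite [LHS]integral_mkcond [RHS]integral_mkcond.
rewrite [RHS](@lebesgue_ge0_integral_affine _ 1 c)//.
- rewrite normr1 mul1e; apply: eq_integral => x _; rewrite !patchE mul1r.
  by rewrite !mem_setE/= !in_itv/= lerD2r ltrD2r.
- exact/(measurable_restrictT _ _).1/measurable_funTS.
- by move=> x; rewrite patchE; case: ifP.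
Qed.

(** Both intervals are cut into two, at [a + 1] and at [a + c]; one piece is common and the others
    are translates by 1. Half-open intervals keep the pieces disjoint. *)
Lemma lebesgue_integral_period (F : R -> \bar R) (a c : R) :
  measurable_fun setT F -> (forall x, 0 <= F x) ->
  (forall x, F (x + 1)%R = F x) -> (0 <= c <= 1)%R ->
  \int[mu]_(x in `[(a + c)%R, (a + c + 1)%R[) F x = \int[mu]_(x in `[a, (a + 1)%R[) F x.
Proof.
move=> mF F0 F1 /andP[c0 c1].
have split (x y z : R) : (x <= y)%R -> (y <= z)%R -> \int[mu]_(t in `[x, z[) F t =
    \int[mu]_(t in `[x, y[) F t + \int[mu]_(t in `[y, z[) F t.
  move=> xy yz; rewrite -ge0_integral_setU//=.
  - by congr (integral _ _ _); rewrite -itv_bndbnd_setU.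
  - exact: measurable_funTS.
  - rewrite disj_set2E; apply/eqP/seteqP; split=> // t [] /=.
    by rewrite !in_itv/= => /andP[_ ty] /andP[yt _]; have := lt_le_trans ty yt; rewrite ltxx.
rewrite (split _ (a + 1)%R); [|lra|lra].
rewrite [RHS](split _ (a + c)%R); [|lra|lra].
rewrite addeC; congr (_ + _).
rewrite -addrA [(c + 1)%R]addrC addrA -[X in _ = X](_ : \int[mu]_(x in `[a, (a + c)%R[) F (x + 1)%R = _).
  by rewrite lebesgue_integral_translate// addrAC.
by apply: eq_integral => x _; rewrite F1.
Qed.

Lemma lebesgue_integral_periodic_translate (F : R -> \bar R) (c : R) :
  measurable_fun setT F -> (forall x, 0 <= F x) ->
  (forall x, F (x + 1)%R = F x) -> (`|c| <= 1)%R ->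
  \int[mu]_(x in `[(- 2^-1)%R, 2^-1%R]) F (x - c)%R =
  \int[mu]_(x in `[(- 2^-1)%R, 2^-1%R]) F x.
Proof.
move=> mF F0 F1 c1.
have mFc : measurable_fun setT (fun x : R => F (x - c)%R).
  by apply: (measurableT_comp mF); exact: measurable_funB.
rewrite -!integral_itv_bndo_bndc; try exact: measurable_funTS.
rewrite lebesgue_integral_translate//.
have h : (2^-1 = - 2^-1 + 1 :> R)%R by field.
rewrite {2 4}h; have [c0|c0] := leP 0%R c.
  rewrite -[in RHS](subrK c (- 2^-1)%R) lebesgue_integral_period//.
    by congr (integral _ _ _); congr [set` Interval _ (BSide _ _)]; rewrite addrAC.
  by rewrite c0 (le_trans (ler_norm _) c1).
rewrite [in LHS](addrAC _ 1%R) lebesgue_integral_period//.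
by rewrite oppr_ge0 (ltW c0) -[leLHS]gtr0_norm ?oppr_gt0// normrN.
Qed.

End periodic_integral.

(** The inverse is continuous off 0, and [0^-1 = 0] makes it equal to its restriction to that open
    set. *)
Lemma measurable_inv (R : realType) : measurable_fun setT (fun x : R => x^-1).
Proof.
pose D := [set x : R | x != 0].
have -> : (fun x : R => x^-1) = (fun x : R => x^-1) \_ D.
  apply/funext => x; rewrite patchE; case: ifPn => //.
  by rewrite notin_setE /D/= => /negP; rewrite negbK => /eqP->; rewrite invr0.
have oD : open D.
  have -> : D = ~` [set 0] by apply/seteqP; split=> x /=; [move/eqP|move/eqP].
  exact/closed_openC/closed_eq.
apply/(measurable_restrictT _ _).1; first exact: open_measurable.
apply: open_continuous_measurable_fun => // x; rewrite inE => /= x0.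
exact: inv_continuous.
Qed.

(** * Weighting by the inverse density of the design *)

Section inverse_density.
Context d (Omega : measurableType d) (R : realType) (P : probability Omega R).
Local Notation mu := (@lebesgue_measure R).
Local Notation I := (`[(- 2^-1 : R), 2^-1]).
Context (g : R -> R).
Hypotheses (g_out : forall x, x \notin I -> g x = 0)
  (g_pos : forall x, x \in I -> 0 < g x)
  (g_cont : {within [set` I], continuous g}).

Let unit_length : mu [set` I] = 1%E.
Proof.
rewrite lebesgue_measure_itv/= lte_fin ifT; last by lra.
by rewrite -EFinD; congr (_%:E); field.
Qed.

Let finite_length : (mu [set` I] < +oo)%E.
Proof. by rewrite unit_length ltry. Qed.

Let integral_unit_cst (c : R) : (\int[mu]_(x in [set` I]) c%:E = c%:E)%E.
Proof.
transitivity (c%:E * mu [set` I])%E; last by rewrite unit_length mule1.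
by apply: integral_cst; exact: measurable_itv.
Qed.

Lemma measurable_density : measurable_fun setT g.
Proof.
have mg : measurable_fun [set` I] g by exact: subspace_continuous_measurable_fun.
have -> : g = g \_ [set` I].
  apply/funext => x; rewrite patchE mem_setE; case: ifPn => //; exact: g_out.
exact/(measurable_restrictT _ _).1.
Qed.

Lemma density_ge0 x : 0 <= g x.
Proof. by have [/g_pos/ltW//|/g_out->] := boolP (x \in I). Qed.

(** The continuous positive [g] attains a positive minimum on the segment. Outside it, [g] is 0 and
    so is its inverse, by convention. *)
Lemma inverse_density_bounded : exists M, forall x, `|(g x)^-1| <= M.
Proof.
have ab : (- 2^-1 : R) <= 2^-1 by lra.
have [c cI cP] := EVT_min ab g_cont.
exists (g c)^-1 => x; have [xI|xI] := boolP (x \in I); last first.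
  by rewrite g_out// invr0 normr0 invr_ge0 density_ge0.
by rewrite ger0_norm ?invr_ge0 ?density_ge0// lef_pV2 ?posrE ?g_pos ?cP.
Qed.

Lemma measurable_inverse_density : measurable_fun setT (fun x => (g x)^-1).
Proof.
exact: (measurableT_comp (@measurable_inv R) measurable_density).
Qed.

Context (X : {RV P >-> R}) (X_density : has_density X g).

(** The density cancels the weight on the segment and is 0 elsewhere, so the weighted design behaves
    as a uniform one. *)
Lemma ge0_expectation_inverse_density (phi : R -> R) : measurable_fun setT phi ->
  (forall x, 0 <= phi x) ->
  (\int[P]_w (phi (X w) / g (X w))%:E = \int[mu]_(x in [set` I]) (phi x)%:E)%E.
Proof.
move=> mphi phi0.
have mX0 : measurable_fun setT X by [].
have mX : measurable_fun setT (X : Omega -> measurableTypeR R) := mX0.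
pose nu := distribution P (measurable_function mX).
have mh : measurable_fun setT (fun x => (phi x / g x)%:E).
  apply/measurable_EFinP; apply: measurable_funM => //.
  exact: measurable_inverse_density.
have h0 x : (0 <= (phi x / g x)%:E)%E by rewrite lee_fin divr_ge0// density_ge0.
rewrite -(@ge0_integral_distribution _ _ _ _ _ P (measurable_function mX)
  (fun x => (phi x / g x)%:E))//.
rewrite (@ge0_integral_density _ _ _ mu nu g measurable_density density_ge0 X_density)//.
rewrite [RHS]integral_mkcond; apply: eq_integral => x _; rewrite patchE mem_setE.
case: ifPn => xI; last by rewrite g_out// mule0.
by rewrite -EFinM divfK// gt_eqF ?g_pos.
Qed.

Lemma integrable_inverse_density (phi : R -> R) M : measurable_fun setT phi ->
  (forall x, `|phi x| <= M) -> P.-integrable setT (EFin \o (fun w => phi (X w) / g (X w))).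
Proof.
move=> mphi phiM; have [K gK] := inverse_density_bounded.
apply: (@Rintegrable_bounded _ _ _ _ _ (M * K)) => [|w].
  apply: measurable_funM; first exact: measurableT_comp.
  exact: (measurableT_comp measurable_inverse_density).
by rewrite normrM ler_pM.
Qed.

Lemma expectation_inverse_density : \int[P]_w (g (X w))^-1 = 1.
Proof.
have i1 : P.-integrable setT (EFin \o (fun w => 1 / g (X w))).
  by apply: (@integrable_inverse_density (cst 1) `|1|).
have := ge0_expectation_inverse_density (@measurable_cst _ _ _ _ setT (1 : R)) (fun=> ler01).
rewrite [X in _ = X -> _](integral_unit_cst 1) /= EFin_Rintegral// => -[].
by under eq_Rintegral do rewrite div1r.
Qed.

(** The identities for nonnegative functions are applied to [f + H], where [H] bounds [|f|];
    translating by [c] does not change the integral over a period, and the contribution of [H] is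
    then removed since the weights have mean 1. *)
Lemma expectation_periodic_inverse_density (f : R -> R) (c : R) :
  measurable_fun setT f -> bounded_fun f -> periodic f 1 ->
  \int[mu]_(x in [set` I]) f x = 0 -> `|c| <= 1 ->
  \int[P]_w (f (X w - c) / g (X w)) = 0.
Proof.
move=> mf [H [_ hH]] f1 fint c1.
have {hH} fM x : `|f x| <= H + 1 by apply: hH; rewrite ?ltrDl.
move: (H + 1) fM => {}H fM.
have mfc : measurable_fun setT (fun x : R => f (x - c)).
  by apply: (measurableT_comp mf); exact: measurable_funB.
have F0 x : 0 <= f x + H by rewrite -lerBlDr sub0r; have := fM x; rewrite ler_norml => /andP[].
have mF : measurable_fun setT (fun x => f x + H) by exact: measurable_funD.
have := ge0_expectation_inverse_density (phi := fun x => f (x - c) + H).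
have mF' : measurable_fun setT (fun x : R => f (x - c) + H) by exact: measurable_funD.
move=> /(_ mF' (fun x => F0 _)).
rewrite (@lebesgue_integral_periodic_translate _ (fun x => (f x + H)%:E))//; last 2 first.
- exact/measurable_EFinP.
- by move=> x; rewrite f1.
have ifI : mu.-integrable [set` I] (EFin \o f).
  apply: measurable_bounded_integrable => //.
  - exact: measurable_funTS.
  - exists H; split=> [|y Hy x _]; first exact: num_real.
    by rewrite /= (le_trans (fM x))// ltW.
have -> : (\int[mu]_(x in [set` I]) (f x + H)%:E = H%:E)%E.
  have icI : mu.-integrable [set` I] (EFin \o cst H).
    apply: measurable_bounded_integrable => //.
    exists `|H|; split=> [|y Hy x _]; first exact: num_real.
    exact: ltW.
  have mI : measurable ([set` I] : set (measurableTypeR R)) by exact: measurable_itv.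
  have := @integralD _ _ _ mu _ mI _ _ ifI icI.
  rewrite [X in _ = (_ + X)%E -> _](integral_unit_cst H).
  have -> : (\int[mu]_(x in [set` I]) (EFin \o f) x = 0)%E.
    have := @integrable_fin_num _ _ _ mu _ mI _ ifI.
    by move=> /fineK <-; congr (_%:E).
  by rewrite add0e.
have i1 := integrable_inverse_density mfc (fun x => fM _).
have i2 : P.-integrable setT (EFin \o (fun w => H / g (X w))).
  by apply: (@integrable_inverse_density (cst H) `|H|).
rewrite EFin_Rintegral; last first.
  under [fun w => _ / _]eq_fun do rewrite mulrDl; exact: Rintegrable_add.
move=> -[]; under eq_Rintegral do rewrite mulrDl.
rewrite RintegralD//.
have i0 : P.-integrable setT (EFin \o (fun w => (g (X w))^-1)).
  have := @integrable_inverse_density (cst 1) `|1|.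
  under [fun w => _ / _]eq_fun do rewrite div1r.
  by apply.
rewrite RintegralZl// expectation_inverse_density mulr1 => h.
by apply: (addIr H); rewrite add0r.
Qed.

End inverse_density.

(** * Independence, common law and covariance of the residuals *)

Section shape_invariant_residuals.
Context d (Omega : measurableType d) (R : realType) (P : probability Omega R).
Context (p : nat) (g f : R -> R) (a theta v : 'cV[R]_p).
Local Notation I := (`[(- 2^-1 : R), 2^-1]).
Hypotheses (g_out : forall x, x \notin I -> g x = 0)
  (g_pos : forall x, x \in I -> 0 < g x)
  (g_cont : {within [set` I], continuous g})
  (f_meas : measurable_fun setT f) (f_bounded : bounded_fun f)
  (f_periodic : periodic f 1)
  (f_int0 : \int[lebesgue_measure]_(x in [set` I]) f x = 0)
  (theta_le : forall j, `|theta j 0| <= 1).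
Context (X : nat -> {RV P >-> R}) (eps : nat * 'I_p -> {RV P >-> R}).
Hypotheses (X_indep : mutually_independent X)
  (X_density : forall i, has_density (X i) g)
  (eps_indep : mutually_independent eps)
  (eps_X_indep : independent_families eps X)
  (eps_int : forall ij, P.-integrable setT (EFin \o eps ij))
  (eps_sqr : forall ij, P.-integrable setT (EFin \o (fun w => eps ij w ^+ 2)))
  (eps_mean : forall ij, \int[P]_w eps ij w = 0).

Definition residual (x : R) (e : 'I_p -> R) : 'cV[R]_p :=
  (g x)^-1 *: sim_response f a theta v x e - v.

Lemma residualE x e j : residual x e j 0 =
  a j 0 * (f (x - theta j 0) / g x) + v j 0 * (g x)^-1 + (g x)^-1 * e j - v j 0.
Proof. by rewrite /residual /sim_response !mxE; ring. Qed.

Let mginv : measurable_fun setT (fun x => (g x)^-1).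
Proof. exact: measurable_inverse_density. Qed.

Lemma measurable_residual d' (T : measurableType d') (x : T -> R)
    (e : T -> 'I_p -> R) (j : 'I_p) :
  measurable_fun setT x -> (forall j, measurable_fun setT (fun t => e t j)) ->
  measurable_fun setT (fun t => residual (x t) (e t) j 0).
Proof.
move=> mx me; under eq_fun do rewrite residualE.
have mgx : measurable_fun setT (fun t => (g (x t))^-1) by exact: (measurableT_comp mginv mx).
apply: measurable_funB => //; apply: measurable_funD; last exact: measurable_funM.
apply: measurable_funD; last exact: measurable_funM.
apply: measurable_funM => //; apply: measurable_funM => //.
by apply: (measurableT_comp f_meas); exact: measurable_funB.
Qed.

Let xi i w := residual (X i w) (fun j => eps (i, j) w).

Let mxi i j : measurable_fun setT (fun w => xi i w j 0).
Proof. by apply: measurable_residual. Qed.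

Let independent_noise i j : independent_pair P (fun w => (g (X i w))^-1) (eps (i, j)).
Proof.
move=> S T mS mT; rewrite setIC [RHS]muleC; apply: eps_X_indep.
- apply: sub_sigma_algebra; exists (i, j) => //=; exists T => //; exact: setTI.
- apply: sub_sigma_algebra; exists i => //=.
  exists ((fun x => (g x)^-1) @^-1` S); last exact: setTI.
  by rewrite -[X in measurable X]setTI; exact: mginv.
Qed.

Lemma residual_square_integrable i j : square_integrable P (fun w => xi i w j 0).
Proof.
have [K gK] := inverse_density_bounded g_out g_pos g_cont.
have [H [_ hH]] := f_bounded.
have fM x : `|f x| <= H + 1 by apply: hH; rewrite ?ltrDl.
under eq_fun do rewrite /xi residualE.
have mgX : measurable_fun setT (fun w => (g (X i w))^-1) by exact: (measurableT_comp mginv).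
have bounded_sq (h : Omega -> R) M : measurable_fun setT h -> (forall w, `|h w| <= M) ->
    square_integrable P h.
  move=> mh hM; have := square_integrable_bounded_mul mh hM (square_integrable_cst P 1).
  by under eq_fun do rewrite mulr1.
apply: square_integrable_add; last exact: square_integrable_cst.
apply: square_integrable_add; last first.
  by apply: (@square_integrable_bounded_mul _ _ _ _ _ _ K).
apply: square_integrable_add; last first.
  by apply: square_integrable_scale; apply: (bounded_sq _ K).
apply: square_integrable_scale; apply: (bounded_sq _ ((H + 1) * K)) => [|w].
  apply: measurable_funM => //.
  by apply: (measurableT_comp f_meas); exact: measurable_funB.
by rewrite normrM ler_pM.
Qed.

Lemma residual_mean i j : \int[P]_w xi i w j 0 = 0.
Proof.
have [H [_ hH]] := f_bounded.
have fM x : `|f x| <= H + 1 by apply: hH; rewrite ?ltrDl.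
have mfc : measurable_fun setT (fun x : R => f (x - theta j 0)).
  by apply: (measurableT_comp f_meas); exact: measurable_funB.
have if_ : P.-integrable setT (EFin \o (fun w => f (X i w - theta j 0) / g (X i w))).
  apply: (integrable_inverse_density g_out g_pos g_cont (X i)
    (phi := fun x => f (x - theta j 0)) (M := H + 1)) => //.
have ig : P.-integrable setT (EFin \o (fun w => (g (X i w))^-1)).
  have := @integrable_inverse_density _ _ _ P g g_out g_pos g_cont (X i) (cst 1) `|1|.
  under [fun w => _ / _]eq_fun do rewrite div1r.
  by apply.
have ie : P.-integrable setT (EFin \o (fun w => (g (X i w))^-1 * eps (i, j) w)).
  exact: (integrable_mul_independent ig (eps_int (i, j)) (independent_noise i j)).
have i1 := Rintegrable_scale (a j 0) if_.
have i2 := Rintegrable_scale (v j 0) ig.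
rewrite /xi; under eq_Rintegral do rewrite residualE.
rewrite RintegralB//; last 2 first.
- by apply: Rintegrable_add => //; exact: Rintegrable_add.
- exact: Rintegrable_cst.
rewrite RintegralD//; last exact: Rintegrable_add.
rewrite RintegralD// RintegralZl// RintegralZl//.
rewrite (Rintegral_mul_independent ig (eps_int (i, j)) (independent_noise i j)) eps_mean.
rewrite (expectation_periodic_inverse_density g_out g_pos g_cont (X_density i))//.
rewrite (expectation_inverse_density g_out g_pos g_cont (X_density i)).
by rewrite Rintegral_probability_cst; ring.
Qed.

Let measurable_linear_form u i : measurable_fun setT (fun w => dot u (xi i w)).
Proof. by apply: measurable_sum => j; apply: measurable_funM => //; exact: mxi. Qed.

Definition residual_form u i : {RV P >-> R} :=
  measurable_function (measurable_linear_form u i).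

Lemma residual_form_independent u : mutually_independent (residual_form u).
Proof.
have ind := mutually_independent_sum eps_indep X_indep eps_X_indep.
(* Block [i] holds the design [X i] and all the noises [eps (i, j)]. *)
pose D (i : nat) : set ((nat * 'I_p) + nat) :=
  [set k | match k with inl ij => ij.1 = i | inr i' => i' = i end].
apply: (mutually_independent_blocks ind (D := D)).
- move=> i i' ii'; apply/seteqP; split=> // -[[k j]|k] [] /= -> e; by move: ii'; rewrite e eqxx.
move=> i B mB.
(* On [Omega] with only the events of block [i], measurability of the form is exactly the membership
   to be shown. *)
pose T := g_sigma_algebraType
  (\bigcup_(k in D i) preimage_set_system setT (sum_family eps X k) measurable).
have mk k : D i k -> measurable_fun (setT : set T) (sum_family eps X k).
  move=> Dk _ C mC; rewrite setTI; apply: sub_sigma_algebra.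
  by exists k => //; exists C => //; rewrite setTI.
have mform : measurable_fun (setT : set T) (fun w => dot u (xi i w)).
  apply: measurable_sum => j; apply: measurable_funM => //.
  apply: measurable_residual => [|k].
  - exact: (mk (inr i)).
  - exact: (mk (inl (i, k))).
by have := mform measurableT B mB; rewrite setTI.
Qed.

Context (X0 : {RV P >-> R}) (eps0 : 'I_p -> {RV P >-> R}).
Hypothesis X0_eps0_law : forall i, same_distribution P
  (fun w => (X0 w, [tuple eps0 j w | j < p]))
  (fun w => (X i w, [tuple eps (i, j) w | j < p])).

(** Design point and noise vector are taken as one random element, since the hypothesis on laws
    concerns them jointly. *)
Let design0 w := (X0 w, [tuple eps0 j w | j < p]).
Let design i w := (X i w, [tuple eps (i, j) w | j < p]).

Let mdesign0 : measurable_fun setT design0.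
Proof.
apply: measurable_fun_pair => //; apply/measurable_fun_tnthP => j.
by rewrite (_ : _ \o _ = eps0 j)//; apply/funext => w /=; rewrite tnth_mktuple.
Qed.

Let mdesign i : measurable_fun setT (design i).
Proof.
apply: measurable_fun_pair => //; apply/measurable_fun_tnthP => j.
by rewrite (_ : _ \o _ = eps (i, j))//; apply/funext => w /=; rewrite tnth_mktuple.
Qed.

Let residual_design (t : R * p.-tuple R) := residual t.1 (tnth t.2).

Let mresidual_design j : measurable_fun setT (fun t => residual_design t j 0).
Proof.
apply: measurable_residual => // k.
exact: (measurableT_comp (measurable_tnth k) measurable_snd).
Qed.

Let residual_designE i w : residual_design (design i w) = xi i w.
Proof.
rewrite /residual_design /design/=; congr (residual _ _).
by apply/funext => j; rewrite tnth_mktuple.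
Qed.

(** Both forms are the same measurable function of their designs, and both designs have the law of
    [design0]. *)
Lemma residual_form_law u i :
  same_distribution P (residual_form u i) (residual_form u 0).
Proof.
pose F t := dot u (residual_design t).
have mF : measurable_fun setT F.
  by apply: measurable_sum => j; apply: measurable_funM => //; exact: mresidual_design.
have E k : residual_form u k = F \o design k :> (Omega -> R).
  by apply/funext => w; rewrite /F /= residual_designE.
move=> B mB.
have mFB : measurable (F @^-1` B) by rewrite -[X in measurable X]setTI; exact: mF.
have EB k : residual_form u k @^-1` B = design k @^-1` (F @^-1` B) by rewrite E.
rewrite !EB.
exact: (etrans (esym (@X0_eps0_law i _ mFB)) (@X0_eps0_law 0 _ mFB)).
Qed.

Let Y0 w := sim_response f a theta v (X0 w) (fun j => eps0 j w).
Let Gamma := covariance_matrix P (fun w => (g (X0 w))^-1 *: Y0 w).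

(** Expectations are moved from [design0] to the observation of index 0. As the residuals are
    centered, [v] is the mean of the weighted response, so centering it yields the residual. *)
Lemma residual_covariance j k : Gamma j k = \int[P]_w (xi 0 w j 0 * xi 0 w k 0).
Proof.
have Z0E w l : ((g (X0 w))^-1 *: Y0 w) l 0 = residual_design (design0 w) l 0 + v l 0.
  rewrite /residual_design /design0/= /residual.
  have -> : tnth [tuple eps0 j w | j < p] = (fun j => eps0 j w).
    by apply/funext => i; rewrite tnth_mktuple.
  have sub (A : 'cV[R]_p) : (A - v) l 0 = A l 0 - v l 0 by rewrite !mxE.
  by rewrite sub subrK.
have transfer (h : R * p.-tuple R -> R) : measurable_fun setT h ->
    P.-integrable setT (EFin \o (h \o design 0)) ->
    P.-integrable setT (EFin \o (h \o design0)) /\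
    \int[P]_w h (design0 w) = \int[P]_w h (design 0 w).
  move=> mh ih; split.
  - exact: (equal_law_integrable mdesign0 (mdesign 0) (@X0_eps0_law 0) mh ih).
  - exact: (equal_law_Rintegral mdesign0 (mdesign 0) (@X0_eps0_law 0) mh ih).
have mean0 l : fine 'E_P[fun w => ((g (X0 w))^-1 *: Y0 w) l 0] = v l 0.
  have [|i0 E0] := transfer _ (mresidual_design l).
    rewrite (_ : _ \o _ = (fun w => xi 0 w l 0)).
      exact: square_integrable_int (residual_square_integrable 0 l).
    by apply/funext => w /=; rewrite residual_designE.
  rewrite unlock -[LHS]/(\int[P]_w ((g (X0 w))^-1 *: Y0 w) l 0).
  under eq_Rintegral do rewrite Z0E.
  rewrite RintegralD//; last exact: Rintegrable_cst.
  rewrite E0 Rintegral_probability_cst.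
  by under eq_Rintegral do rewrite residual_designE; rewrite residual_mean add0r.
rewrite /Gamma mxE covariance.unlock !mean0 expectation.unlock.
rewrite -[LHS]/(\int[P]_w ((((g (X0 w))^-1 *: Y0 w) j 0 - v j 0) *
  (((g (X0 w))^-1 *: Y0 w) k 0 - v k 0))).
under eq_Rintegral do rewrite !Z0E !addrK.
have mjk := measurable_funM (mresidual_design j) (mresidual_design k).
have [|_ ->] := transfer _ mjk.
  rewrite (_ : _ \o _ = (fun w => xi 0 w j 0 * xi 0 w k 0)).
    exact: square_integrable_mul (residual_square_integrable 0 j)
      (residual_square_integrable 0 k).
  by apply/funext => w /=; rewrite residual_designE.
by apply: eq_Rintegral => w _ /=; rewrite residual_designE.
Qed.

Lemma residual_form_square_integrable u :
  square_integrable P (fun w => residual_form u 0 w).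
Proof.
apply: square_integrable_sum => j; apply: square_integrable_scale.
exact: residual_square_integrable.
Qed.

Lemma residual_form_mean u : \int[P]_w residual_form u 0 w = 0.
Proof.
have ij j : P.-integrable setT (EFin \o (fun w => u j 0 * xi 0 w j 0)).
  apply: Rintegrable_scale; apply: square_integrable_int.
  exact: residual_square_integrable.
rewrite /= /dot Rintegral_sum// big1// => j _.
rewrite RintegralZl//; first by rewrite residual_mean mulr0.
exact: square_integrable_int (residual_square_integrable 0 j).
Qed.

Lemma residual_form_variance u : \int[P]_w residual_form u 0 w ^+ 2 = quad Gamma u.
Proof.
have ijk j k : P.-integrable setT (EFin \o (fun w => xi 0 w j 0 * xi 0 w k 0)).
  exact: square_integrable_mul (residual_square_integrable 0 j)
    (residual_square_integrable 0 k).
have E w : residual_form u 0 w ^+ 2 =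
    \sum_j \sum_k (u j 0 * u k 0) * (xi 0 w j 0 * xi 0 w k 0).
  rewrite /= /dot expr2 big_distrlr/=; apply: eq_bigr => j _.
  by apply: eq_bigr => k _; ring.
under eq_Rintegral do rewrite E.
have isum j : P.-integrable setT (EFin \o (fun w =>
    \sum_k (u j 0 * u k 0) * (xi 0 w j 0 * xi 0 w k 0))).
  by apply: Rintegrable_sum => k; exact: Rintegrable_scale.
have -> : quad Gamma u = \sum_j \sum_k (u j 0 * u k 0) * Gamma j k.
  rewrite /quad mxE; move: Gamma => S.
  under eq_bigr do rewrite mxE mulr_suml.
  rewrite exchange_big; apply: eq_bigr => j _; apply: eq_bigr => k _.
  by rewrite mxE mulrAC.
rewrite Rintegral_sum//; apply: eq_bigr => j _.
rewrite Rintegral_sum => [|k]; last exact: Rintegrable_scale.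
by apply: eq_bigr => k _; rewrite RintegralZl// residual_covariance.
Qed.

End shape_invariant_residuals.

Theorem theorem3p1 (R : realType) (d : measure_display)
    (Omega : measurableType d) (P : probability Omega R)
    (p : nat) (p_ge2 : (2 <= p)%N)
    (g : R -> R)
    (g_out : forall x : R, x \notin `[- 2^-1, 2^-1] -> g x = 0)
    (g_pos : forall x : R, x \in `[- 2^-1, 2^-1] -> 0 < g x)
    (g_cont : {within `[- 2^-1, 2^-1], continuous g})
    (g_diff : exists g1 g2 : R -> R,
       [/\ has_derivative_within `[- 2^-1, 2^-1] g g1,
           has_derivative_within `[- 2^-1, 2^-1] g1 g2,
           [bounded g1 x | x in `[- 2^-1, 2^-1] : set R] &
           [bounded g2 x | x in `[- 2^-1, 2^-1] : set R]])
    (f : R -> R)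
    (f_meas : measurable_fun [set: R] f)
    (f_sym : forall x, f (- x) = f x)
    (f_bounded : bounded_fun f)
    (f_periodic : periodic f 1)
    (f_int0 : \int[lebesgue_measure]_(x in `[- 2^-1, 2^-1]) f x = 0)
    (a theta v : 'cV[R]_p)
    (a_neq0 : forall j, a j 0 != 0)
    (a_first : forall j : 'I_p, j = 0%N :> nat -> a j 0 = 1)
    (theta_first : forall j : 'I_p, j = 0%N :> nat -> theta j 0 = 0)
    (theta_lt : \big[Num.max/0]_(j < p) `|theta j 0| < 4^-1)
    (X : nat -> {RV P >-> R})
    (X_indep : mutually_independent X)
    (X_density : forall i, has_density (X i) g)
    (eps : nat * 'I_p -> {RV P >-> R})
    (eps_indep : mutually_independent eps)
    (eps_X_indep : independent_families eps X)
    (sigma : 'I_p -> R)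
    (eps_mean : forall i j, ('E_P[eps (i, j)] = 0)%E)
    (eps_var : forall i j,
       ('E_P[(fun w => eps (i, j) w ^+ 2)%R] = (sigma j ^+ 2)%:E)%E)
    (eps_ident : forall i i' j,
       same_distribution P (eps (i, j)) (eps (i', j)))
    (X0 : {RV P >-> R}) (eps0 : 'I_p -> {RV P >-> R})
    (X0_eps0_law : forall i, same_distribution P
       (fun w => (X0 w, [tuple eps0 j w | j < p]))
       (fun w => (X i w, [tuple eps (i, j) w | j < p]))) :
  let Y i w := sim_response f a theta v (X i w) (fun j => eps (i, j) w) in
  let Y0 w := sim_response f a theta v (X0 w) (fun j => eps0 j w) in
  let vhat := v_hat g (fun i => X i) Y in
  let Gamma := covariance_matrix P (fun w => (g (X0 w))^-1 *: Y0 w) in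
  [/\ {ae P, forall w, vhat n w @[n --> \oo] --> v},
      (exists2 N : probability (borel 'cV[R]_p) R,
         is_multivariate_normal 0 Gamma N &
         cvg_in_distribution P
           (fun n w => Num.sqrt n%:R *: (vhat n w - v)) N) &
      {ae P, forall w,
         (ln n%:R)^-1 *: \sum_(1 <= i < n.+1)
             ((vhat i w - v) *m (vhat i w - v)^T) @[n --> \oo] --> Gamma}].
Proof.
move=> Y Y0 vhat Gamma.
have theta_le j : `|theta j 0| <= 1.
  apply: (@le_trans _ _ (\big[Num.max/0]_(j < p) `|theta j 0|)).
    exact: (le_bigmax _ (fun j => `|theta j 0|)).
  by rewrite ltW// (lt_le_trans theta_lt)//; lra.
have eps_sqr ij : P.-integrable setT (EFin \o (fun w => eps ij w ^+ 2)).
  case: ij => i j; have := eps_var i j; rewrite unlock => E2.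
  apply/integrableP; split.
    by apply/measurable_EFinP; exact: measurable_funX.
  under eq_integral do rewrite /= ger0_norm ?sqr_ge0//.
  by rewrite E2 ltry.
have eps_int ij : P.-integrable setT (EFin \o eps ij).
  by apply: square_integrable_int; split.
have eps_mean0 ij : \int[P]_w eps ij w = 0.
  by case: ij => i j; have := eps_mean i j; rewrite unlock /Rintegral => ->.
pose xi i w := residual g f a theta v (X i w) (fun j => eps (i, j) w).
pose form := residual_form a theta v g_out g_cont f_meas X eps.
have formE u i w : form u i w = dot u (xi i w) by [].
(* At [n = 0] the left side is [- v] and the right side 0. The exception is harmless: the factor
   [Num.sqrt 0] cancels it in the central limit theorem, and the sums of the quadratic law start at
   1. *)
have vhatE n w : (0 < n)%N -> vhat n w - v = sample_mean xi n w.
  move=> n0; apply/matrixP => j k; rewrite (ord1 k).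
  have sub (A : 'cV[R]_p) : (A - v) j 0 = A j 0 - v j 0 by rewrite !mxE.
  rewrite sub /vhat /v_hat mxE /sample_mean mxE summxE.
  under [in RHS]eq_bigr do rewrite /xi /residual sub mxE mulrC.
  rewrite sumrB sumr_const card_ord mulrBr; congr (_ - _).
  by rewrite -[v j 0 *+ n]mulr_natl mulKf// pnatr_eq0 -lt0n.
have form_indep u : mutually_independent (form u).
  exact: residual_form_independent.
have form_law u i : same_distribution P (form u i) (form u 0).
  exact: (residual_form_law a theta v g_out g_cont f_meas X0_eps0_law).
have form_sqr u : P.-integrable setT (EFin \o (fun w => form u 0 w ^+ 2)).
  by apply: (residual_form_square_integrable a theta v _ _ _ _ _ _ _ u).2.
have form_mean u : \int[P]_w form u 0 w = 0.
  by apply: residual_form_mean.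
have Gamma_sym : Gamma^T = Gamma.
  by apply/matrixP => j k; rewrite !mxE covarianceC.
have form_var u : \int[P]_w form u 0 w ^+ 2 = quad Gamma u.
  by apply: residual_form_variance.
split.
- have := sample_mean_strong_law formE form_indep form_law form_sqr form_mean.
  apply: filterS => w H; apply: cvg_mx => j k; rewrite (ord1 k).
  have : sample_mean xi n w j 0 + v j 0 @[n --> \oo] --> 0 + v j 0.
    by apply: cvgD; [exact: H|exact: cvg_cst].
  rewrite add0r; apply: cvg_trans; apply: near_eq_cvg; near=> n.
  rewrite -vhatE; first by rewrite !mxE subrK.
  by near: n; exact: nbhs_infty_gt.
- have [N N1 N2] := sample_mean_central_limit formE form_indep form_law form_sqr
    form_mean Gamma_sym form_var.
  exists N => //.
  rewrite (_ : (fun n w => _) = (fun n w => Num.sqrt n%:R *: sample_mean xi n w))//.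
  apply/funext => n; apply/funext => w.
  by case: n => [|n]; [rewrite sqrtr0 !scale0r|rewrite vhatE].
- have := sample_mean_quadratic_strong_law formE form_indep form_law form_sqr
    form_mean Gamma_sym form_var.
  apply: filterS => w; apply: cvg_trans; apply: near_eq_cvg; apply: nearW => n.
  congr (_ *: _); rewrite !big_nat; apply: eq_bigr => i /andP[i0 _].
  by rewrite vhatE.
Unshelve. all: by end_near. Qed.
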